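(* Let $1<d<2$ and let $\rho$ be the Weibull$(d)$ distribution. Let $C_{n,n}^\rho$ be the total cost of the stable matching in $K_{n,n}^\rho$. Then there exists a non-Gaussian (and hence non-stable) random variable $\xi_d$ with $\mathrm{Var}(\xi_d)<\infty$ such that, as $n\to\infty$, the centred total cost $C_{n,n}^\rho-\mathbb{E}\,C_{n,n}^\rho$ converges in distribution to $\xi_d$ and $\mathrm{Var}(C_{n,n}^\rho)\to\mathrm{Var}(\xi_d)$.
   Context: The Weibull$(d)$ distribution has density $d x^{d-1}e^{-x^d}$, $x\ge 0$. $K_{n,n}^\rho$ is the complete bipartite graph with vertex sets $V_n,V_n'$, each of size $n$, whose edges $e=(v,v')$, $v\in V_n$, $v'\in V_n'$, carry i.i.d. non-negative costs $\omega(e)$ with distribution $\rho$. A matching is a set of pairwise non-adjacent edges. The matching cost of a vertex is the cost of the edge of the matching incident to it (and $\infty$ if it is unmatched). A matching is stable if for every pair $v\in V_n$, $v'\in V_n'$, either $v$ and $v'$ are matched to each other or at least one of them has matching cost smaller than $\omega(v,v')$. Almost surely there is a unique stable matching; it is perfect and is obtained by the greedy algorithm which repeatedly adds the cheapest edge among those with both endpoints still unmatched. Its total cost $C_{n,n}^\rho$ is the sum of the costs of its $n$ edges. A random variable $X$ has a stable distribution if for any $n\ge2$ there are constants $a_n>0$ and $b_n\in\mathbb{R}$ such that $\sum_{i=1}^n X_i$ equals $a_nX+b_n$ in distribution, where $X_1,\dots,X_n$ are independent copies of $X$; ''non-stable'' means not having a stable distribution. *)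

(* Defs.v *)
From HB Require Import structures.
From mathcomp Require Import all_boot all_order all_algebra.
From mathcomp Require Import all_classical all_reals all_analysis.
From mathcomp Require Import measurable_realfun.

Set Implicit Arguments.
Unset Strict Implicit.
Unset Printing Implicit Defensive.

Import Order.TTheory GRing.Theory Num.Theory.
Import numFieldNormedType.Exports.

Local Open Scope classical_set_scope.
Local Open Scope ring_scope.

Section weibull.
Context {R : realType}.
Implicit Types d x : R.

Definition weibull_pdf d x : R :=
  if 0 <= x then d * x `^ (d - 1) * expR (- (x `^ d)) else 0.

Definition weibull_prob d : set R -> \bar R :=
  fun A => (\int[lebesgue_measure]_(x in A) (weibull_pdf d x)%:E)%E.

Lemma weibull_pdf_ge0 d x : 0 <= d -> 0 <= weibull_pdf d x.
Proof.
move=> d0; rewrite /weibull_pdf; case: ifPn => // x0.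
by rewrite !mulr_ge0 ?powR_ge0 ?expR_ge0.
Qed.

Lemma weibull_prob_setT d : 1 < d -> weibull_prob d setT = 1%E.
Proof.
move=> d1; have d0 : 0 < d by rewrite (lt_trans _ d1).
have dB0 : 0 < d - 1 by rewrite subr_gt0.
pose F x : R := - expR (- x `^ d).
pose f x : R := d * x `^ (d - 1) * expR (- (x `^ d)).
have F0 : F 0 = -1 by rewrite /F powR0 ?gt_eqF// oppr0 expR0.
have cpow (p x : R) : 0 < x -> {for x, continuous (@powR R ^~ p)}.
  move=> x0; apply: differentiable_continuous; apply/derivable1_diffP.
  by apply: derivable_powR; rewrite in_itv/= x0.
have cexp (u : R -> R) (l : R) (G : set_system R) (FG : Filter G) :
    u x @[x --> G] --> l -> expR (- u x) @[x --> G] --> expR (- l).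
  move=> ul; apply: (cvg_comp _ expR); last exact: continuous_expR.
  exact: cvgN.
have pow0 (p : R) : 0 < p -> x `^ p @[x --> (0:R)^'+] --> (0:R) `^ p.
  by move=> p0; rewrite powR0 ?gt_eqF//; exact: powR_cvg0.
rewrite /weibull_prob.
have -> : (fun x => (weibull_pdf d x)%:E) =
    (fun x => (f x)%:E) \_ (`[0, +oo[%classic : set R).
  apply/funext => x; rewrite /weibull_pdf patchE.
  have -> : (x \in (`[0, +oo[%classic : set R)) = (0 <= x).
    by apply/idP/idP; rewrite inE/= in_itv/= andbT.
  by case: ifP.
rewrite -integral_mkcond (@ge0_continuous_FTC2y _ f F 0 0).
- by rewrite F0 -EFinB sub0r opprK.
- by move=> x x0; rewrite /f !mulr_ge0 ?powR_ge0 ?expR_ge0// ltW.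
- apply/continuous_within_itvcyP; split.
    move=> x; rewrite in_itv/= andbT => x0.
    apply: cvgM; last by apply: cexp; exact: cpow.
    by apply: cvgM; [exact: cvg_cst | exact: cpow].
  apply: cvgM; last by apply: cexp; exact: pow0.
  by apply: cvgM; [exact: cvg_cst | exact: pow0].
- rewrite -[X in _ --> X]oppr0; apply: cvgN.
  apply: (cvg_comp (fun x : R => x `^ d) (fun y => expR (- y))); last first.
    exact: cvgr_expR.
  apply/cvgryPge => A; near=> y.
  have y0 : 0 <= y by near: y; exact: nbhs_pinfty_ge.
  have yA : (Num.max A 0) `^ d^-1 <= y by near: y; exact: nbhs_pinfty_ge.
  have := @ge0_ler_powR R d (ltW d0) _ _ (powR_ge0 _ _) y0 yA.
  rewrite -powRrM mulVf ?gt_eqF// powRr1 ?le_max ?lexx ?orbT//.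
  by apply: le_trans; rewrite le_max lexx.
- move=> x x0; have h := is_derive1_powR d x0; exact: ex_derive.
- by apply: cvgN; apply: cexp; exact: pow0.
- move=> x; rewrite in_itv/= andbT => x0.
  have h := is_derive1_powR d x0.
  rewrite derive1E derive_val /f.
  by rewrite mulrN opprK mulrC.
Unshelve. all: by end_near. Qed.

End weibull.

Section stable_matching.
Context {R : realType} {n : nat}.

(* The vertex [inl i] is the i-th element of V_n, [inr j] the j-th of V_n'. *)
Definition vertex : finType := ('I_n + 'I_n)%type.
Definition edge : finType := ('I_n * 'I_n)%type.

Definition incident (x : vertex) (e : edge) : bool :=
  match x with inl v => e.1 == v | inr v' => e.2 == v' end.

Definition adjacent (e f : edge) : bool :=
  (e != f) && [exists x : vertex, incident x e && incident x f].

Definition is_matching (M : {set edge}) : bool :=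
  [forall e in M, forall f in M, ~~ adjacent e f].

Definition matching_cost (w : edge -> R) (M : {set edge}) (x : vertex) : \bar R :=
  if [pick e in M | incident x e] is Some e then (w e)%:E else +oo%E.

Definition is_stable_matching (w : edge -> R) (M : {set edge}) : bool :=
  is_matching M &&
  [forall v : 'I_n, forall v' : 'I_n,
    [|| (v, v') \in M,
        (matching_cost w M (inl v) < (w (v, v'))%:E)%E
      | (matching_cost w M (inr v') < (w (v, v'))%:E)%E]].

(* There is at most one stable matching, and exactly one if the costs are
   pairwise distinct (lemmas below); the empty set is only taken when ties
   leave no stable matching. *)
Definition stable_matching (w : edge -> R) : {set edge} :=
  odflt finset.set0 [pick M | is_stable_matching w M].

Definition total_cost (w : edge -> R) : R :=
  \sum_(e in stable_matching w) w e.

Lemma matching_incident (M : {set edge}) x e f : is_matching M ->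
  e \in M -> f \in M -> incident x e -> incident x f -> e = f.
Proof.
move=> /forall_inP /(_ e) h eM fM xe xf.
have /forall_inP /(_ f fM) := h eM.
rewrite /adjacent negb_and negbK => /orP[/eqP//|/existsP[]].
by exists x; rewrite xe xf.
Qed.

Lemma matching_costE (w : edge -> R) (M : {set edge}) x e : is_matching M ->
  e \in M -> incident x e -> matching_cost w M x = (w e)%:E.
Proof.
move=> mM eM xe; rewrite /matching_cost; case: pickP => [f /andP[fM xf]|].
  by rewrite (matching_incident mM fM eM xf xe).
by move=> /(_ e); rewrite eM xe.
Qed.

Lemma stable_matching_uniq (w : edge -> R) (M N : {set edge}) :
  is_stable_matching w M -> is_stable_matching w N -> M = N.
Proof.
have blocked (M' : {set edge}) e : is_stable_matching w M' -> e \notin M' ->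
    exists x f, [/\ f \in M', incident x e, incident x f & w f < w e].
  move=> /andP[_ /forallP/(_ e.1)/forallP/(_ e.2)].
  rewrite -surjective_pairing => /orP[-> //|h] _.
  case/orP: h; rewrite /matching_cost; case: pickP => [f /andP[fM xf]|_];
    rewrite ?lte_fin ?ltNge ?leey// -ltNge => wf.
    by exists (inl e.1), f; split => //=.
  by exists (inr e.2), f; split => //=.
wlog suff sub : M N / is_stable_matching w M -> is_stable_matching w N ->
    M \subset N.
  by move=> sM sN; apply/eqP; rewrite finset.eqEsubset !sub.
move=> sM sN; pose D := ((M :\: N) :|: (N :\: M))%SET.
suff D0 e : e \notin D.
  by apply/fintype.subsetP => e eM; move: (D0 e); rewrite !inE eM; case: (e \in N).
apply/negP => eD.
have [e0 e0D min] := @Order.TotalTheory.arg_minP _ R _ e (mem D) w eD.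
have key (A B : {set edge}) : is_stable_matching w A -> is_stable_matching w B ->
    e0 \in A -> e0 \notin B -> exists2 f, f \in B :\: A & w f < w e0.
  move=> sA sB eA eB; have [x [f [fB xe xf wf]]] := blocked B e0 sB eB.
  exists f => //; rewrite finset.in_setD fB andbT; apply/negP => fA.
  have mA : is_matching A by case/andP: sA.
  by move: wf; rewrite (matching_incident mA fA eA xf xe) ltxx.
have [f fD] : exists2 f, f \in D & w f < w e0.
  have : e0 \in D by [].
  rewrite !inE => /orP[]/andP[e1 e2].
    by have [f fD wf] := key _ _ sM sN e2 e1; exists f => //; rewrite finset.in_setU fD orbT.
  by have [f fD wf] := key _ _ sN sM e2 e1; exists f => //; rewrite finset.in_setU fD.
by rewrite ltNge min.
Qed.

Lemma stable_matching_exists (w : edge -> R) : injective w ->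
  exists M, is_stable_matching w M.
Proof.
move=> winj.
suff [M [_ mM h]] : exists M : {set edge}, [/\ M \subset [set: edge]%SET,
    is_matching M & forall e, e \in [set: edge]%SET -> e \in M \/
    exists x, incident x e /\ (matching_cost w M x < (w e)%:E)%E].
  exists M; rewrite /is_stable_matching mM; apply/forallP => v; apply/forallP => v'.
  have [->//|[[u|u]]] := h (v, v') (finset.in_setT _); move=> [/= /eqP -> ->];
    by rewrite ?orbT.
move: [set: edge]%SET => A.
have [k] := ubnP #|A|; elim: k A => // k IH A Ak.
have [->|/set0Pn[e1 e1A]] := eqVneq A finset.set0.
  exists finset.set0; split; first exact: finset.sub0set.
    by apply/forall_inP => e; rewrite inE.
  by move=> e; rewrite inE.
have [e0 e0A min] := @Order.TotalTheory.arg_minP _ R _ e1 (mem A) w e1A.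
pose A' := [set e in A | (e != e0) && ~~ adjacent e0 e]%SET.
have A'A : A' \proper A.
  apply/properP; split; first by apply/fintype.subsetP => e; rewrite inE => /andP[].
  by exists e0 => //; rewrite inE eqxx andbF.
have [|M' [M'A' mM' h']] := IH A'; first exact: leq_trans (proper_card A'A) Ak.
have nadj f : f \in M' -> f != e0 /\ ~~ adjacent e0 f.
  by move=> /(fintype.subsetP M'A'); rewrite inE => /andP[_ /andP].
have adjC e f : adjacent e f = adjacent f e.
  by rewrite /adjacent eq_sym; congr andb; apply: eq_existsb => x; rewrite andbC.
have mM : is_matching (e0 |: M')%SET.
  apply/forall_inP => e; rewrite !inE => /orP[/eqP ->|eM']; apply/forall_inP => f;
    rewrite !inE => /orP[/eqP ->|fM'].
  - by rewrite /adjacent eqxx.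
  - by have [] := nadj _ fM'.
  - by rewrite adjC; have [] := nadj _ eM'.
  - by have /forall_inP/(_ e eM')/forall_inP/(_ f fM') := mM'.
exists (e0 |: M')%SET; split => //.
  apply/fintype.subsetP => e; rewrite !inE => /orP[/eqP -> //|].
  by move/(fintype.subsetP M'A'); rewrite inE => /andP[].
move=> e eA; rewrite !inE.
have [->|ee0 /=] := eqVneq e e0; first by left.
have [adj|nad] := boolP (adjacent e0 e).
  right; move/andP: (adj) => [_ /existsP[x /andP[xe0 xe]]]; exists x; split => //.
  rewrite (matching_costE w mM _ xe0) ?inE ?eqxx// lte_fin lt_neqAle min ?andbT//.
  by apply/eqP => /winj/esym/eqP; apply/negP.
have [|eM'|[x [xe cx]]] := h' e; [by rewrite inE eA ee0 nad|by left|right].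
exists x; split => //; move: cx; rewrite {1}/matching_cost.
case: pickP => [f /andP[fM' xf] wf|_]; last by rewrite ltNge leey.
by rewrite (matching_costE w mM _ xf)// !inE fM' orbT.
Qed.

Lemma stable_matchingP (w : edge -> R) (M : {set edge}) :
  is_stable_matching w M -> stable_matching w = M.
Proof.
move=> sM; rewrite /stable_matching; case: pickP => [N sN|/(_ M)]; last by rewrite sM.
exact: stable_matching_uniq sN sM.
Qed.

End stable_matching.

Arguments edge n : clear implicits.
Arguments vertex n : clear implicits.

Section total_cost_rv.
Context d (T : measurableType d) (R : realType) (P : probability T R) (n : nat).
Variable omega : edge n -> {RV P >-> R}.

Definition stable_cost (t : T) : R := total_cost (fun e => omega e t).

Lemma measurable_forall (I : finType) (f : I -> T -> bool) :
  (forall i, measurable_fun setT (f i)) ->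
  measurable_fun setT (fun t => [forall i, f i t]).
Proof.
move=> mf; apply: (measurable_fun_bool true).
rewrite setTI [X in measurable X](_ : _ =
    \bigcap_(i in [set: I]) (f i @^-1` [set true])).
  apply: fin_bigcap_measurable => // i _.
  by rewrite -[X in measurable X]setTI; exact: mf.
apply/seteqP; split => t /=; first by move/forallP => h i _ /=; exact: h.
by move=> h; apply/forallP => i; exact: (h i Logic.I).
Qed.

Lemma measurable_is_stable_matching M : measurable_fun setT
  (fun t => is_stable_matching (fun e => omega e t) M).
Proof.
apply: measurable_and; first exact: measurable_cst.
apply: measurable_forall => v; apply: measurable_forall => v'.
have mc x : measurable_fun setT
    (fun t => (matching_cost (fun e => omega e t) M x
               < (omega (v, v') t)%:E)%E).
  rewrite /matching_cost; case: pickP => [e _|_].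
    under eq_fun do rewrite lte_fin.
    exact: measurable_fun_ltr.
  under eq_fun do rewrite ltNge leey/=.
  exact: measurable_cst.
apply: measurable_or; first exact: measurable_cst.
exact: measurable_or.
Qed.

Lemma measurable_stable_matching M :
  measurable [set t | stable_matching (fun e => omega e t) = M].
Proof.
pose S t := [set N | is_stable_matching (fun e => omega e t) N]%SET.
have SE t : stable_matching (fun e => omega e t) =
    odflt finset.set0 [pick N in S t].
  by rewrite /stable_matching; congr odflt; apply: eq_pick => N; rewrite !inE.
rewrite [X in measurable X](_ : _ = \bigcup_(A in
  [set A : {set {set edge n}} | odflt finset.set0 [pick N in A] = M])
  [set t | S t = A]).
  apply: fin_bigcup_measurable => // A _.
  rewrite [X in measurable X](_ : _ = [set t | [forall N,
    is_stable_matching (fun e => omega e t) N == (N \in A)]]).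
    have : measurable_fun setT (fun t => [forall N,
      is_stable_matching (fun e => omega e t) N == (N \in A)]).
      apply: measurable_forall => N; case: (N \in A).
        under eq_fun do rewrite eqb_id.
        exact: measurable_is_stable_matching.
      under eq_fun do rewrite eqbF_neg.
      exact: measurable_neg (measurable_is_stable_matching N).
    by move=> /(_ measurableT [set true] I); rewrite setTI.
  apply/seteqP; split => t /=.
    by move=> <-; apply/forallP => N; rewrite inE.
  by move/forallP => h; apply/setP => N; rewrite inE; exact/eqP/h.
apply/seteqP; split => t /=.
  by move=> h; exists (S t) => //=; rewrite -SE.
by move=> [A /= h1 h2]; rewrite SE h2.
Qed.

Lemma measurable_stable_cost : measurable_fun setT stable_cost.
Proof.
rewrite [stable_cost](_ : _ = fun t => \sum_(M : {set edge n})
  \1_[set t | stable_matching (fun e => omega e t) = M] t *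
  \sum_(e in M) omega e t).
  apply: measurable_sum => M; apply: measurable_funM.
    by apply: measurable_indic; exact: measurable_stable_matching.
  rewrite [X in measurable_fun _ X](_ : _ = fun t => \sum_(e <- enum M) omega e t).
    by apply: measurable_sum => e.
  by apply/funext => t; rewrite big_enum.
apply/funext => t; rewrite /stable_cost /total_cost.
set M0 := stable_matching _.
have rest : \sum_(M : {set edge n} | M != M0)
    \1_[set t | stable_matching (fun e => omega e t) = M] t *
    (\sum_(e in M) omega e t) = 0.
  apply: big1 => M MM0; rewrite indicE memNset ?mul0r//= => h.
  by move/eqP: MM0; apply; rewrite -h.
by rewrite (bigD1 M0)//= rest addr0 indicE mem_set// mul1r.
Qed.

HB.instance Definition _ := isMeasurableFun.Build _ _ _ _ stable_cost
  measurable_stable_cost.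

End total_cost_rv.

Section laws.
Context d (T : measurableType d) (R : realType) (P : probability T R).

Definition has_law (X : {RV P >-> R}) (rho : set R -> \bar R) : Prop :=
  forall A : set R, measurable A -> distribution P X A = rho A.

Definition mutually_independent (I : finType) (X : I -> {RV P >-> R}) : Prop :=
  forall (J : {set I}) (A : I -> set R), (forall i, measurable (A i)) ->
    P (\bigcap_(i in [set` J]) (X i @^-1` A i)) =
    (\prod_(i in J) P (X i @^-1` A i))%E.

Definition iid_with_law (I : finType) (X : I -> {RV P >-> R})
    (rho : set R -> \bar R) : Prop :=
  mutually_independent X /\ forall i, has_law (X i) rho.

(* Point masses count as (degenerate) Gaussian laws: they are stable. *)
Definition gaussian (X : {RV P >-> R}) : Prop :=
  (exists m s : R, 0 < s /\ has_law X (normal_prob m s)) \/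
  (exists m : R, has_law X (\d_m : set R -> \bar R)).

Definition centred (X : {RV P >-> R}) : {RV P >-> R} :=
  X - (cst (fine 'E_P[X]) : {RV P >-> R}).

End laws.

(* Everything depends only on the laws, so the independent copies may live on
   any probability space. *)
Definition stable_law d (T : measurableType d) (R : realType)
    (P : probability T R) (X : {RV P >-> R}) : Prop :=
  forall n : nat, (2 <= n)%N -> exists a b : R, 0 < a /\
    forall d' (T' : measurableType d') (P' : probability T' R)
      (Y : 'I_n -> {RV P' >-> R}),
      iid_with_law Y (distribution P X) ->
      has_law (\sum_(i < n) Y i : {RV P' >-> R})
        (distribution P (a *: X + (cst b : {RV P >-> R}) : {RV P >-> R})).

Definition cvg_in_law (R : realType) (dT : nat -> measure_display)
    (T : forall n, measurableType (dT n)) (P : forall n, probability (T n) R)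
    (X : forall n, {RV (P n) >-> R}) d (S : measurableType d)
    (Q : probability S R) (xi : {RV Q >-> R}) : Prop :=
  forall x : R, {for x, continuous (cdf xi)} ->
    cdf (X n) x @[n --> \oo] --> cdf xi x.
Arguments cvg_in_law {R dT T} P X {d S} Q xi.

(* Main.v *)
Require Import Defs.
From HB Require Import structures.
From mathcomp Require Import all_boot all_order all_algebra.
From mathcomp Require Import all_classical all_reals all_analysis.
From mathcomp Require Import measurable_realfun ring lra.

(** Let [p = d^-1], so that 1/2 < p < 1. Raising the costs to the power [d]
    turns the Weibull law into the exponential law of mean 1 and keeps the order
    of the edges. The stable matching is thus the greedy matching for i.i.d.
    exponential variables, and its cost is the sum of the [p]-th powers of the
    successive minima.

    When a [k] by [k] grid of edges is left, the minimum of the [k ^ 2] remaining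
    variables is exponential of rate [k ^ 2]; given this minimum, the excesses of
    the other variables over it are again i.i.d. exponential, by the memoryless
    property. So the total cost has the law of

      C_n = sum_(k < n) S_(k,n) ^ p,   S_(k,n) = sum_(k <= j < n) E_j / (j + 1)^2,

    where the E_j are i.i.d. exponential ([greedy_integral], [chain_sequence],
    [stable_cost_law]). This realises the costs for all [n] on one probability
    space, that of a single i.i.d. sequence ([exists_iid_sequence]).

    Let m_(k,n) be the mean of S_(k,n); it is at most 2 / (k + 1), and the variance
    of S_(k,n) is at most a constant times m_(k,n) / (k + 1)^2. Linearising the
    power at the mean, S_(k,n) ^ p - m_(k,n) ^ p has second moment
    O((k + 1) ^ (- 2 p - 1)). Its square root is summable because p + 1/2 > 1, and
    a weighted Cauchy-Schwarz inequality shows that the sums over [k] of these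
    deviations are Cauchy in L2 ([sum_dev_cauchy]). Their limit, once centred, is
    the random variable of the theorem; convergence in L2 yields convergence of
    the centred laws and of the variances ([sqn_cvg_cdf], [sqn_cvg_sqn]).

    The limit is neither Gaussian nor stable because of the size of its upper tail.
    The variable E_0 has coefficient 1 in S_(0,n), so one value of E_0 of order
    y ^ d is enough to make the limit exceed [y]; the probability of that is about
    exp (- y ^ d) ([sum_dev_lower_tail]). As [d < 2], this exceeds every Gaussian
    tail ([heavy_tail_not_gaussian]). On the other hand the power is
    concave, so the sums of deviations are bounded above by linear forms in the E_j
    with square-summable coefficients, and the limit X has a finite exponential
    moment ([limit_mgf]). If X were stable, finiteness of its variance would force
    X + X' = sqrt 2 X in law for an independent copy X' of X, hence
    M (sqrt 2 * t) = M t ^ 2 for the moment generating function M of X. Then the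
    bound M t <= exp (C * t ^ 2), which holds for small t >= 0, would hold for every
    t >= 0, and X would have a Gaussian upper tail after all
    ([heavy_tail_not_stable]). *)

Set Implicit Arguments.
Unset Strict Implicit.
Unset Printing Implicit Defensive.

Import Order.TTheory GRing.Theory Num.Theory.
Import numFieldNormedType.Exports.

Local Open Scope classical_set_scope.
Local Open Scope ring_scope.

(** * Product spaces and i.i.d. laws *)

Definition box (I : eqType) d (T : measurableType d) (s : seq I)
    (A : I -> set T) : set (I -> T) := [set x | forall i, i \in s -> A i (x i)].

Definition boxes (I : eqType) d (T : measurableType d) : set (set (I -> T)) :=
  [set B | exists s A, (forall i, measurable (A i)) /\ B = box s A].

(** The product sigma-algebra: finite boxes form a pi-system that generates
    it, so measures on [I -> T] are compared on boxes. *)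
Definition prodspace (I : eqType) d (T : measurableType d) : Type :=
  g_sigma_algebraType (@boxes I d T).
HB.instance Definition _ (I : eqType) d (T : measurableType d) :=
  Measurable.on (@prodspace I d T).

Section prodspace.
Context (I : eqType) d (T : measurableType d).
Notation S := (@prodspace I d T).
Implicit Types (s : seq I) (A : I -> set T).

Lemma measurable_box s A : (forall i, measurable (A i)) ->
  measurable (box s A : set S).
Proof. by move=> mA; apply: sub_sigma_algebra; exists s, A. Qed.

Lemma boxesI : setI_closed (@boxes I d T).
Proof.
move=> _ _ [s [A [mA ->]]] [s' [A' [mA' ->]]].
exists (s ++ s'), (fun i => (if i \in s then A i else setT) `&`
                          (if i \in s' then A' i else setT)); split.
  by move=> i; apply: measurableI; case: ifP => _.
apply/seteqP; split => x /=.
  by move=> [h h'] i _; split; case: ifPn => // iS; [exact: h|exact: h'].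
by move=> h; split=> i iS; have := h i; rewrite mem_cat iS ?orbT => /(_ isT) [].
Qed.

Lemma measurable_coord i : measurable_fun [set: S] (fun x : S => x i).
Proof.
move=> _ Y mY; rewrite setTI.
rewrite (_ : _ @^-1` Y = box [:: i] (fun=> Y)); first exact: measurable_box.
apply/seteqP; split => x /=; first by move=> Yx j; rewrite inE => /eqP ->.
by apply; rewrite inE.
Qed.

Lemma measurable_prodspaceP d' (U : measurableType d') (f : U -> S) :
  (forall i, measurable_fun setT (fun u => f u i)) -> measurable_fun setT f.
Proof.
move=> mf; apply: (@measurability _ _ U S setT f (@boxes I d T)) => //.
move=> _ [_ [s [A [mA ->]]] <-]; rewrite setTI.
rewrite (_ : _ @^-1` _ = \bigcap_(i in [set` s]) ((fun u => f u i) @^-1` A i)).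
  apply: fin_bigcap_measurable; first exact: finite_seq.
  by move=> i _; rewrite -[X in measurable X]setTI; exact: mf.
by apply/seteqP; split => x /= h i /=; exact: h.
Qed.

Definition upd (x : I -> T) i t : I -> T := fun j => if j == i then t else x j.

Lemma measurable_upd i :
  measurable_fun setT (fun z : T * S => upd z.2 i z.1 : S).
Proof.
apply: measurable_prodspaceP => j; rewrite /upd; case: eqP => _.
  exact: measurable_fst.
by apply: (measurableT_comp (measurable_coord j)); exact: measurable_snd.
Qed.

Lemma box_undup s A : box (undup s) A = box s A.
Proof.
by apply/seteqP; split => x h i iS; apply: h; rewrite ?mem_undup// -mem_undup.
Qed.

End prodspace.

Section iid.
Context (R : realType) (I : eqType) d (T : measurableType d).
Notation S := (@prodspace I d T).
Variable mu : probability T R.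

Definition iid_law (L : set S -> \bar R) : Prop :=
  forall s A, uniq s -> (forall i, measurable (A i)) ->
  L (box s A) = (\prod_(i <- s) mu (A i))%E.

Lemma iid_law_unique (L1 L2 : {measure set S -> \bar R}) :
  iid_law L1 -> iid_law L2 -> forall E, measurable E -> L1 E = L2 E.
Proof.
move=> i1 i2 E mE.
apply: (@measure_unique _ R S (@boxes I d T) (fun=> setT) _ _ _ _ L1 L2) => //.
- exact: boxesI.
- by move=> _; exists [::], (fun=> setT); split=> //; apply/seteqP; split.
- by rewrite bigcup_const.
- by move=> _ [s [A [mA ->]]]; rewrite -box_undup i1 ?i2 ?undup_uniq.
- move=> _; rewrite (_ : setT = box [::] (fun=> setT)); last first.
    by apply/seteqP; split.
  by rewrite i1// big_nil ltry.
Qed.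

Lemma iid_law_integral (L1 L2 : {measure set S -> \bar R}) (f : S -> \bar R) :
  iid_law L1 -> iid_law L2 ->
  (\int[L1]_x f x = \int[L2]_x f x)%E.
Proof.
move=> i1 i2; apply: eq_measure_integral => A mA _; exact: iid_law_unique.
Qed.

(** Resampling coordinate [i] from [mu] changes only the factor of index [i]
    in the probability of a box, and replaces it by itself. *)
Lemma iid_law_upd (L : probability S R) i : iid_law L ->
  iid_law (pushforward (mu \x L)%E (fun z : T * S => upd z.2 i z.1 : S)).
Proof.
move=> iL s A us mA; rewrite /pushforward.
have boxE : (fun z : T * S => upd z.2 i z.1 : S) @^-1` (box s A) =
   (if i \in s then A i else setT) `*` (box (rem i s) A : set S).
  apply/seteqP; split => -[t x] /=.
    move=> h; split.
      by case: ifPn => // iS; have := h i iS; rewrite /upd eqxx.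
    move=> j; rewrite mem_rem_uniq// inE => /andP[ji js].
    by have := h j js; rewrite /upd (negbTE ji).
  move=> [h1 h2] j js; rewrite /upd; case: eqP => [ji|/eqP ji].
    by move: h1; rewrite -ji js.
  by apply: h2; rewrite mem_rem_uniq// inE js andbT.
rewrite boxE product_measure1E//; last 2 first.
  by case: ifP.
  exact: measurable_box.
have LE : L (box (rem i s) A) = (\prod_(j <- rem i s) mu (A j))%E.
  by apply: iL; rewrite ?rem_uniq.
transitivity (mu (if i \in s then A i else setT) *
              \prod_(j <- rem i s) mu (A j))%E; first by congr (_ * _)%E.
case: ifPn => iS; first by rewrite (perm_big _ (perm_to_rem iS))/= big_cons.
by rewrite probability_setT mul1e rem_id.
Qed.

(** Fubini's theorem for one coordinate against all of them. Resampling
    coordinate [i], instead of splitting it off, keeps the same space on both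
    sides, so that inductions can treat the coordinates one at a time. *)
Lemma iid_fubini (L : probability S R) i (f : S -> \bar R) : iid_law L ->
  measurable_fun setT f -> (forall x, 0 <= f x)%E ->
  (\int[L]_x f x = \int[mu]_t \int[L]_x f (upd x i t))%E.
Proof.
move=> iL mf f0.
pose phi := fun z : T * S => upd z.2 i z.1 : S.
have mphi : measurable_fun setT phi by exact: measurable_upd.
pose phiM : {mfun (T * S)%type >-> S} :=
  HB.pack phi (isMeasurableFun.Build _ _ _ _ _ mphi).
transitivity (\int[distribution (mu \x L)%E phiM]_x f x)%E.
  by apply: iid_law_integral => //; exact: iid_law_upd.
rewrite ge0_integral_distribution//.
apply: (@fubini_tonelli1 _ _ T S R mu L (f \o phi)) => [|z]; last exact: f0.
exact: (measurableT_comp mf mphi).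
Qed.

End iid.

(** * The exponential law and memorylessness *)

Section ray_unique.
Context (R : realType).

(** Open rays form a pi-system that generates the Borel sets. *)
Lemma measure_ray_unique (m1 m2 : {measure set R -> \bar R}) :
  (m1 setT < +oo)%E -> (forall a, m1 `]a, +oo[%classic = m2 `]a, +oo[%classic) ->
  forall E, measurable E -> m1 E = m2 E.
Proof.
move=> m1fin m12 E mE.
apply: (@measure_unique _ R _ (@RGenOInfty.G R)
  (fun n => `](- n%:R), +oo[%classic) _ _ _ _ m1 m2) => //.
- exact: RGenOInfty.measurableE.
- move=> _ _ [a ->] [b ->]; exists (Num.max a b).
  by apply/seteqP; split => x /=; rewrite !in_itv/= !andbT gt_max;
    [case=> -> ->|case/andP=> -> ->].
- by move=> i; exists (- i%:R).
- apply/seteqP; split => // x _.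
  exists (Num.bound `|x|) => //=; rewrite in_itv/= andbT ltrNl.
  by rewrite (le_lt_trans (ler_norm _))// normrN; exact: archi_boundP.
- by move=> _ [a ->].
- move=> k; apply: le_lt_trans m1fin; apply: le_measure; rewrite ?inE//.
Qed.

End ray_unique.

Section expo.
Context (R : realType).

(** Given by its tails, the form in which minima and memorylessness are read
    off; it determines the law ([expo_law_unique]). *)
Definition expo_law (mu : set R -> \bar R) : Prop :=
  forall a, 0 <= a -> mu `]a, +oo[%classic = (expR (- a))%:E.

Lemma expo_law_ltr0 (mu : probability R R) (a : R) : expo_law mu -> a < 0 ->
  mu `]a, +oo[%classic = 1%E.
Proof.
move=> emu a0; apply/eqP; rewrite eq_le probability_le1//=.
have := emu 0 (lexx _); rewrite oppr0 expR0 => <-.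
apply: le_measure; rewrite ?inE// => x /=.
by rewrite !in_itv/= !andbT; exact: lt_trans.
Qed.

(** Both sides are finite measures in [A] that agree on rays. *)
Lemma expo_memoryless (mu : probability R R) (t : R) (A : set R) : expo_law mu -> 0 <= t ->
  measurable A ->
  mu (`]t, +oo[%classic `&` A) = ((expR (- t))%:E * mu ((fun x : R => t + x)%R @^-1` A))%E.
Proof.
move=> emu t0 mA.
have mf : measurable_fun [set: R] (fun x => t + x)%R by exact: measurable_funD.
pose f : {mfun R >-> R} := HB.pack (fun x => t + x)%R
  (isMeasurableFun.Build _ _ _ _ _ mf).
have mI : measurable (`]t, +oo[%classic : set R) by [].
have e0 : 0 <= expR (- t) by exact: expR_ge0.
rewrite setIC.
apply: (measure_ray_unique (m1 := mrestr mu mI)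
  (m2 := mscale (NngNum e0) (distribution mu f))) => //.
  by apply: le_lt_trans (ltry 1); apply: probability_le1; exact: measurableI.
move=> a; change (mu (`]a, +oo[%classic `&` `]t, +oo[%classic) =
  (expR (- t))%:E * mu ((fun x : R => t + x)%R @^-1` `]a, +oo[%classic))%E.
have -> : `]a, +oo[%classic `&` `]t, +oo[%classic = `](Num.max a t), +oo[%classic :> set R.
  by apply/seteqP; split => x /=; rewrite !in_itv/= !andbT gt_max;
    [case=> -> ->|case/andP=> -> ->].
have -> : (fun x => t + x)%R @^-1` `]a, +oo[%classic = `](a - t), +oo[%classic :> set R.
  by apply/seteqP; split => x /=; rewrite !in_itv/= !andbT ltrBlDl.
rewrite emu ?le_max ?t0 ?orbT//.
have [ta|at'] := leP t a.
  by rewrite emu ?subr_ge0// -EFinM -expRD; rewrite opprB addKr.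
by rewrite expo_law_ltr0 ?mule1// subr_lt0.
Qed.

End expo.

Section memoryless.
Context (R : realType) (I : finType) (mu : probability R R).
Notation S := (@prodspace I _ R).
Hypothesis emu : expo_law mu.

Definition delay (D : {set I}) (t : R) (z : I -> R) : I -> R :=
  fun i => if i \in D then t + z i else z i.

Definition above (D : {set I}) (t : R) : set (I -> R) :=
  [set z | forall i, i \in D -> t < z i].

Lemma measurable_delay D t : measurable_fun setT (delay D t : S -> S).
Proof.
apply: measurable_prodspaceP => i; rewrite /delay; case: (i \in D).
  by apply: measurable_funD => //; exact: (@measurable_coord I _ R i).
exact: (@measurable_coord I _ R i).
Qed.

Lemma aboveE D t : above D t = box (enum I)
  (fun i => if i \in D then `]t, +oo[%classic else setT).
Proof.
apply/seteqP; split => x /= h i.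
  by move=> _; case: ifPn => // iD; rewrite /= in_itv/= andbT h.
by move=> iD; have := h i; rewrite mem_enum iD /= in_itv/= andbT; apply.
Qed.

Lemma measurable_above D t : measurable (above D t : set S).
Proof. by rewrite aboveE; apply: measurable_box => i; case: ifP. Qed.

Lemma box_full (s : seq I) (A : I -> set R) :
  box s A = box (enum I) (fun i => if i \in s then A i else setT).
Proof.
apply/seteqP; split => x /= h i; first by case: ifPn => // /h.
by move=> iS; have := h i; rewrite mem_enum iS; apply.
Qed.

(** Memorylessness in each coordinate of [D]: both sides are finite measures
    in [E], and on a box they are products over the coordinates. *)
Lemma iid_above_delay (L : probability S R) (D : {set I}) (t : R) : iid_law mu L -> 0 <= t ->
  forall E : set S, measurable E -> L (above D t `&` E) =
    ((expR (- t) ^+ #|D|)%:E * L ((delay D t : S -> S) @^-1` E))%E.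
Proof.
move=> iL t0 E mE.
pose f : {mfun S >-> S} := HB.pack (delay D t : S -> S)
  (isMeasurableFun.Build _ _ _ _ _ (measurable_delay D t)).
have mI := measurable_above D t.
have e0 : 0 <= expR (- t) ^+ #|D| by rewrite exprn_ge0// expR_ge0.
rewrite setIC.
apply: (@measure_unique _ R S (@boxes I _ R) (fun=> setT) _ _ _ _
  (mrestr L mI) (mscale (NngNum e0) (distribution L f))) => //.
- exact: boxesI.
- by move=> _; exists [::], (fun=> setT); split=> //; apply/seteqP; split.
- by rewrite bigcup_const.
- move=> _ [s [A [mA ->]]]; rewrite box_full.
  pose B (i : I) : set R := if i \in s then A i else setT.
  have mB i : measurable (B i) by rewrite /B; case: ifP.
  change (L (box (enum I) B `&` above D t) =
    (expR (- t) ^+ #|D|)%:E * L ((delay D t : S -> S) @^-1` box (enum I) B))%E.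
  have -> : box (enum I) B `&` above D t = box (enum I)
      (fun i => if i \in D then `]t, +oo[%classic `&` B i else B i).
    rewrite aboveE; apply/seteqP; split => x /=.
      by move=> [h1 h2] i iI; have := h1 i iI; have := h2 i iI; case: ifP.
    by move=> h; split=> i iI; have := h i iI; case: ifP => // _ [].
  have -> : (delay D t : S -> S) @^-1` box (enum I) B = box (enum I)
      (fun i => if i \in D then (fun x : R => t + x)%R @^-1` B i else B i).
    apply/seteqP; split => x /= h i iI; have := h i iI; rewrite /delay;
    by case: ifP.
  have mT i : measurable ((fun x : R => t + x)%R @^-1` B i).
    rewrite -[X in measurable X]setTI.
    by apply: measurable_funD => //; exact: measurable_id.
  have h1 := iL (enum I) (fun i => if i \in D then `]t, +oo[%classic `&` B i else B i).
  have h2 := iL (enum I) (fun i => if i \in D then (fun x : R => t + x)%R @^-1` B i else B i).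
  rewrite h1 ?h2 ?enum_uniq//; last 2 first.
    by move=> i; case: ifP.
    by move=> i; case: ifP => // _; exact: measurableI.
  transitivity (\prod_(i <- enum I) ((if i \in D then expR (- t) else 1)%:E *
      mu (if i \in D then (fun x : R => t + x)%R @^-1` B i else B i)))%E.
    apply: eq_bigr => i _; case: ifP => _; last by rewrite mul1e.
    by rewrite expo_memoryless.
  rewrite big_split/=; congr (_ * _)%E.
  rewrite prodEFin; congr (_ %:E).
  by rewrite big_enum/= -big_mkcond/= prodr_const.
- move=> k; apply: le_lt_trans (ltry 1); apply: probability_le1.
  exact: measurableI.
Qed.

(** The renewal property behind the greedy algorithm: given that the
    coordinates in [D] all exceed [t], their excesses over [t] have the
    original law. *)
Lemma iid_memoryless (L : probability S R) (D : {set I}) (t : R) (F : S -> \bar R) :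
  iid_law mu L -> 0 <= t -> measurable_fun setT F -> (forall z, 0 <= F z)%E ->
  (\int[L]_(z in above D t) F z =
   (expR (- t) ^+ #|D|)%:E * \int[L]_z F (delay D t z))%E.
Proof.
move=> iL t0 mF F0.
pose f : {mfun S >-> S} := HB.pack (delay D t : S -> S)
  (isMeasurableFun.Build _ _ _ _ _ (measurable_delay D t)).
have mI := measurable_above D t.
have e0 : 0 <= expR (- t) ^+ #|D| by rewrite exprn_ge0// expR_ge0.
pose m2 : {measure set S -> \bar R} := mscale (NngNum e0) (distribution L f).
have m2E E : measurable E -> m2 E = L (above D t `&` E).
  by move=> mE; rewrite iid_above_delay.
transitivity (\int[m2]_z F z)%E; last first.
  by rewrite ge0_integral_mscale//= ge0_integral_distribution.
have mC : measurable (~` above D t : set S) by exact: measurableC.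
rewrite -(setUv (above D t)) ge0_integral_setU//=; last 2 first.
- by rewrite setUv.
- exact/disj_setPCl.
rewrite [X in (_ + X)%E](_ : _ = 0%E) ?adde0.
  apply: eq_measure_integral => A mA AD.
  by rewrite /= m2E// setIC setIidl.
rewrite (@eq_measure_integral _ _ _ _ mzero); last first.
  move=> A mA AD; rewrite /= m2E// (_ : _ `&` _ = set0) ?measure0//.
  by apply/disjoints_subset; exact: subsetCr.
exact: integral_measure_zero.
Qed.

End memoryless.

(** * Minima of exponential variables *)

Section density.
Local Open Scope ereal_scope.
Context d (T : measurableType d) (R : realType).
Variables (lam nu : {measure set T -> \bar R}) (g : T -> R).
Hypotheses (mg : measurable_fun setT g) (g0 : forall x, (0 <= g x)%R)
  (nuE : forall E, measurable E -> nu E = \int[lam]_(x in E) (g x)%:E).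

Import HBNNSimple.

Let density_nnsfun (h : {nnsfun T >-> R}) :
  \int[nu]_x (h x)%:E = \int[lam]_x ((h x)%:E * (g x)%:E).
Proof.
under [LHS]eq_integral do rewrite fimfunE -fsumEFin//.
rewrite [LHS]ge0_integral_fsum//; last 2 first.
  - by move=> r; exact/measurable_EFinP/measurableT_comp.
  - by move=> n x _; rewrite EFinM nnfun_muleindic_ge0.
under [RHS]eq_integral.
  move=> x xD; rewrite fimfunE -fsumEFin// ge0_mule_fsuml; last first.
    by move=> r; rewrite EFinM nnfun_muleindic_ge0.
  over.
rewrite [RHS]ge0_integral_fsum//; last 2 first.
  - move=> r; apply: emeasurable_funM; last exact/measurable_EFinP.
    by apply/measurable_EFinP; apply/measurableT_comp.
  - by move=> n x _; apply: mule_ge0; rewrite ?EFinM ?nnfun_muleindic_ge0 ?lee_fin.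
apply: eq_fsbigr => r _.
rewrite integralZl_indic_nnsfun// integral_indic// setIT nuE//.
have [r0|r0] := ltP r 0%R.
  rewrite preimage_nnfun0// integral_set0 mule0.
  by apply/esym/integral0_eq => x _; rewrite indic0 mulr0 mul0e.
under [RHS]eq_integral do rewrite EFinM -muleA.
rewrite ge0_integralZl//; last 2 first.
  - by apply: emeasurable_funM => //; apply/measurable_EFinP.
  - by move=> x _; rewrite mule_ge0// lee_fin.
congr (_ * _); rewrite integral_mkcond; apply: eq_integral => x _.
by rewrite epatch_indic/= muleC.
Qed.

(** From simple functions by monotone convergence. *)
Lemma ge0_integral_density (f : T -> \bar R) : measurable_fun setT f ->
  (forall x, 0 <= f x) -> \int[nu]_x f x = \int[lam]_x (f x * (g x)%:E).
Proof.
move=> mf f0; pose f_ := nnsfun_approx measurableT mf.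
have fcvg x : (f_ n x)%:E @[n --> \oo] --> f x.
  by apply: cvg_nnsfun_approx => // *; exact: f0.
have fnd x a b : (a <= b)%N -> (f_ a x)%:E <= (f_ b x)%:E.
  by move=> ab; rewrite lee_fin; exact/lefP/nd_nnsfun_approx.
have mf_ n : measurable_fun setT (fun x => (f_ n x)%:E).
  exact/measurable_EFinP.
transitivity (limn (fun n => \int[nu]_x (f_ n x)%:E)).
  rewrite -monotone_convergence//=.
  - by apply: eq_integral => x _; apply/esym/cvg_lim.
  - by move=> n x _; rewrite lee_fin.
  - by move=> x _ a b; exact: fnd.
transitivity (limn (fun n => \int[lam]_x ((f_ n x)%:E * (g x)%:E))).
  by congr (limn _); apply/funext => n; exact: density_nnsfun.
rewrite -monotone_convergence//=.
- apply: eq_integral => x _; apply/cvg_lim => //.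
  by apply: cvgeZr => //; exact: fcvg.
- by move=> n; apply: emeasurable_funM => //; exact/measurable_EFinP.
- by move=> n x _; rewrite mule_ge0// lee_fin.
- by move=> x _ a b ab; apply: lee_wpmul2r; [rewrite lee_fin|exact: fnd].
Qed.

End density.

Section exponential.
Context (R : realType).
Notation lam := (@lebesgue_measure R).
Local Open Scope ereal_scope.

(** The identity between two measurable structures on the reals, which carries
    the exponential law from the one on which it is constructed to the other. *)
Definition idTR : measurableTypeR R -> R := idfun.

Lemma measurable_idTR : measurable_fun setT idTR.
Proof. exact: measurable_id. Qed.

HB.instance Definition _ := isMeasurableFun.Build _ _ _ _ idTR measurable_idTR.

Section rate.
Variables (r : R) (r0 : (0 < r)%R).

Definition exponential_probT : probability (measurableTypeR R) R.
Proof. refine (exponential_prob r : probability (measurableTypeR R) R). exact: r0. Defined.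

Definition expo_prob : probability R R := distribution exponential_probT idTR.

Lemma integral_expo_prob (f : R -> \bar R) : measurable_fun setT f ->
  (forall x, 0 <= f x) ->
  \int[expo_prob]_x f x = \int[lam]_x (f x * (exponential_pdf r x)%:E).
Proof.
move=> mf f0; rewrite ge0_integral_distribution//.
apply: (@ge0_integral_density _ _ _ lam exponential_probT) => //.
- exact: measurable_exponential_pdf.
- by move=> x; apply: exponential_pdf_ge0; exact: ltW.
Qed.

Lemma expo_prob_tail (a : R) : (0 <= a)%R ->
  expo_prob `]a, +oo[%classic = (expR (- (r * a)))%:E.
Proof.
move=> a0.
have := probability_setC exponential_probT (@measurable_itv R `]-oo, a]).
rewrite setCitvl => H.
change (exponential_probT `]a, +oo[%classic = (expR (- (r * a)))%:E).
rewrite H.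
suff -> : exponential_probT `]-oo, a]%classic = 1 - (expR (- (r * a)))%:E.
  change ((1 - (1 - expR (- (r * a))))%:E = (expR (- (r * a)))%:E :> \bar R).
  by congr EFin; ring.
transitivity (\int[lam]_(x in `[0%R, a]) (exponential_pdf r x)%:E).
  change (\int[lam]_(x in `]-oo, a]) (exponential_pdf r x)%:E =
    \int[lam]_(x in `[0%R, a]) (exponential_pdf r x)%:E).
  rewrite [LHS]integral_mkcond [RHS]integral_mkcond; apply: eq_integral => x _.
  rewrite !patchE; have [x0|x0] := ltP x 0%R.
    by rewrite lt0_exponential_pdf//; do 2 case: ifP.
  suff -> : (x \in `]-oo, a]%classic) = (x \in `[0%R, a]%classic) by [].
  by apply/idP/idP; rewrite !inE/= !in_itv/= x0.
move: a0; rewrite le_eqVlt => /predU1P[<-|a0].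
  rewrite mulr0 oppr0 expR0 subee// set_itv1 integral_set1//.
have := exponential_prob_itv0c r a0; rewrite /exponential_prob mulNr.
by move=> ->.
Qed.

End rate.

Lemma expo_prob1_law : expo_law (expo_prob ltr01).
Proof. by move=> a a0; rewrite expo_prob_tail// mul1r. Qed.

Lemma expo_law_unique (mu nu : probability R R) : expo_law mu -> expo_law nu ->
  forall A, measurable A -> mu A = nu A.
Proof.
move=> emu enu; apply: (@measure_ray_unique _ mu nu).
  by apply: le_lt_trans (ltry 1); exact: probability_le1.
move=> a; have [a0|a0] := leP 0%R a.
  by transitivity (expR (- a))%:E; [exact: emu|apply/esym; exact: enu].
by transitivity (1 : \bar R); [|apply/esym]; exact: expo_law_ltr0.
Qed.

Lemma expo_integral (mu : probability R R) (f : R -> \bar R) : expo_law mu ->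
  measurable_fun setT f -> (forall x, 0 <= f x) ->
  \int[mu]_x f x = \int[lam]_x (f x * (exponential_pdf 1 x)%:E).
Proof.
move=> emu mf f0; rewrite -(integral_expo_prob ltr01)//.
apply: eq_measure_integral => A mA _; apply: expo_law_unique => //.
exact: expo_prob1_law.
Qed.

(** The law of the minimum of [N] i.i.d. exponential variables. On the left,
    each of the [N] variables in turn takes the value [t] while the others
    exceed it; on the right, the minimum is an exponential variable divided by
    [N]. *)
Lemma expo_min (mu : probability R R) (N : nat) (H : R -> \bar R) :
  expo_law mu -> (0 < N)%N -> measurable_fun setT H -> (forall x, 0 <= H x) ->
  N%:R%:E * \int[mu]_t ((expR (- t) ^+ N.-1)%:E * H t) =
  \int[mu]_x H (x / N%:R)%R.
Proof.
move=> emu N0 mH H0.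
have N0R : (0 < N%:R :> R)%R by rewrite ltr0n.
have mf : measurable_fun [set: R] (fun x => x / N%:R)%R by exact: measurable_funM.
pose f : {mfun R >-> R} := HB.pack (fun x => x / N%:R)%R
  (isMeasurableFun.Build _ _ _ _ _ mf).
have mexp : measurable_fun setT (fun t : R => (expR (- t) ^+ N.-1)%:E).
  apply/measurable_EFinP; apply: measurable_funX.
  by apply: measurableT_comp => //; exact: measurable_funN.
transitivity (\int[expo_prob N0R]_x H x); last first.
  rewrite -[RHS](@ge0_integral_distribution _ _ _ _ _ mu f)//.
  apply: eq_measure_integral => A mA _; apply: measure_ray_unique mA.
    by apply: le_lt_trans (ltry 1); exact: probability_le1.
  move=> a.
  change (expo_prob N0R `]a, +oo[%classic =
    mu ((fun x => x / N%:R)%R @^-1` `]a, +oo[%classic)).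
  have -> : (fun x => x / N%:R)%R @^-1` `]a, +oo[%classic =
      `](N%:R * a)%R, +oo[%classic.
    by apply/seteqP; split => x /=; rewrite !in_itv/= !andbT ltr_pdivlMr// mulrC.
  have [a0|a0] := leP 0%R a; first by rewrite expo_prob_tail// emu// mulr_ge0.
  rewrite (@expo_law_ltr0 _ mu)//; last by rewrite nmulr_llt0.
  apply/eqP; rewrite eq_le probability_le1//=.
  have := expo_prob_tail N0R (lexx 0%R); rewrite mulr0 oppr0 expR0 => <-.
  apply: le_measure; rewrite ?inE// => x /=.
  by rewrite !in_itv/= !andbT; exact: lt_trans.
have meH : measurable_fun setT (fun t : R => (expR (- t) ^+ N.-1)%:E * H t).
  exact: emeasurable_funM.
have eH0 x : 0 <= (expR (- x) ^+ N.-1)%:E * H x.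
  by rewrite mule_ge0// lee_fin exprn_ge0// expR_ge0.
have mpdf : measurable_fun setT (fun x : R => (exponential_pdf 1 x)%:E).
  by apply/measurable_EFinP; exact: measurable_exponential_pdf.
rewrite integral_expo_prob// expo_integral//.
rewrite -ge0_integralZl//; last 2 first.
- exact: emeasurable_funM.
- move=> x _; rewrite !mule_ge0// ?lee_fin ?exprn_ge0 ?expR_ge0//.
  exact: exponential_pdf_ge0.
have key x : (exponential_pdf N%:R x =
    N%:R * (expR (- x) ^+ N.-1 * exponential_pdf 1 x))%R.
  rewrite /exponential_pdf !patchE; case: ifP; last by rewrite !mulr0.
  move=> _; rewrite mul1r mulN1r -exprSr prednK//.
  by rewrite -expRM_natl mulrN mulNr.
apply: eq_integral => x _; rewrite key !EFinM.
by rewrite [X in _ * X = _]muleAC [LHS]muleA [LHS]muleC.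
Qed.

End exponential.

Lemma expo_integral_pos (R : realType) (mu : probability R R) (f : R -> \bar R) :
  expo_law mu -> measurable_fun setT f -> (forall x, 0 <= f x)%E ->
  (\int[mu]_x f x = \int[mu]_(x in `]0%R, +oo[) f x)%E.
Proof.
move=> emu mf f0.
have mI : measurable (`]0, +oo[%classic : set R) by [].
have mC : measurable (~` `]0, +oo[%classic : set R) by exact: measurableC.
rewrite -[in LHS](setUv (`]0%R, +oo[%classic : set R)) ge0_integral_setU//=; last 2 first.
- by rewrite setUv.
- exact/disj_setPCl.
rewrite [X in (_ + X)%E](_ : _ = 0%E) ?adde0//.
rewrite (@eq_measure_integral _ _ _ _ mzero).
  exact: integral_measure_zero.
move=> A mA AD; apply/eqP; rewrite -measure_le0.
have mu0 : (mu (~` (`]0%R, +oo[%classic : set R)) = 0)%E.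
  by rewrite probability_setC// emu// oppr0 expR0 subee.
by rewrite -[leRHS]mu0; apply: le_measure; rewrite ?inE.
Qed.

(** * The greedy matching with exponential costs *)

Section greedy.
Context (R : realType) (n : nat).
Variables (c : R -> R) (G : R -> \bar R).
Notation grid U V := (finset.setX U V).
Implicit Types (U V : {set 'I_n}) (u : edge n -> R).

Definition strict_min (D : {set edge n}) (u : edge n -> R) (e : edge n) : bool :=
  [forall f in (D :\ e)%SET, u e < u f].

(** The test function [G] applied to the cost of the greedy matching: [U] and
    [V] are the unmatched vertices, [u] the exponential costs, [c] converts
    them to costs, and [y] is the cost accumulated so far. The sum over [e]
    has at most one nonzero term; it vanishes when the minimum is not unique. *)
Fixpoint greedy (k : nat) (U V : {set 'I_n}) (u : edge n -> R) (y : R) : \bar R :=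
  if k is k'.+1 then
    (\sum_(e in grid U V)
      if strict_min (grid U V) u e then
        greedy k' (U :\ e.1)%SET (V :\ e.2)%SET u (y + c (u e))
      else 0)%E
  else G y.

Lemma greedy_ext k U V u u' y : {in grid U V, u =1 u'} ->
  greedy k U V u y = greedy k U V u' y.
Proof.
elim: k U V y => //= k IH U V y uu'.
apply: eq_bigr => e eUV; rewrite -uu'//.
have -> : strict_min (grid U V) u' e = strict_min (grid U V) u e.
  apply: eq_forallb_in => f; rewrite !inE => /andP[_ fUV].
  by rewrite !uu'// inE.
case: ifP => // _; apply: IH => f; rewrite inE => /andP[].
rewrite !inE => /andP[_ fU] /andP[_ fV].
by rewrite uu'// inE fU fV.
Qed.

Hypotheses (mc : measurable_fun setT c) (mG : measurable_fun setT G)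
  (G0 : forall y, (0 <= G y)%E).

Lemma greedy_ge0 k U V u y : (0 <= greedy k U V u y)%E.
Proof.
elim: k U V y => //= k IH U V y.
by apply: sume_ge0 => e _; case: ifP.
Qed.

Lemma measurable_greedy k U V d (T : measurableType d) (f : T -> edge n -> R)
  (Y : T -> R) : (forall e, measurable_fun setT (fun t => f t e)) ->
  measurable_fun setT Y ->
  measurable_fun setT (fun t => greedy k U V (f t) (Y t)).
Proof.
move=> mf; elim: k U V Y => /= [|k IH] U V Y mY.
  exact: measurableT_comp.
rewrite (_ : (fun t => _) = (fun t => \sum_(e <- enum (grid U V))
  if strict_min (grid U V) (f t) e then
     greedy k (U :\ e.1)%SET (V :\ e.2)%SET (f t) (Y t + c (f t e))
  else 0)%E); last by apply/funext => t; rewrite big_enum.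
apply: emeasurable_sum => e; apply: measurable_fun_ifT => //.
  apply: measurable_forall => g.
  case: (g \in _) => /=; last exact: measurable_cst.
  exact: measurable_fun_ltr.
apply: IH; apply: measurable_funD => //; exact: measurableT_comp.
Qed.

Lemma strict_min_uniq U V u e f : e \in grid U V -> f \in grid U V ->
  strict_min (grid U V) u e -> strict_min (grid U V) u f -> e = f.
Proof.
move=> eD fD /forall_inP se /forall_inP sf; apply/eqP/negPn/negP => ef.
have := se f; rewrite in_setD1 eq_sym ef fD => /(_ isT) h1.
have := sf e; rewrite in_setD1 ef eD => /(_ isT).
by rewrite ltNge (ltW h1).
Qed.

Definition blocked_in (w : edge n -> R) (M : {set edge n}) (e : edge n) : Prop :=
  exists x f, [/\ f \in M, incident x e, incident x f & w f < w e].

(** An edge leaves the grid because an adjacent edge, cheaper than all those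
    remaining, has been selected: this edge blocks it. *)
Lemma greedy_stable k U V u y : #|U| = k -> #|V| = k ->
  {homo c : a b / a < b} ->
  greedy k U V u y = 0%E \/
  exists M : {set edge n}, [/\ M \subset grid U V, is_matching M,
    forall e, e \in grid U V -> e \in M \/ blocked_in (c \o u) M e &
    greedy k U V u y = G (y + \sum_(e in M) c (u e))].
Proof.
move=> + + hc; elim: k U V y => /= [|k IH] U V y cU cV.
  right; exists finset.set0; split.
  - exact: finset.sub0set.
  - by apply/forall_inP => e; rewrite inE.
  - by move=> e; rewrite inE (cards0_eq cU) inE.
  - by rewrite big_set0 addr0.
have [e /andP[eD emin]|nomin] :=
    pickP (fun e => (e \in grid U V) && strict_min (grid U V) u e); last first.
  left; apply: big1 => e eD; case: ifP => // h.
  by have := nomin e; rewrite eD h.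
have [eU eV] : e.1 \in U /\ e.2 \in V by move: eD; rewrite inE => /andP[].
rewrite (bigD1 e)//= emin big1 ?adde0; last first.
  move=> f /andP[fD fe]; case: ifP => // h.
  by rewrite (strict_min_uniq fD eD h emin) eqxx in fe.
have cU' : #|(U :\ e.1)%SET| = k by apply/eqP; rewrite -eqSS -cU (cardsD1 e.1 U) eU.
have cV' : #|(V :\ e.2)%SET| = k by apply/eqP; rewrite -eqSS -cV (cardsD1 e.2 V) eV.
have [->|[M [MD mM sM ->]]] := IH _ _ (y + c (u e)) cU' cV'; first by left.
right; exists (e |: M)%SET.
have subD f : f \in M -> [/\ f \in grid U V, f.1 != e.1 & f.2 != e.2].
  move=> /(fintype.subsetP MD); rewrite !inE => /andP[/andP[-> ->] /andP[-> ->]].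
  by [].
have eM : e \notin M by apply/negP => /subD[_]; rewrite eqxx.
split.
- apply/fintype.subsetP => f; rewrite in_setU1 => /predU1P[->//|/subD[]//].
- apply/forall_inP => f /setU1P[->|fM]; apply/forall_inP => g /setU1P[->|gM].
  + by rewrite /Defs.adjacent eqxx.
  + have [_ g1 g2] := subD g gM; rewrite /Defs.adjacent negb_and; apply/orP; right.
    by apply/existsPn => -[v|v] /=; rewrite negb_and; case: eqP => //= <-.
  + have [_ g1 g2] := subD f fM; rewrite /Defs.adjacent negb_and; apply/orP; right.
    by apply/existsPn => -[v|v] /=; rewrite negb_and orbC; case: eqP => //= <-.
  + by have /forall_inP/(_ f fM)/forall_inP/(_ g gM) := mM.
- move=> f fD; have [->|fe] := eqVneq f e; first by left; rewrite setU11.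
  have wef : c (u e) < c (u f).
    by apply: hc; move/forall_inP : emin; apply; rewrite in_setD1 fe.
  have [f1|f1] := eqVneq f.1 e.1.
    by right; exists (inl e.1), e; split; rewrite ?setU11//= f1.
  have [f2|f2] := eqVneq f.2 e.2.
    by right; exists (inr e.2), e; split; rewrite ?setU11//= f2.
  have [||[x [g [gM xf xg wg]]]] := sM f.
  + by move: fD; rewrite !inE f1 f2.
  + by left; rewrite setU1r.
  + by right; exists x, g; split; rewrite // setU1r.
- by rewrite big_setU1//= addrA.
Qed.

(** The inequality is strict only if ties make [greedy] vanish. It gives one
    inequality between laws, and passing to complements gives the other. *)
Lemma greedy_total_cost u : {homo c : a b / a < b} ->
  (greedy n [set: 'I_n]%SET [set: 'I_n]%SET u 0 <= G (total_cost (c \o u)))%E.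
Proof.
move=> hc.
have [] := @greedy_stable n [set: 'I_n]%SET [set: 'I_n]%SET u 0 _ _ hc; rewrite ?cardsT ?card_ord//.
  by move=> ->.
move=> [M [_ mM sM ->]]; rewrite add0r.
suff /stable_matchingP MM : is_stable_matching (c \o u) M.
  by rewrite /total_cost MM.
rewrite /is_stable_matching mM; apply/forallP => v; apply/forallP => v'.
have [|->//|[x [f [fM xe xf wf]]]] := sM (v, v'); first by rewrite !inE.
apply/orP; right; case: x xe xf => [i|i] /= /eqP ie xf; subst i.
  by rewrite (matching_costE _ mM fM)/= ?lte_fin ?wf// eqxx.
by apply/orP; right; rewrite (matching_costE _ mM fM)/= ?lte_fin ?wf// eqxx.
Qed.

Section expectation.
Variable mu : probability R R.
Hypothesis emu : expo_law mu.

(** The expectation of [greedy] as a recursion on numbers: [s] is the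
    exponential cost of the last selected edge, and with [k] vertices left on
    each side the next selected edge costs an exponential variable of rate
    [k ^ 2] more. *)
Fixpoint chain (k : nat) (s y : R) : \bar R :=
  if k is k'.+1 then
    (\int[mu]_x chain k' (s + x / (k ^ 2)%:R) (y + c (s + x / (k ^ 2)%:R)))%E
  else G y.

Lemma chain_ge0 k s y : (0 <= chain k s y)%E.
Proof. by case: k => //= k; apply: integral_ge0 => x _; elim: k s y x => //= k IH s y x; apply: integral_ge0. Qed.

Lemma measurable_chain k : measurable_fun setT (fun z : R * R => chain k z.1 z.2).
Proof.
elim: k => /= [|k IH]; first exact: measurableT_comp.
pose h (z : R * (R * R)) : \bar R :=
  chain k (z.2.1 + z.1 / (k.+1 ^ 2)%:R)
    (z.2.2 + c (z.2.1 + z.1 / (k.+1 ^ 2)%:R)).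
have mh : measurable_fun setT h.
  have m1 : measurable_fun setT
      (fun z : R * (R * R) => z.2.1 + z.1 / (k.+1 ^ 2)%:R).
    apply: measurable_funD.
      by apply: measurableT_comp => //; exact: measurable_snd.
    by apply: measurable_funM => //; exact: measurable_fst.
  have m2 : measurable_fun setT (fun z : R * (R * R) =>
      (z.2.1 + z.1 / (k.+1 ^ 2)%:R, z.2.2 + c (z.2.1 + z.1 / (k.+1 ^ 2)%:R))).
    apply/measurable_fun_pairP; split => //=.
    apply: measurable_funD; last exact: measurableT_comp.
    by apply: measurableT_comp => //; exact: measurable_snd.
  exact: (measurableT_comp IH m2).
have h0 z : (0 <= h z)%E by exact: chain_ge0.
exact: (measurable_fun_fubini_tonelli_G (m1 := mu) h mh h0).
Qed.

(** Sum over the first selected edge [e] and integrate over its cost [t]. The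
    [k ^ 2 - 1] other edges must exceed [t], which costs a factor
    [expR (- t) ^+ (k ^ 2 - 1)] and restarts the process from the level
    [s + t]; the sum over [e] is then computed by [expo_min]. *)
Lemma greedy_integral (L : probability (prodspace (edge n) R) R) k U V s y :
  iid_law mu L -> #|U| = k -> #|V| = k ->
  (\int[L]_z greedy k U V (fun e => s + z e)%R y = chain k s y)%E.
Proof.
move=> iL; elim: k U V s y => [|k IH] U V s y cU cV.
  by rewrite /= integral_cst//= probability_setT mule1.
have cD : #|grid U V| = (k.+1 ^ 2)%N by rewrite cardsX cU cV.
pose N := (k.+1 ^ 2)%N; have N0 : (0 < N)%N by rewrite expn_gt0.
pose H (t : R) := chain k (s + t) (y + c (s + t)).
have mH : measurable_fun setT H.
  have m2 : measurable_fun setT (fun t : R => (s + t, y + c (s + t))).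
    have m1 : measurable_fun [set: R] (fun t => s + t) by exact: measurable_funD.
    apply/measurable_fun_pairP; split => //=.
    by apply: measurable_funD => //; exact: measurableT_comp.
  exact: (measurableT_comp (measurable_chain k) m2).
have mcoord e : measurable_fun setT
    (fun z : prodspace (edge n) R => (s + z e)%R).
  by apply: measurable_funD => //; exact: (@measurable_coord (edge n) _ R e).
transitivity (\sum_(e in grid U V)
    \int[mu]_t ((expR (- t) ^+ N.-1)%:E * H t))%E; last first.
  rewrite sumr_const cD -/N.
  transitivity (N%:R%:E * \int[mu]_t ((expR (- t) ^+ N.-1)%:E * H t))%E.
    exact/esym/mule_natl.
  by apply: (expo_min emu N0 mH) => t; exact: chain_ge0.
pose h e (z : prodspace (edge n) R) : \bar R :=
  if strict_min (grid U V) (fun e => s + z e)%R e then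
    greedy k (U :\ e.1)%SET (V :\ e.2)%SET (fun e => s + z e)%R (y + c (s + z e))
  else 0%E.
have mh e : measurable_fun setT (h e).
  apply: measurable_fun_ifT => //.
    apply: measurable_forall => g.
    case: (g \in _) => /=; last exact: measurable_cst.
    exact: measurable_fun_ltr.
  apply: measurable_greedy => //.
  by apply: measurable_funD => //; exact: measurableT_comp.
have h0 e z : (0 <= h e z)%E by rewrite /h; case: ifP => // _; exact: greedy_ge0.
transitivity (\sum_(e in grid U V) \int[L]_z h e z)%E.
  rewrite -[RHS]big_enum/= -ge0_integral_sum//.
  by apply: eq_integral => z _; rewrite big_enum.
apply: eq_bigr => e eD.
have mhu : measurable_fun setT
    (fun p : R * prodspace (edge n) R => h e (upd p.2 e p.1)).
  exact: (measurableT_comp (mh e) (@measurable_upd (edge n) _ R e)).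
(* integrate over the cost [t] of the first selected edge last *)
rewrite (iid_fubini e iL)//.
have mE : measurable_fun setT (fun t : R => expR (- t) ^+ N.-1).
  apply: measurable_funX.
  by apply: measurableT_comp => //; exact: measurable_funN.
rewrite (expo_integral_pos emu); last 2 first.
- exact: (measurable_fun_fubini_tonelli_F (m2 := L) _ mhu (fun p => h0 e _)).
- by move=> t; exact: integral_ge0.
rewrite [RHS](expo_integral_pos emu); last 2 first.
- by apply: emeasurable_funM => //; exact/measurable_EFinP.
- move=> t; rewrite mule_ge0 ?chain_ge0// lee_fin exprn_ge0// expR_ge0.
apply: eq_integral => t; rewrite inE/= in_itv/= andbT => t0.
pose D' := (grid U V :\ e)%SET.
have cD' : #|D'| = N.-1.
  by have := cardsD1 e (grid U V); rewrite eD cD -/N /D' => ->.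
have eE z : upd z e t e = t by rewrite /upd eqxx.
have uE z f : f != e -> upd z e t f = z f by rewrite /upd => /negbTE ->.
have sub f : f \in grid (U :\ e.1)%SET (V :\ e.2)%SET -> f != e /\ f \in D'.
  rewrite !inE => /andP[/andP[f1 ->] /andP[f2 ->]]; rewrite !andbT.
  suff : f != e by [].
  by apply: contra f1 => /eqP ->.
pose F z := greedy k (U :\ e.1)%SET (V :\ e.2)%SET (fun e => s + z e)%R
  (y + c (s + t)).
(* [e] is the strict minimum exactly when all the other edges exceed [t] *)
transitivity (\int[L]_(z in above D' t) F z)%E.
  rewrite [RHS]integral_mkcond; apply: eq_integral => z _.
  rewrite patchE /h eE.
  have -> : strict_min (grid U V) (fun e0 => s + upd z e t e0) e =
      (z \in above D' t).
    apply/forall_inP/idP => [h1|].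
      rewrite inE => f fD /=; have := h1 f fD; rewrite eE ltrD2l uE//.
      by move: fD; rewrite !inE => /andP[].
    rewrite inE => h1 f fD; rewrite eE ltrD2l uE; first exact: h1.
    by move: fD; rewrite !inE => /andP[].
  case: ifP => // _; apply: greedy_ext => f /sub[fe _]; by rewrite uE.
rewrite (iid_memoryless emu _ iL (ltW t0)); last 2 first.
- by apply: measurable_greedy => //; exact: measurable_cst.
- by move=> z; exact: greedy_ge0.
rewrite cD'; congr (_ * _)%E; rewrite /H -(IH (U :\ e.1)%SET (V :\ e.2)%SET).
- apply: eq_integral => z _; apply: greedy_ext => f /sub[_ fD'].
  by rewrite /delay fD' addrA.
- by apply/eqP; rewrite -eqSS -cU (cardsD1 e.1 U); move: eD; rewrite inE => /andP[->].
- by apply/eqP; rewrite -eqSS -cV (cardsD1 e.2 V); move: eD; rewrite inE => /andP[_ ->].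
Qed.

End expectation.

End greedy.

(** * The total cost as a function of an i.i.d. sequence *)

Section chain_sequence.
Context (R : realType).
Variables (c : R -> R) (G : R -> \bar R).
Hypotheses (mc : measurable_fun setT c) (mG : measurable_fun setT G)
  (G0 : forall y, (0 <= G y)%E).

(** The exponential cost of the edge selected when [i.+1] vertices are left on
    each side, out of [k]: the step made with [j.+1] vertices left has rate
    [j.+1 ^ 2]. *)
Definition tau (i k : nat) (x : nat -> R) : R :=
  \sum_(i <= j < k) x j / (j.+1 ^ 2)%:R.

Definition seq_cost (k : nat) (s : R) (x : nat -> R) : R :=
  \sum_(i < k) c (s + tau i k x).

Lemma measurable_tau i k :
  measurable_fun setT (fun x : prodspace nat R => tau i k x).
Proof.
rewrite /tau; apply: measurable_sum => j; apply: measurable_funM => //.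
exact: (@measurable_coord nat _ R j).
Qed.

Lemma measurable_seq_cost k s :
  measurable_fun setT (fun x : prodspace nat R => seq_cost k s x).
Proof.
rewrite /seq_cost; apply: measurable_sum => j; apply: measurableT_comp => //.
by apply: measurable_funD => //; exact: measurable_tau.
Qed.

Lemma seq_cost_upd k s (x : nat -> R) t :
  seq_cost k.+1 s (upd x k t) =
  c (s + t / (k.+1 ^ 2)%:R) + seq_cost k (s + t / (k.+1 ^ 2)%:R) x.
Proof.
rewrite /seq_cost big_ord_recr/= addrC; congr (c _ + _).
  by rewrite /tau big_nat1 /upd eqxx.
apply: eq_bigr => i _; congr c; rewrite -addrA; congr (_ + _).
rewrite /tau big_nat_recr/=; last exact: ltnW.
rewrite addrC /upd eqxx; congr (_ + _).
by rewrite [LHS]big_nat_cond [RHS]big_nat_cond; apply: eq_bigr => j /andP[/andP[_ jk] _]; rewrite (ltn_eqF jk).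
Qed.

(** Coordinate [k] supplies the step made with [k.+1] vertices left on each
    side. *)
Lemma chain_sequence (mu : probability R R) (L : probability (prodspace nat R) R)
    k s y : iid_law mu L ->
  (chain c G mu k s y = \int[L]_x G (y + seq_cost k s x))%E.
Proof.
move=> iL; elim: k s y => [|k IH] s y /=.
  under eq_integral do rewrite /seq_cost big_ord0 addr0.
  by rewrite integral_cst//= probability_setT mule1.
rewrite (iid_fubini k iL)//; last first.
  apply: measurableT_comp => //.
  by apply: measurable_funD => //; exact: measurable_seq_cost.
apply: eq_integral => t _; rewrite IH.
by apply: eq_integral => x _; rewrite seq_cost_upd addrA.
Qed.

End chain_sequence.

Section weibull_tail.
Context (R : realType) (d : R).
Hypothesis d1 : 1 < d.

(** The density is the derivative of [- expR (- (x `^ d))]. *)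
Lemma weibull_tail (b : R) : 0 <= b ->
  weibull_prob d `]b, +oo[%classic = (expR (- (b `^ d)))%:E.
Proof.
move=> b0; have d0 : 0 < d by rewrite (lt_trans _ d1).
have dB0 : 0 < d - 1 by rewrite subr_gt0.
pose F x : R := - expR (- x `^ d).
pose f x : R := d * x `^ (d - 1) * expR (- (x `^ d)).
have cpow (p x : R) : 0 < x -> {for x, continuous (@powR R ^~ p)}.
  move=> x0; apply: differentiable_continuous; apply/derivable1_diffP.
  by apply: derivable_powR; rewrite in_itv/= x0.
have cexp (u : R -> R) (l : R) (H : set_system R) (FH : Filter H) :
    u x @[x --> H] --> l -> expR (- u x) @[x --> H] --> expR (- l).
  move=> ul; apply: (cvg_comp _ expR); last exact: continuous_expR.
  exact: cvgN.
have pow0 (p : R) : 0 < p -> x `^ p @[x --> b^'+] --> b `^ p.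
  move=> p0; move: b0; rewrite le_eqVlt => /predU1P[<-|b0].
    by rewrite powR0 ?gt_eqF//; exact: powR_cvg0.
  by apply: cvg_at_right_filter; exact: cpow.
have bpos x : x \in `]b, +oo[ -> 0 < x.
  by rewrite in_itv/= andbT; exact: le_lt_trans.
rewrite /weibull_prob.
transitivity (\int[lebesgue_measure]_(x in `]b, +oo[) (f x)%:E)%E.
  apply: eq_integral => x /[1!inE]/= xb.
  by rewrite /weibull_pdf ifT// ltW// bpos.
rewrite integral_itv_obnd_cbnd; last first.
  apply/measurable_EFinP; apply: open_continuous_measurable_fun => //.
  move=> x /[1!inE]/= xb.
  apply: cvgM; last by apply: cexp; apply: cpow; exact: bpos.
  by apply: cvgM; [exact: cvg_cst | apply: cpow; exact: bpos].
rewrite (@ge0_continuous_FTC2y _ f F b 0).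
- by rewrite /F sub0e -EFinN opprK.
- by move=> x x0; rewrite /f !mulr_ge0 ?powR_ge0 ?expR_ge0// ltW.
- apply/continuous_within_itvcyP; split.
    move=> x xb.
    apply: cvgM; last by apply: cexp; apply: cpow; exact: bpos.
    by apply: cvgM; [exact: cvg_cst | apply: cpow; exact: bpos].
  apply: cvgM; last by apply: cexp; exact: pow0.
  by apply: cvgM; [exact: cvg_cst | exact: pow0].
- rewrite -[X in _ --> X]oppr0; apply: cvgN.
  apply: (cvg_comp (fun x : R => x `^ d) (fun y => expR (- y))); last first.
    exact: cvgr_expR.
  apply/cvgryPge => A; near=> y.
  have y0 : 0 <= y by near: y; exact: nbhs_pinfty_ge.
  have yA : (Num.max A 0) `^ d^-1 <= y by near: y; exact: nbhs_pinfty_ge.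
  have := @ge0_ler_powR R d (ltW d0) _ _ (powR_ge0 _ _) y0 yA.
  rewrite -powRrM mulVf ?gt_eqF// powRr1 ?le_max ?lexx ?orbT//.
  by apply: le_trans; rewrite le_max lexx.
- move=> x x0; have h := is_derive1_powR d (le_lt_trans b0 x0); exact: ex_derive.
- by apply: cvgN; apply: cexp; exact: pow0.
- move=> x xb.
  have h := is_derive1_powR d (bpos _ xb).
  rewrite derive1E derive_val /f.
  by rewrite mulrN opprK mulrC.
Unshelve. all: by end_near. Qed.

End weibull_tail.

Section spow.
Context (R : realType).

(** Extended by the identity to the negative reals, so that it is increasing
    and invertible on the whole line: costs are nonnegative only almost
    surely. *)
Definition spow (p x : R) : R := if 0 <= x then x `^ p else x.

Lemma spow_ge0 p x : 0 <= x -> spow p x = x `^ p.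
Proof. by rewrite /spow => ->. Qed.

Lemma measurable_spow p : measurable_fun setT (spow p).
Proof.
apply: measurable_fun_ifT => //; first exact: measurable_fun_ler.
Qed.

Lemma spowK p q : p * q = 1 -> cancel (spow p) (spow q).
Proof.
move=> pq x; rewrite /spow; case: (leP 0 x) => [x0|x0].
  by rewrite powR_ge0 -powRrM pq powRr1.
by rewrite leNgt x0.
Qed.

Lemma spow_mono p : 0 < p -> {homo spow p : a b / a < b}.
Proof.
move=> p0 a b ab; rewrite /spow; case: (leP 0 a) => a0.
  have b0 : 0 < b by exact: le_lt_trans ab.
  by rewrite (ltW b0) gt0_ltr_powR// nnegrE// ltW.
case: (leP 0 b) => b0 //; exact: lt_le_trans (powR_ge0 _ _).
Qed.

End spow.

Section total_cost_law.
Context (R : realType) (d : R).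
Hypothesis d1 : 1 < d.
Let d0 : 0 < d. Proof. exact: lt_trans d1. Qed.
Let pd : d^-1 * d = 1. Proof. by rewrite mulVf// gt_eqF. Qed.
Let dp : d * d^-1 = 1. Proof. by rewrite mulfV// gt_eqF. Qed.

Section one_n.
Context dT (T : measurableType dT) (P : probability T R) (n : nat)
  (omega : edge n -> {RV P >-> R}).
Hypothesis iid_omega : iid_with_law omega (weibull_prob d).

Let ecost (e : edge n) : T -> R := fun t => spow d (omega e t).

Let measurable_ecost e : measurable_fun setT (ecost e).
Proof. by apply: (measurableT_comp (measurable_spow d)). Qed.

Let ecost_expo e (a : R) : 0 <= a ->
  P (ecost e @^-1` `]a, +oo[%classic) = (expR (- a))%:E.
Proof.
move=> a0.
have -> : ecost e @^-1` `]a, +oo[%classic =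
    omega e @^-1` `](a `^ d^-1), +oo[%classic.
  apply/seteqP; split => t /=; rewrite !in_itv/= !andbT /ecost.
    move=> h; have := spow_mono (p := d^-1) _ h.
    rewrite invr_gt0 => /(_ d0); rewrite (spowK dp) spow_ge0//.
  move=> h; have := spow_mono d0 h.
  by rewrite -(spow_ge0 _ a0) (spowK pd).
have [_ /(_ e)] := iid_omega.
move=> /(_ `](a `^ d^-1), +oo[%classic (measurable_itv _)).
rewrite /distribution/= /pushforward => ->.
by rewrite weibull_tail ?powR_ge0// -powRrM pd powRr1.
Qed.

Let S := prodspace (edge n) R.
Let Z : T -> S := fun t e => ecost e t.

Let measurable_Z : measurable_fun setT Z.
Proof. exact: measurable_prodspaceP. Qed.

Let ecost_law e A : measurable A -> P (ecost e @^-1` A) = expo_prob ltr01 A.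
Proof.
move=> mA.
pose f : {mfun T >-> R} := HB.pack (ecost e)
  (isMeasurableFun.Build _ _ _ _ _ (measurable_ecost e)).
change (distribution P f A = expo_prob ltr01 A).
apply: expo_law_unique => //; last exact: expo_prob1_law.
by move=> a a0; exact: ecost_expo.
Qed.

Let ZM : {mfun T >-> S} := HB.pack Z (isMeasurableFun.Build _ _ _ _ _ measurable_Z).

Let Z_iid : iid_law (expo_prob ltr01) (distribution P ZM).
Proof.
move=> s A us mA.
transitivity (P (\bigcap_(i in [set` [set e in s]%SET])
    (omega i @^-1` (spow d @^-1` A i)))).
  rewrite /distribution/= /pushforward; congr (P _).
  apply/seteqP; split => t /= h i; first by rewrite /= inE => /h.
  by move=> iS; apply: (h i); rewrite /= inE.
have [-> //] := iid_omega; last first.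
  by move=> i; rewrite -[X in measurable X]setTI; exact: measurable_spow.
transitivity (\prod_(i <- s) P (omega i @^-1` (spow d @^-1` A i)))%E.
  by rewrite big_uniq//; apply: eq_bigl => i; rewrite inE.
by apply: eq_bigr => i _; exact: ecost_law.
Qed.

(** The increasing map [spow d] makes the costs exponential without changing
    the matching. [greedy_total_cost] and [greedy_integral] give one
    inequality, for every measurable set; applied to the complement it gives
    the other. *)
Lemma stable_cost_law (mu : probability R R)
    (L : probability (prodspace nat R) R) (B : set R) :
  expo_law mu -> iid_law mu L -> measurable B ->
  distribution P (stable_cost omega) B =
  L ((fun x : prodspace nat R => seq_cost (spow d^-1) n 0 x) @^-1` B).
Proof.
move=> emu iL mB.
have mc := measurable_spow d^-1.
have hc : {homo spow d^-1 : a b / a < b} by apply: spow_mono; rewrite invr_gt0.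
have mcost : measurable_fun setT
    (fun x : prodspace nat R => seq_cost (spow d^-1) n 0 x).
  exact: measurable_seq_cost.
pose C : T -> R := stable_cost omega.
have mC : measurable_fun setT C by exact: measurable_stable_cost.
have ineq (E : set R) : measurable E ->
    (L ((fun x : prodspace nat R => seq_cost (spow d^-1) n 0 x) @^-1` E) <=
     P (C @^-1` E))%E.
  move=> mE; pose G (y : R) : \bar R := (\1_E y)%:E.
  have mG : measurable_fun setT G by apply/measurable_EFinP; exact: measurable_indic.
  have G0 y : (0 <= G y)%E by rewrite lee_fin.
  have indE d' (U : measurableType d') (Q : probability U R) (f : U -> R) :
      measurable_fun setT f -> Q (f @^-1` E) = (\int[Q]_u G (f u))%E.
    move=> mf; have mfE : measurable (f @^-1` E).
      by rewrite -[X in measurable X]setTI; exact: mf.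
    by rewrite -[in LHS](setIT (f @^-1` E)) -integral_indic.
  rewrite (indE _ _ L)// (indE _ _ P)//.
  under eq_integral do rewrite -[seq_cost _ _ _ _]add0r.
  rewrite -(chain_sequence mc mG G0 n 0 0 iL).
  have emu1 := @expo_prob1_law R.
  (* [mu] and the law built from the exponential density are equal *)
  have cE k s y : chain (spow d^-1) G mu k s y =
      chain (spow d^-1) G (expo_prob ltr01) k s y.
    elim: k s y => //= k IH s y.
    rewrite (@eq_measure_integral _ _ _ _ (expo_prob ltr01)); last first.
      by move=> A mA _; exact: expo_law_unique.
    by apply: eq_integral => x _; exact: IH.
  rewrite cE -(@greedy_integral _ n _ _ mc mG G0 _ emu1 (distribution P ZM) n
    [set: 'I_n]%SET [set: 'I_n]%SET 0 0 Z_iid)//; last 2 first.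
    by rewrite cardsT card_ord.
    by rewrite cardsT card_ord.
  rewrite ge0_integral_distribution//; last 2 first.
  - apply: measurable_greedy => // e.
    by apply: measurable_funD => //; exact: (@measurable_coord (edge n) _ R e).
  - by move=> z; exact: greedy_ge0.
  apply: ge0_le_integral => //.
  - by move=> t _; exact: greedy_ge0.
  - apply: measurable_greedy => // e.
    by apply: measurable_funD => //; exact: measurable_ecost.
  - exact: measurableT_comp.
  move=> t _ /=; under [X in greedy _ _ _ _ _ X]eq_fun do rewrite add0r.
  apply: le_trans (greedy_total_cost G0 _ hc) _.
  rewrite (_ : _ \o _ = (fun e => omega e t))//.
  by apply/funext => e /=; rewrite /Z /ecost (spowK dp).
apply/eqP; rewrite eq_le; apply/andP; split; last exact: ineq.
have mP : measurable (C @^-1` B).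
  by rewrite -[X in measurable X]setTI; exact: mC.
pose f (x : prodspace nat R) : R := seq_cost (spow d^-1) n 0 x.
have mL : measurable (f @^-1` B).
  by rewrite -[X in measurable X]setTI; exact: mcost.
have PC : P (C @^-1` (~` B)) = (1 - P (C @^-1` B))%E.
  exact: (probability_setC P mP).
have LC : L (f @^-1` (~` B)) = (1 - L (f @^-1` B))%E.
  exact: (probability_setC L mL).
have h : (L (f @^-1` (~` B)) <= P (C @^-1` (~` B)))%E.
  by apply: ineq; exact: measurableC.
move: h; rewrite PC LC.
have Pf : P (C @^-1` B) \is a fin_num by exact: fin_num_measure.
have Lf : L (f @^-1` B) \is a fin_num by exact: fin_num_measure.
change (1 - L (f @^-1` B) <= 1 - P (C @^-1` B) -> P (C @^-1` B) <= L (f @^-1` B))%E.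
by rewrite -(fineK Pf) -(fineK Lf) -!EFinB !lee_fin; lra.
Qed.

End one_n.

End total_cost_law.

(** Any finite box is a box over an initial segment, with full factors in the
    missing coordinates. *)
(** * Existence of an i.i.d. exponential sequence *)

Lemma iid_law_prefix (R : realType) d (T : measurableType d)
    (mu : probability T R) (L : set (@prodspace nat d T) -> \bar R) :
  (forall N (A : nat -> set T), (forall i, measurable (A i)) ->
    L (box (iota 0 N) A) = (\prod_(i <- iota 0 N) mu (A i))%E) ->
  iid_law mu L.
Proof.
move=> h s A us mA.
have [N sN] : exists N, forall i, i \in s -> i \in iota 0 N.
  exists (\max_(i <- s) i).+1 => i iS.
  by rewrite mem_iota/= add0n ltnS; exact: leq_bigmax_seq.
transitivity (L (box (iota 0 N) (fun i => if i \in s then A i else setT))).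
  congr L; apply/seteqP; split => x /= hx i; first by move=> _; case: ifP => // /hx.
  by move=> iS; have := hx i (sN i iS); rewrite iS.
rewrite h; last by move=> i; case: ifP.
rewrite (eq_bigr (fun i => if i \in s then mu (A i) else 1%E)); last first.
  by move=> i _; case: ifP => // _; rewrite probability_setT.
rewrite -big_mkcond/= -big_filter; apply: perm_big; apply: uniq_perm => //.
  exact/filter_uniq/iota_uniq.
by move=> i; rewrite mem_filter; case: (boolP (i \in s)) => //= /sN ->.
Qed.

Section digits.
Context (R : realType).
Implicit Types (v : R) (s : nat -> bool).

(** For [0 <= v < 1] this is the fractional part of [2 ^ i * v], whose first
    binary digit is the digit of index [i] of [v]. *)
Fixpoint remainder (i : nat) v : R :=
  if i is j.+1 then 2 * remainder j v - ((2^-1 <= remainder j v)%R)%:R else v.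

Definition bit v (i : nat) : bool := 2^-1 <= remainder i v.

Definition bin_sum s (N : nat) : R := \sum_(i < N) (s i)%:R / 2 ^+ i.+1.

Lemma binS s N : bin_sum s N.+1 = bin_sum s N + (s N)%:R / 2 ^+ N.+1.
Proof. by rewrite /bin_sum big_ord_recr. Qed.

Lemma bin_remainder v N : v = bin_sum (bit v) N + remainder N v / 2 ^+ N.
Proof.
elim: N => [|N IH]; first by rewrite /bin_sum big_ord0 add0r expr0 divr1.
rewrite binS [LHS]IH -addrA; congr (_ + _).
rewrite /= -/(bit v N) exprS.
have : (2 : R) ^+ N != 0 by rewrite expf_neq0.
by move=> h; field.
Qed.

Lemma remainder_itv v N : 0 <= v < 1 -> 0 <= remainder N v < 1.
Proof.
move=> v01; elim: N => //= N /andP[r0 r1].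
by case: (leP 2^-1 (remainder N v)) => h; rewrite /=; apply/andP; split; lra.
Qed.

(** Prescribing the first [N] binary digits of [v] confines it to a dyadic
    interval of length [2 ^- N]. *)
Lemma bitP v N s : 0 <= v < 1 ->
  (forall i, (i < N)%N -> bit v i = s i) <-> bin_sum s N <= v < bin_sum s N + 2 ^- N.
Proof.
move=> v01; have p0 k : 0 < (2 : R) ^+ k by rewrite exprn_gt0.
have p0' k : 0 < (2 : R) ^- k by rewrite invr_gt0.
have binE k : (forall i, (i < k)%N -> bit v i = s i) -> bin_sum (bit v) k = bin_sum s k.
  by move=> h; apply: eq_bigr => i _; rewrite h.
have eqv k : (forall i, (i < k)%N -> bit v i = s i) ->
    v = bin_sum s k + remainder k v * 2 ^- k.
  by move=> h; rewrite -binE//; exact: bin_remainder.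
split.
  move=> h; have /andP[r0 r1] := remainder_itv N v01.
  rewrite (eqv N h) lerDl mulr_ge0 ?(ltW (p0' _))//=.
  by rewrite ltrD2l gtr_pMl.
elim: N => // N IH.
rewrite binS; have -> : 2 ^- N.+1 = 2^-1 * 2 ^- N :> R by rewrite exprS invfM.
set q := 2 ^- N; have q0 : 0 < q by exact: p0'.
move=> /andP[h1 h2].
have hN : forall i, (i < N)%N -> bit v i = s i.
  apply: IH; rewrite -/q.
  by move: h1 h2; case: (s N) => /=; rewrite ?mul1r ?mul0r => h1 h2; apply/andP; split; lra.
move=> i; rewrite ltnS leq_eqVlt => /predU1P[->|]; last exact: hN.
have := eqv N hN; rewrite -/q => vE.
have rE : remainder N v * q = v - bin_sum s N by rewrite {2}vE; ring.
rewrite /bit -(ler_pM2r q0) rE.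
move: h1 h2; case: (s N) => /=; rewrite ?mul1r ?mul0r => h1 h2.
  by lra.
by apply/negbTE; rewrite -ltNge; lra.
Qed.

Lemma measurable_remainder i : measurable_fun setT (@remainder i).
Proof.
elim: i => [|i IH]; first exact: measurable_id.
apply: measurable_funB; first exact: measurable_funM.
rewrite (_ : (fun x => _) = (fun x : R => if 2^-1 <= remainder i x then 1 else 0)).
  by apply: measurable_fun_ifT => //; exact: measurable_fun_ler.
by apply/funext => x; case: ifP.
Qed.

End digits.

Lemma expo_setI_pos (R : realType) (mu : probability R R) (E : set R) :
  expo_law mu -> measurable E -> mu E = mu (E `&` `]0, +oo[%classic).
Proof.
move=> emu mE.
have mI : measurable (`]0, +oo[%classic : set R) by [].
have mC : measurable (~` `]0, +oo[%classic : set R) by exact: measurableC.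
have -> : mu E = (mu (E `&` (`]0%R, +oo[%classic : set R)) + mu (E `&` ~` (`]0%R, +oo[%classic : set R)))%E.
  rewrite -measureU//; last 3 first.
  - exact: measurableI.
  - exact: measurableI.
  - by rewrite setIACA setICr setI0.
  by rewrite -setIUr setUCr setIT.
suff -> : mu (E `&` ~` (`]0%R, +oo[%classic : set R)) = 0%E by rewrite adde0.
apply/eqP; rewrite -measure_le0.
have mu0 : (mu (~` (`]0%R, +oo[%classic : set R)) = 0)%E.
  by rewrite probability_setC// emu// oppr0 expR0 subee.
by rewrite -[leRHS]mu0; apply: le_measure; rewrite ?inE//; exact: measurableI.
Qed.

Section iid_sequence.
Context (R : realType) (mu : probability R R).
Hypothesis emu : expo_law mu.

(** Uniform on [0, 1[; the value 0 on the negligible set of [x <= 0] keeps it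
    inside [0, 1[ everywhere, where binary digits make sense. *)
Let uni (x : R) : R := if 0 < x then expR (- x) else 0.

Let uni_itv x : 0 <= uni x < 1.
Proof.
rewrite /uni; case: ifPn => x0; last by rewrite lexx ltr01.
by rewrite expR_ge0 expR_lt1 oppr_lt0.
Qed.

Let measurable_uni : measurable_fun setT uni.
Proof.
apply: measurable_fun_ifT => //; first exact: measurable_fun_ltr.
by apply: measurableT_comp => //; exact: measurable_funN.
Qed.

Let uni_lt b : 0 <= b <= 1 -> mu (uni @^-1` `]-oo, b[%classic) = b%:E.
Proof.
move=> /andP[b0 b1].
have mE : measurable (uni @^-1` `]-oo, b[%classic).
  by rewrite -[X in measurable X]setTI; exact: measurable_uni.
rewrite expo_setI_pos//.
move: b0; rewrite le_eqVlt => /predU1P[<-|b0].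
  rewrite (_ : _ `&` _ = set0) ?measure0// -subset0 => x /= [].
  by rewrite in_itv/= ltNge; have /andP[->] := uni_itv x.
have lnb : 0 <= - ln b by rewrite oppr_ge0 ln_le0.
rewrite -[in RHS](lnK b0) -[ln b]opprK -(emu lnb); congr (mu _).
apply/seteqP; split => x /=; rewrite !in_itv/= !andbT /uni.
  by move=> [+ x0]; rewrite x0 -{1}(lnK b0) ltr_expR ltrNl.
move=> h; have x0 : 0 < x by exact: le_lt_trans h.
by rewrite x0 -{1}(lnK b0) ltr_expR ltrNl.
Qed.

Let uni_co a b : 0 <= a -> a <= b -> b <= 1 ->
  mu (uni @^-1` `[a, b[%classic) = (b - a)%:E.
Proof.
move=> a0 ab b1.
have mE c : measurable (uni @^-1` `]-oo, c[%classic).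
  by rewrite -[X in measurable X]setTI; exact: measurable_uni.
rewrite (_ : _ @^-1` _ = uni @^-1` `]-oo, b[%classic `\` uni @^-1` `]-oo, a[%classic).
  rewrite measureD//; last by rewrite (le_lt_trans (probability_le1 _ _))// ltry.
  rewrite setIidr; last first.
    by move=> x /=; rewrite !in_itv/= => h; exact: lt_le_trans ab.
  transitivity (b%:E - a%:E)%E => //.
  by congr (_ - _)%E; apply: uni_lt; rewrite ?a0 ?b1 ?(le_trans a0)// (le_trans ab).
apply/seteqP; split => x /=; rewrite !in_itv/=.
  by move=> /andP[h1 h2]; split => //; apply/negP; rewrite -leNgt.
by move=> [h2 /negP]; rewrite -leNgt => -> .
Qed.

Let bits (x : R) : prodspace nat bool := bit (uni x).

Let measurable_bits : measurable_fun setT bits.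
Proof.
apply: measurable_prodspaceP => i; apply: measurable_fun_ler => //.
exact: (measurableT_comp (@measurable_remainder R i)).
Qed.

Let bitsM : {mfun R >-> prodspace nat bool} :=
  HB.pack bits (isMeasurableFun.Build _ _ _ _ _ measurable_bits).

Let bin_itv (s : nat -> bool) N : 0 <= bin_sum R s N :> R /\ bin_sum R s N + 2 ^- N <= 1 :> R.
Proof.
elim: N => [|N [h0 h1]]; first by rewrite /bin_sum big_ord0 add0r expr0 invr1.
have p0 : 0 < (2 : R) ^- N by rewrite invr_gt0 exprn_gt0.
rewrite binS; have -> : 2 ^- N.+1 = 2^-1 * 2 ^- N :> R by rewrite exprS invfM.
by case: (s N) => /=; rewrite ?mul1r ?mul0r; split; lra.
Qed.

Let bits_atom s N : mu (bits @^-1` box (iota 0 N) (fun i => [set s i])) =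
  (2^-1 ^+ N)%:E.
Proof.
have [b0 b1] := bin_itv s N.
rewrite (_ : _ @^-1` _ = uni @^-1` `[bin_sum R s N, (bin_sum R s N + 2 ^- N)[%classic).
  by rewrite uni_co// ?lerDl ?invr_ge0 ?exprn_ge0// addrC addKr exprVn.
apply/seteqP; split => x /=; rewrite in_itv/=.
  move=> h; apply/(bitP N s (uni_itv x)) => i iN.
  by apply: (h i); rewrite mem_iota.
by move=> /(bitP N s (uni_itv x)) h i; rewrite mem_iota/= add0n => /h.
Qed.

Let coin : probability bool R := distribution mu
  ((HB.pack (fun x => bits x 0%N) (isMeasurableFun.Build _ _ _ _ _
    (measurableT_comp (measurable_coord 0%N) measurable_bits))) : {mfun R >-> bool}).

Let coin1 b : coin [set b] = (2^-1)%:E.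
Proof.
rewrite -[2^-1]expr1 -(bits_atom (fun=> b) 1).
rewrite /coin /distribution/= /pushforward; congr (mu _).
apply/seteqP; split => x /=; first by move=> h i; rewrite inE => /eqP ->.
by move=> /(_ 0%N); apply; rewrite inE.
Qed.

(** Boxes whose factors are all singletons correspond to dyadic intervals. The
    other boxes follow by induction on [m], the number of coordinates with an
    arbitrary factor, by splitting the last such factor into singletons. *)
Let coin_iid : iid_law coin (distribution mu bitsM).
Proof.
apply: iid_law_prefix => N A mA.
suff : forall m, (m <= N)%N -> forall A : nat -> set bool, (forall i, measurable (A i)) ->
   (forall i, (m <= i)%N -> exists b, A i = [set b]) ->
   mu (bits @^-1` box (iota 0 N) A) = (\prod_(i <- iota 0 N) coin (A i))%E.
  move=> h; change (mu (bits @^-1` box (iota 0 N) A) =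
    (\prod_(i <- iota 0 N) coin (A i))%E).
  (* the box does not see the factors beyond [N], which may be taken to be
     singletons *)
  pose A' i := if (i < N)%N then A i else [set true].
  have := h N (leqnn _) A' _ _.
  have bA : box (iota 0 N) A' = box (iota 0 N) A.
    by apply/seteqP; split => x /= hx i iN; have := hx i iN;
      move: iN; rewrite mem_iota /A' /= add0n => ->.
  rewrite bA => ->.
  - by apply: eq_big_seq => i; rewrite mem_iota/= add0n /A' => ->.
  - by move=> i; rewrite /A'; case: ifP.
  - by move=> i iN; exists true; rewrite /A' ltnNge iN.
elim=> [_ {mA}A mA sA|m IH mN {mA}A mA sA].
  have [s sE] : exists s : nat -> bool, forall i, A i = [set s i].
    exists (fun i => true \in A i) => i; have [b ->] := sA i (leq0n i).
    by congr set1; apply/esym; case: b; [exact: mem_set|exact: memNset].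
  rewrite (_ : A = fun i => [set s i]); last exact/funext.
  rewrite bits_atom; under eq_bigr do rewrite coin1.
  by rewrite prodEFin big_const_seq count_predT size_iota iter_mulr_1.
pose A1 b i := if i == m then [set b] else A i.
have mA1 b i : measurable (A1 b i) by rewrite /A1; case: ifP.
have IH1 b : mu (bits @^-1` box (iota 0 N) (A1 b)) =
    (\prod_(i <- iota 0 N) coin (A1 b i))%E.
  apply: IH => //; first exact: ltnW.
  move=> i; rewrite leq_eqVlt => /predU1P[<-|mi].
    by exists b; rewrite /A1 eqxx.
  by rewrite /A1 gtn_eqF//; exact: sA.
have mB (B : set (prodspace nat bool)) : measurable B -> measurable (bits @^-1` B).
  by move=> mB; rewrite -[X in measurable X]setTI; exact: measurable_bits.
have mN' : m \in iota 0 N by rewrite mem_iota.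
have split b : box (iota 0 N) A `&` [set x | x m = b] =
    if b \in A m then box (iota 0 N) (A1 b) else set0.
  apply/seteqP; split => x /=.
    move=> [h <-]; rewrite mem_set; last exact: h.
    by move=> i iN; rewrite /A1; case: eqP => [->//|_]; exact: h.
  case: ifPn => //; rewrite inE => bA h; split.
    move=> i iN; have := h i iN; rewrite /A1; case: eqP => [->|//].
    by move=> /= ->.
  by have := h m mN'; rewrite /A1 eqxx.
have muS b : mu (bits @^-1` (box (iota 0 N) A `&` [set x | x m = b])) =
    ((b \in A m)%:R%:E * ((2^-1)%:E *
      \prod_(i <- rem m (iota 0 N)) coin (A i)))%E.
  rewrite split; case: ifPn => bA; last by rewrite preimage_set0 measure0 mul0e.
  rewrite mul1e IH1 (perm_big _ (perm_to_rem mN'))/= big_cons /A1 eqxx coin1.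
  congr (_ * _)%E; apply: eq_big_seq => i.
  rewrite mem_rem_uniq ?iota_uniq// inE => /andP[im _].
  by rewrite (negbTE im).
have mcoordm b : measurable ([set x | x m = b] : set (prodspace nat bool)).
  rewrite -[X in measurable X]setTI.
  exact: (@measurable_coord nat _ bool m measurableT [set b]).
rewrite (_ : bits @^-1` _ =
   bits @^-1` (box (iota 0 N) A `&` [set x | x m = true]) `|`
   bits @^-1` (box (iota 0 N) A `&` [set x | x m = false])); last first.
  rewrite -preimage_setU -setIUr (_ : _ `|` _ = setT) ?setIT//.
  by apply/seteqP; split => // x _ /=; case: (x m); [left|right].
rewrite measureU; last 3 first.
- by apply: mB; apply: measurableI => //; exact: measurable_box.
- by apply: mB; apply: measurableI => //; exact: measurable_box.
- by rewrite -subset0 => x /= [[_ ->] [_]].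
set W := (\prod_(i <- rem m (iota 0 N)) coin (A i))%E in muS.
transitivity ((true \in A m)%:R%:E * ((2^-1)%:E * W) +
              (false \in A m)%:R%:E * ((2^-1)%:E * W))%E.
  by congr (_ + _)%E; exact: muS.
rewrite (perm_big _ (perm_to_rem mN'))/= big_cons -/W.
have -> : coin (A m) = (((true \in A m)%:R + (false \in A m)%:R) * 2^-1)%:E.
  have AmE : A m = (A m `&` [set true]) `|` (A m `&` [set false]).
    rewrite -setIUr (_ : _ `|` _ = setT) ?setIT//.
    by apply/seteqP; split => // -[] _ /=; [left|right].
  transitivity (coin (A m `&` [set true]) + coin (A m `&` [set false]))%E.
    rewrite {1}AmE; apply: measureU => //.
    by rewrite -subset0 => x /= [[_ ->] [_]].
  have cE b : coin (A m `&` [set b]) = ((b \in A m)%:R * 2^-1)%:E.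
    case: (boolP (b \in A m)) => bA.
      rewrite setIidr ?coin1 ?mul1r// => x /= ->; exact: set_mem.
    rewrite (_ : _ `&` _ = set0) ?measure0 ?mul0r// -subset0 => x /= [xA xb].
    by move: bA; rewrite -xb mem_set.
  by rewrite mulrDl EFinD; congr (_ + _)%E; exact: cE.
by rewrite EFinM EFinD -muleA ge0_muleDl ?lee_fin.
Qed.

Let Lb := distribution mu bitsM.
Let B := prodspace nat bool.

(** Recovers [x] from the binary digits of [expR (- x)]. *)
Let decode (x : B) : R := - ln (limn (bin_sum R x)).

Let cvg_bin (x : nat -> bool) : cvgn (bin_sum R x).
Proof.
apply: nondecreasing_is_cvgn.
  apply/nondecreasing_seqP => N; rewrite binS lerDl divr_ge0// exprn_ge0//.
exists 1 => _ [N _ <-]; have [_] := bin_itv x N; apply: le_trans.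
by rewrite lerDl invr_ge0 exprn_ge0.
Qed.

Let measurable_decode : measurable_fun setT decode.
Proof.
apply: measurable_funN; apply: measurableT_comp => //.
apply: (@measurable_fun_cvg _ _ _ _ (fun N (x : B) => bin_sum R x N)) => [N|x _].
  rewrite /bin_sum; apply: measurable_sum => i; apply: measurable_funM => //.
  rewrite (_ : (fun x => _) = (fun x : B => if x i then 1 else 0)).
    by apply: measurable_fun_ifT => //; exact: (@measurable_coord nat _ bool i).
  by apply/funext => x; case: (x i).
exact: cvg_bin.
Qed.

Let decode_bits x : 0 < x -> decode (bits x) = x.
Proof.
move=> x0; rewrite /decode (_ : limn _ = uni x).
  by rewrite /uni x0 expRK opprK.
apply/cvg_lim => //.
rewrite (_ : bin_sum R (bits x) = fun N => uni x - remainder N (uni x) / 2 ^+ N); last first.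
  by apply/funext => N; rewrite {1}(bin_remainder (uni x) N) addrK.
rewrite -[X in _ --> X]subr0; apply: cvgB; first exact: cvg_cst.
apply: (@squeeze_cvgr _ _ _ _ (cst 0) (fun N => 2^-1 ^+ N)).
- near=> N; have /andP[r0 r1] := remainder_itv N (uni_itv x).
  have p0 : 0 < (2 : R) ^- N by rewrite invr_gt0 exprn_gt0.
  by rewrite /= mulr_ge0 ?(ltW p0)//= exprVn ler_piMl ?(ltW p0)// ltW.
- exact: cvg_cst.
- apply: cvg_expr; rewrite ger0_norm; last by rewrite invr_ge0.
  by rewrite invf_lt1// ltr1n.
Unshelve. all: by end_near. Qed.

Let decode_law A : measurable A -> Lb (decode @^-1` A) = mu A.
Proof.
move=> mA; change (mu (bits @^-1` (decode @^-1` A)) = mu A).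
have mdA : measurable (decode @^-1` A).
  by rewrite -[X in measurable X]setTI; exact: measurable_decode.
have mE : measurable (bits @^-1` (decode @^-1` A)).
  by rewrite -[X in measurable X]setTI; exact: measurable_bits.
rewrite expo_setI_pos// [RHS]expo_setI_pos//; congr (mu _).
by apply/seteqP; split => x /= [+ x0]; move: (x0); rewrite in_itv/= andbT => x1;
  rewrite decode_bits.
Qed.

Let interleave (z : B * B) : B := fun i => if odd i then z.2 i./2 else z.1 i./2.

Let measurable_interleave : measurable_fun setT interleave.
Proof.
apply: measurable_prodspaceP => i; rewrite /interleave; case: (odd i).
  apply: (measurableT_comp (@measurable_coord nat _ bool i./2)).
  exact: measurable_snd.
apply: (measurableT_comp (@measurable_coord nat _ bool i./2)).
exact: measurable_fst.
Qed.

Let interleaveM : {mfun (B * B)%type >-> B} :=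
  HB.pack interleave (isMeasurableFun.Build _ _ _ _ _ measurable_interleave).

(** The even and odd positions of an interleaved sequence involve disjoint
    sets of coins. *)
Let interleave_iid : iid_law coin (distribution (Lb \x Lb)%E interleaveM).
Proof.
move=> s A us mA.
pose s0 := [seq i./2 | i <- s & ~~ odd i]; pose s1 := [seq i./2 | i <- s & odd i].
pose A0 j := A j.*2; pose A1 j := A j.*2.+1.
have boxE : interleave @^-1` box s A = (box s0 A0 : set B) `*` (box s1 A1 : set B).
  apply/seteqP; split => -[x y] /=.
    move=> h; split => j /mapP[i]; rewrite mem_filter => /andP[oi iS] ->.
      by have := h i iS; rewrite /interleave (negbTE oi) /A0 even_halfK.
    by have := h i iS; rewrite /interleave oi /A1 odd_halfK// prednK// odd_gt0.
  move=> [h0 h1] i iS; rewrite /interleave; case: ifPn => oi.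
    have := h1 i./2; rewrite /A1 odd_halfK// prednK ?odd_gt0//; apply.
    by apply: map_f; rewrite mem_filter oi.
  have := h0 i./2; rewrite /A0 even_halfK//; apply.
  by apply: map_f; rewrite mem_filter oi.
change ((Lb \x Lb)%E (interleave @^-1` box s A) = (\prod_(i <- s) coin (A i))%E).
rewrite boxE product_measure1E; last 2 first.
- exact: measurable_box.
- exact: measurable_box.
have u0 : uniq s0.
  rewrite map_inj_in_uniq ?filter_uniq// => i j; rewrite !mem_filter.
  by move=> /andP[oi _] /andP[oj _] /(congr1 double); rewrite !even_halfK.
have u1 : uniq s1.
  rewrite map_inj_in_uniq ?filter_uniq// => i j; rewrite !mem_filter.
  move=> /andP[oi _] /andP[oj _] /(congr1 double); rewrite !odd_halfK//.
  by move=> /(congr1 S); rewrite !prednK ?odd_gt0.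
transitivity ((\prod_(j <- s0) coin (A0 j)) * (\prod_(j <- s1) coin (A1 j)))%E.
  by congr (_ * _)%E; [exact: coin_iid|exact: coin_iid].
have p0 : (\prod_(j <- s0) coin (A0 j) = \prod_(i <- s | ~~ odd i) coin (A i))%E.
  rewrite big_map big_filter; apply: eq_bigr => i oi.
  by rewrite /A0 even_halfK.
have p1 : (\prod_(j <- s1) coin (A1 j) = \prod_(i <- s | odd i) coin (A i))%E.
  rewrite big_map big_filter; apply: eq_bigr => i oi.
  by rewrite /A1 odd_halfK// prednK ?odd_gt0.
by rewrite p0 p1 muleC [RHS](bigID (fun i => odd i)).
Qed.

Let evens (x : B) : B := fun i => x i.*2.
Let odds (x : B) : B := fun i => x i.*2.+1.

Let measurable_evens : measurable_fun setT evens.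
Proof. by apply: measurable_prodspaceP => i; exact: (@measurable_coord nat _ bool i.*2). Qed.

Let measurable_odds : measurable_fun setT odds.
Proof. by apply: measurable_prodspaceP => i; exact: (@measurable_coord nat _ bool i.*2.+1). Qed.

(** Interleaving two independent coin sequences gives a coin sequence, and the
    law of a coin sequence is unique; hence its even and odd parts are
    independent coin sequences. *)
Let split_law (E1 E2 : set B) : measurable E1 -> measurable E2 ->
  Lb (evens @^-1` E1 `&` odds @^-1` E2) = (Lb E1 * Lb E2)%E.
Proof.
move=> mE1 mE2.
have mE : measurable (evens @^-1` E1 `&` odds @^-1` E2).
  apply: measurableI; rewrite -[X in measurable X]setTI.
    exact: measurable_evens.
  exact: measurable_odds.
apply: eq_trans (iid_law_unique coin_iid interleave_iid mE) _.
change ((Lb \x Lb)%E (interleave @^-1` (evens @^-1` E1 `&` odds @^-1` E2)) =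
  (Lb E1 * Lb E2)%E).
apply: eq_trans (product_measure1E Lb Lb mE1 mE2); congr ((Lb \x Lb)%E _).
have e1 x y : evens (interleave (x, y)) = x.
  by apply/funext => i; rewrite /evens /interleave odd_double doubleK.
have e2 x y : odds (interleave (x, y)) = y.
  by apply/funext => i; rewrite /odds /interleave /= odd_double/= uphalf_double.
by apply/seteqP; split => -[x y] /=; rewrite e1 e2.
Qed.

(** Keep the even coins for the first variable, split the odd coins in the
    same way for the following ones. *)
Let expo_seq (x : B) : prodspace nat R := fun k => decode (evens (iter k odds x)).

Let measurable_expo_seq : measurable_fun setT expo_seq.
Proof.
apply: measurable_prodspaceP => k; apply: (measurableT_comp measurable_decode).
apply: (measurableT_comp measurable_evens).
elim: k => [|k IH]; first exact: measurable_id.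
exact: (measurableT_comp measurable_odds IH).
Qed.

Let expo_seqM : {mfun B >-> prodspace nat R} :=
  HB.pack expo_seq (isMeasurableFun.Build _ _ _ _ _ measurable_expo_seq).

(** The binary digits of [expR (- x)], for one exponential variable [x], are
    independent fair coins; these can be divided into infinitely many
    independent sequences of coins, each decoded into an exponential variable. *)
Lemma exists_iid_sequence :
  exists L : probability (prodspace nat R) R, iid_law mu L.
Proof.
exists (distribution Lb expo_seqM); apply: iid_law_prefix => N A mA.
change (Lb (expo_seq @^-1` box (iota 0 N) A) = (\prod_(i <- iota 0 N) mu (A i))%E).
elim: N A mA => [|N IH] A mA.
  rewrite big_nil; apply: eq_trans (probability_setT Lb); congr (Lb _).
  by apply/seteqP; split.
have iotaS : iota 0 N.+1 = 0%N :: [seq i.+1 | i <- iota 0 N].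
  by rewrite /= -[1%N]addn0 iotaDl.
rewrite iotaS big_cons big_map -(IH (fun i => A i.+1))// -(decode_law (mA 0%N)).
rewrite -split_law; last 2 first.
- by rewrite -[X in measurable X]setTI; exact: measurable_decode.
- rewrite -[X in measurable X]setTI; apply: measurable_expo_seq => //.
  exact: measurable_box.
congr (Lb _); apply/seteqP; split => x /=.
  move=> h; split; first by apply: (h 0%N); rewrite mem_head.
  move=> i iN; have := h i.+1; rewrite /expo_seq iterSr; apply.
  by rewrite inE map_f ?orbT.
move=> [h0 h] i; rewrite inE => /predU1P[->//|/mapP[j jN ->]].
by rewrite /expo_seq iterSr; exact: h.
Qed.

End iid_sequence.

(** * Convergence in mean square *)

Section sqn.
Context d (T : measurableType d) (R : realType) (P : probability T R).
Implicit Types f g : T -> R.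

(** The second moment, as an extended real so that it makes sense for every
    function; [sqn (f - g)] is the squared L2 distance. *)
Definition sqn f : \bar R := (\int[P]_x (f x ^+ 2)%:E)%E.

Definition sqn_cvg (f : nat -> T -> R) g : Prop :=
  forall e : R, 0 < e -> exists N, forall n, (N <= n)%N ->
    (sqn (fun x => f n x - g x)%R <= e%:E)%E.

Lemma sqn_ge0 f : (0 <= sqn f)%E.
Proof. by apply: integral_ge0 => x _; rewrite lee_fin sqr_ge0. Qed.

Lemma measurable_sq f : measurable_fun setT f ->
  measurable_fun setT (fun x => (f x ^+ 2)%:E).
Proof. by move=> mf; apply/measurable_EFinP; exact: measurable_funX. Qed.

Lemma sqn_le f g : measurable_fun setT f -> measurable_fun setT g ->
  (forall x, f x ^+ 2 <= g x ^+ 2) -> (sqn f <= sqn g)%E.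
Proof.
move=> mf mg fg; apply: ge0_le_integral => //.
- by move=> x _; rewrite lee_fin sqr_ge0.
- exact: measurable_sq.
- exact: measurable_sq.
- by move=> x _; rewrite lee_fin.
Qed.

Lemma sqnZ c f : measurable_fun setT f ->
  sqn (fun x => c * f x)%R = ((c ^+ 2)%:E * sqn f)%E.
Proof.
move=> mf; rewrite -ge0_integralZl//.
- by apply: eq_integral => x _; rewrite exprMn EFinM.
- exact: measurable_sq.
- by move=> x _; rewrite lee_fin sqr_ge0.
- by rewrite lee_fin sqr_ge0.
Qed.

Lemma sqnC f g : sqn (fun x => f x - g x)%R = sqn (fun x => g x - f x)%R.
Proof. by apply: eq_integral => x _; rewrite -sqrrN opprB. Qed.

(** Weighted Cauchy-Schwarz inequality, by induction on [r]: the cross terms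
    are absorbed by completing a square. *)
Lemma sum_sqr_weight (I : Type) (r : seq I) (b w : I -> R) :
  (forall i, 0 < w i) ->
  (\sum_(i <- r) b i) ^+ 2 <= (\sum_(i <- r) w i) * \sum_(i <- r) (b i ^+ 2 / w i).
Proof.
move=> w0; elim: r => [|i r IH]; first by rewrite !big_nil expr2 !mul0r.
rewrite !big_cons; set B := \sum_(j <- r) b j in IH *.
set W := \sum_(j <- r) w j in IH *; set Q := \sum_(j <- r) _ in IH *.
have W0 : 0 <= W by apply: sumr_ge0 => j _; exact: ltW.
have wi := w0 i.
have Q0 : 0 <= Q by apply: sumr_ge0 => j _; rewrite divr_ge0 ?sqr_ge0// ltW.
set u := b i; set v := w i in wi *.
have -> : (v + W) * (u ^+ 2 / v + Q) = u ^+ 2 + v * Q + W * (u ^+ 2 / v) + W * Q.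
  by field; rewrite gt_eqF.
rewrite sqrrD -[X in X <= _]addrAC.
suff : u * B *+ 2 <= v * Q + W * (u ^+ 2 / v) by move: IH; lra.
have [We|W1] := eqVneq W 0.
  have : B ^+ 2 == 0 by rewrite eq_le sqr_ge0 andbT (le_trans IH)// We mul0r.
  rewrite sqrf_eq0 => /eqP ->.
  by rewrite We mulr0 mul0rn mul0r addr0 mulr_ge0// ltW.
have WP : 0 < W by rewrite lt0r W1.
have QB : B ^+ 2 / W <= Q by rewrite ler_pdivrMr// mulrC.
apply: (@le_trans _ _ (v * (B ^+ 2 / W) + W * (u ^+ 2 / v))); last first.
  by rewrite lerD2r ler_wpM2l// ltW.
rewrite -subr_ge0.
have -> : v * (B ^+ 2 / W) + W * (u ^+ 2 / v) - u * B *+ 2 =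
   (v * B - W * u) ^+ 2 / (v * W).
  by field; rewrite !gt_eqF.
by rewrite divr_ge0 ?sqr_ge0// mulr_ge0 ?ltW.
Qed.

Lemma sqn_sum (I : eqType) (r : seq I) (b : I -> T -> R) (w beta : I -> R) :
  (forall i, measurable_fun setT (b i)) -> (forall i, 0 < w i) ->
  (forall i, i \in r -> (sqn (b i) <= (beta i)%:E)%E) ->
  (sqn (fun x => \sum_(i <- r) b i x)%R <=
   ((\sum_(i <- r) w i) * \sum_(i <- r) (beta i / w i))%:E)%E.
Proof.
move=> mb w0 hb.
have W0 : 0 <= \sum_(i <- r) w i by apply: sumr_ge0 => i _; exact: ltW.
have mq i : measurable_fun setT (fun x => b i x ^+ 2 / w i).
  by apply: measurable_funM => //; exact: measurable_funX.
apply: (@le_trans _ _ (\int[P]_x ((\sum_(i <- r) w i)%:E *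
    \sum_(i <- r) (b i x ^+ 2 / w i)%:E))%E).
  apply: ge0_le_integral => //.
  - by move=> x _; rewrite lee_fin sqr_ge0.
  - by apply: measurable_sq; exact: measurable_sum.
  - apply: emeasurable_funM => //; apply: emeasurable_sum => i.
    exact/measurable_EFinP.
  - by move=> x _; rewrite sumEFin -EFinM lee_fin sum_sqr_weight.
rewrite ge0_integralZl//; last 2 first.
- by apply: emeasurable_sum => i; exact/measurable_EFinP.
- move=> x _; apply: sume_ge0 => i _.
  by rewrite lee_fin divr_ge0 ?sqr_ge0// ltW.
rewrite EFinM; apply: lee_wpmul2l; first by rewrite lee_fin.
rewrite ge0_integral_sum//; last 2 first.
- by move=> i; exact/measurable_EFinP.
- by move=> i x _; rewrite lee_fin divr_ge0 ?sqr_ge0// ltW.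
rewrite -sumEFin big_seq [leRHS]big_seq; apply: lee_sum => i iS.
under eq_integral do rewrite EFinM muleC.
rewrite ge0_integralZl//; last 3 first.
- exact: measurable_sq.
- by move=> x _; rewrite lee_fin sqr_ge0.
- by rewrite lee_fin invr_ge0 ltW.
rewrite muleC EFinM; apply: lee_wpmul2r; first by rewrite lee_fin invr_ge0 ltW.
exact: hb.
Qed.

Lemma sqnD2 f g (a b : R) : measurable_fun setT f -> measurable_fun setT g ->
  (sqn f <= a%:E)%E -> (sqn g <= b%:E)%E ->
  (sqn (fun x => f x + g x)%R <= (2 * (a + b))%:E)%E.
Proof.
move=> mf mg fa gb.
have := @sqn_sum _ [:: true; false] (fun i => if i then f else g) (fun=> 1)
  (fun i => if i then a else b).
have -> : (fun x => \sum_(i <- [:: true; false]) (if i then f else g) x) =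
    (fun x => f x + g x).
  by apply/funext => x; rewrite !big_cons big_nil addr0.
rewrite !big_cons !big_nil !addr0 !divr1; apply => //; first by case.
by case.
Qed.

Lemma sqn_markov f (e : R) : measurable_fun setT f -> 0 < e ->
  (P [set x | (e <= `|f x|)%R] <= (e ^- 2)%:E * sqn f)%E.
Proof.
move=> mf e0; have e20 : 0 < e ^- 2 by rewrite invr_gt0 exprn_gt0.
have mE : measurable [set x | e <= `|f x|].
  rewrite -[X in measurable X]setTI.
  by apply: (measurable_fun_ler _ _ measurableT (Y := [set true])) => //;
    exact: measurableT_comp.
rewrite -[P _]mul1e -integral_cst// -ge0_integralZl//; last 3 first.
- exact: measurable_sq.
- by move=> x _; rewrite lee_fin sqr_ge0.
- by rewrite lee_fin ltW.
apply: (@le_trans _ _ (\int[P]_(x in [set x | (e <= `|f x|)%R]) ((e ^- 2)%:E * (f x ^+ 2)%:E))%E).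
  apply: ge0_le_integral => //.
  - apply: emeasurable_funM => //; apply: measurable_funTS; exact: measurable_sq.
  - move=> x /= ex; rewrite -EFinM lee_fin mulrC ler_pdivlMr ?exprn_gt0// mul1r.
    by rewrite -[leRHS]real_normK ?num_real// lerXn2r ?nnegrE// ltW.
apply: ge0_subset_integral => //.
- by apply: emeasurable_funM => //; exact: measurable_sq.
- by move=> x _; rewrite -EFinM lee_fin mulr_ge0 ?sqr_ge0// ltW.
Qed.

End sqn.

Section ae_convergence.
Context d (T : measurableType d) (R : realType) (P : probability T R).

Lemma nneseries_lty_cvg (u : nat -> R) : (forall k, 0 <= u k) ->
  (\sum_(k <oo) (u k)%:E < +oo)%E -> cvgn (series u).
Proof.
move=> u0 uoo; apply: nondecreasing_is_cvgn; first exact: nondecreasing_series.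
set l := (\sum_(k <oo) (u k)%:E)%E in uoo.
have l0 : (0 <= l)%E by apply: nneseries_ge0 => k _ _; rewrite lee_fin.
have lfin : l \is a fin_num by rewrite ge0_fin_numE.
exists (fine l) => _ [n _ <-].
rewrite -lee_fin fineK// /series/= -sumEFin big_mkord -(big_mkord xpredT (fun k => (u k)%:E)).
by apply: nneseries_lim_ge => k _ _; rewrite lee_fin.
Qed.

(** The sum of the series has a finite integral, so it is finite almost
    everywhere. *)
Lemma ae_summable (h : nat -> T -> R) (c : R) :
  (forall k, measurable_fun setT (h k)) -> (forall k x, 0 <= h k x) -> 0 <= c ->
  (forall k, (\int[P]_x (h k x)%:E <= (c / (2 ^ k.+1)%:R)%:E)%E) ->
  {ae P, forall x, cvgn (series (h ^~ x))}.
Proof.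
move=> mh h0 c0 hint.
have mhE k : measurable_fun setT (fun x => (h k x)%:E) by exact/measurable_EFinP.
have h0E k x : (0 <= (h k x)%:E)%E by rewrite lee_fin.
pose H x := (\sum_(k <oo) (h k x)%:E)%E.
have mH : measurable_fun setT H by exact: ge0_emeasurable_sum.
have H0 x : (0 <= H x)%E by apply: nneseries_ge0 => k _ _.
have Hint : (\int[P]_x H x < +oo)%E.
  rewrite integral_nneseries//; apply: (@le_lt_trans _ _ c%:E); last exact: ltry.
  apply: le_trans (epsilon_trick0 xpredT c0).
  by apply: lee_nneseries => k *; [exact: integral_ge0|exact: hint].
have iH : P.-integrable setT H.
  by apply/integrableP; split => //; under eq_integral do rewrite gee0_abs//.
have := integrable_ae measurableT iH; apply: filterS => x /(_ I) Hx.
by apply: nneseries_lty_cvg => //; rewrite -/(H x) -ge0_fin_numE.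
Qed.

(** Fatou's lemma for an almost everywhere limit. *)
Lemma fatou_le (h : nat -> T -> \bar R) (g : T -> \bar R) (c : \bar R) :
  (forall k, measurable_fun setT (h k)) -> measurable_fun setT g ->
  (forall k x, (0 <= h k x)%E) -> (forall x, (0 <= g x)%E) ->
  {ae P, forall x, h k x @[k --> \oo] --> g x} ->
  (forall k, (\int[P]_x h k x <= c)%E) -> (\int[P]_x g x <= c)%E.
Proof.
move=> mh mg h0 g0 hg hc.
have mlim : measurable_fun setT (fun x => limn_einf (h ^~ x)).
  apply: measurableT_comp => //; apply: measurable_fun_limn_esup => k.
  exact: measurableT_comp.
have lim0 x : (0 <= limn_einf (h ^~ x))%E.
  rewrite limn_einf_lim; apply: lime_ge; first exact: is_cvg_einfs.
  by near=> n; apply: le_ereal_inf_tmp => _ [k _ <-].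
rewrite (ge0_ae_eq_integral (g := fun x => limn_einf (h ^~ x)))//; last first.
  by apply: filterS hg => x hx _; have [-> _] := cvg_limn_einf_sup hx.
apply: le_trans (fatou P measurableT mh _) _ => //.
rewrite limn_einf_lim; apply: lime_le; first exact: is_cvg_einfs.
near=> n; apply: le_trans (hc n); apply: ereal_inf_lbound; exists n => //=.
Unshelve. all: by end_near. Qed.

(** Along a subsequence with geometrically small distances the squared
    differences are almost everywhere summable, hence tend to 0. *)
Lemma sqn_ae_subseq (f : nat -> T -> R) (g : T -> R) :
  (forall k, measurable_fun setT (f k)) -> measurable_fun setT g ->
  sqn_cvg P f g -> exists phi : nat -> nat, (forall k, (k <= phi k)%N) /\
    {ae P, forall x, f (phi k) x @[k --> \oo] --> g x}.
Proof.
move=> mf mg fg.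
have /choice[N0 hN0] k : exists N, forall n, (N <= n)%N ->
    (sqn P (fun x => f n x - g x)%R <= (1 / (2 ^ k.+1)%:R)%:E)%E.
  by apply: fg; rewrite divr_gt0// ltr0n expn_gt0.
pose phi k := maxn (N0 k) k.
exists phi; split; first by move=> k; rewrite leq_maxr.
have mh k : measurable_fun setT (fun x => (f (phi k) x - g x) ^+ 2).
  by apply: measurable_funX; exact: measurable_funB.
have := @ae_summable (fun k x => (f (phi k) x - g x) ^+ 2) 1 mh
  (fun k x => sqr_ge0 _) ler01 (fun k => hN0 k _ (leq_maxl _ _)).
apply: filterS => x /cvg_series_cvg_0 h.
apply/cvgrPdist_lt => e e0.
have e20 : 0 < e ^+ 2 by rewrite exprn_gt0.
move/cvgrPdist_lt : h => /(_ _ e20); apply: filterS => k.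
rewrite sub0r normrN normrX distrC => h.
by move: h; rewrite ltr_sqr// nnegrE ltW.
Qed.

(** Riesz-Fischer theorem: a subsequence with geometrically small increments
    converges almost everywhere, and Fatou's lemma extends the Cauchy estimate
    to its limit. *)
Lemma sqn_complete (f : nat -> T -> R) : (forall k, measurable_fun setT (f k)) ->
  (forall e : R, 0 < e -> exists N, forall n m, (N <= n)%N -> (N <= m)%N ->
    (sqn P (fun x => f n x - f m x)%R <= e%:E)%E) ->
  exists g, measurable_fun setT g /\ sqn_cvg P f g.
Proof.
move=> mf cf.
have /choice[N0 hN0] k : exists N, forall n m, (N <= n)%N -> (N <= m)%N ->
    (sqn P (fun x => f n x - f m x)%R <= ((4 ^ k.+1)%:R^-1)%:E)%E.
  by apply: cf; rewrite invr_gt0 ltr0n expn_gt0.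
pose phi k := (\sum_(i < k.+1) (N0 i).+1)%N.
have phiS k : (phi k <= phi k.+1)%N by rewrite [leqRHS]/phi big_ord_recr leq_addr.
have phiN k : (N0 k <= phi k)%N.
  by rewrite /phi big_ord_recr/= addnS leqW// leq_addl.
have phik k : (k <= phi k)%N.
  by elim: k => // k IH; rewrite /phi big_ord_recr/= addnS ltnS (leq_trans IH)// leq_addr.
pose D k x := f (phi k.+1) x - f (phi k) x.
have mD k : measurable_fun setT (D k) by exact: measurable_funB.
have mDn k : measurable_fun setT (fun x => `|D k x|) by exact: measurableT_comp.
have p0 k : 0 < (2 ^ k.+1)%:R :> R by rewrite ltr0n expn_gt0.
have Dint k : (\int[P]_x (`|D k x|)%:E <= (2 / (2 ^ k.+1)%:R)%:E)%E.
  pose a : R := (2 ^ k.+1)%:R; have a0 : 0 < a by exact: p0.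
  apply: (@le_trans _ _ (\int[P]_x ((a^-1)%:E + a%:E * (D k x ^+ 2)%:E))%E).
    apply: ge0_le_integral => //.
    - exact/measurable_EFinP.
    - apply: emeasurable_funD => //; apply: emeasurable_funM => //.
      exact: measurable_sq.
    - move=> x _; rewrite -EFinM -EFinD lee_fin -real_normK ?num_real//.
      set z := `|_|.
      have : 0 <= (a * z - 1) ^+ 2 + a * z by rewrite addr_ge0 ?sqr_ge0// mulr_ge0 ?normr_ge0// ltW.
      rewrite (_ : _ + _ = a * (a^-1 + a * z ^+ 2 - z)); last by field; rewrite gt_eqF.
      by rewrite pmulr_rge0// subr_ge0.
  rewrite ge0_integralD//; last 3 first.
  - by move=> x _; rewrite lee_fin invr_ge0 ltW.
  - by move=> x _; rewrite -EFinM lee_fin mulr_ge0 ?sqr_ge0// ltW.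
  - by apply: emeasurable_funM => //; exact: measurable_sq.
  rewrite integral_cst//= probability_setT mule1 ge0_integralZl//; last 3 first.
  - exact: measurable_sq.
  - by move=> x _; rewrite lee_fin sqr_ge0.
  - by rewrite lee_fin ltW.
  have h : (sqn P (D k) <= ((4 ^ k.+1)%:R^-1)%:E)%E.
    by apply: hN0 => //; exact: leq_trans (phiN k) (phiS k).
  apply: (@le_trans _ _ ((a^-1)%:E + a%:E * ((4 ^ k.+1)%:R^-1)%:E)%E).
    by apply: leeD => //; apply: lee_wpmul2l => //; rewrite lee_fin ltW.
  rewrite -EFinM -EFinD lee_fin (_ : (4 ^ k.+1)%:R = a * a :> R); last first.
    by rewrite /a -natrM -expnMn.
  rewrite le_eqVlt; apply/orP; left; apply/eqP; field.
  by rewrite /a pnatr_eq0 expn_eq0.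
(* the limit superior is measurable, and equals the limit almost everywhere *)
pose G x := limn_esup (fun k => (f (phi k) x)%:E).
pose g x := fine (G x).
have mg : measurable_fun setT g.
  apply: measurableT_comp => //; apply: measurable_fun_limn_esup => k.
  exact/measurable_EFinP.
have aeg : {ae P, forall x, f (phi k) x @[k --> \oo] --> g x}.
  have := @ae_summable _ 2 mDn (fun k x => normr_ge0 _) (ler0n _ _) Dint.
  apply: filterS => x /normed_cvg cD.
  have cf' : cvgn (fun k => f (phi k) x).
    rewrite (_ : (fun k => _) = (fun k => f (phi 0%N) x + series (D ^~ x) k)).
      by apply: is_cvgD => //; exact: is_cvg_cst.
    apply/funext => k; rewrite /series/=; elim: k => [|k IH].
      by rewrite big_nil addr0.
    by rewrite big_nat_recr//= addrA -IH /D addrC subrK.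
  suff -> : g x = limn (fun k => f (phi k) x) by [].
  have cE : (f (phi k) x)%:E @[k --> \oo] --> (limn (fun k => f (phi k) x))%:E.
    by apply: cvg_EFin; [exact: nearW|exact: cf'].
  by rewrite /g /G; have [_ ->] := cvg_limn_einf_sup cE.
exists g; split => // e e0; have [N hN] := cf e e0; exists N => n Nn.
pose phi' k := phi (k + N)%N.
apply: (@fatou_le (fun k x => ((f n x - f (phi' k) x) ^+ 2)%:E)).
- by move=> k; apply: measurable_sq; exact: measurable_funB.
- by apply: measurable_sq; exact: measurable_funB.
- by move=> k x; rewrite lee_fin sqr_ge0.
- by move=> x; rewrite lee_fin sqr_ge0.
- apply: filterS aeg => x hx0.
  have hx : f (phi' k) x @[k --> \oo] --> g x.
    by move: hx0; rewrite -(cvg_shiftn N).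
  apply: cvg_EFin; first exact: nearW.
  rewrite /comp/=; apply: (@cvg_comp _ _ _ _ (fun y => y ^+ 2)); last exact: exprn_continuous.
  by apply: cvgB => //; exact: cvg_cst.
- move=> k; apply: hN => //.
  by rewrite /phi' (leq_trans _ (phik _))// leq_addl.
Qed.

End ae_convergence.

Section L2_limits.
Context d (T : measurableType d) (R : realType) (P : probability T R).
Implicit Types f g : T -> R.
Notation sqn := (sqn P).

Definition mean f : R := fine 'E_P[f].

Lemma sqn_Lfun1 f : measurable_fun setT f -> (sqn f < +oo)%E -> f \in Lfun P 1.
Proof.
move=> mf sf; apply/Lfun1_integrable/integrableP; split; first exact/measurable_EFinP.
apply: (@le_lt_trans _ _ (\int[P]_x (1 + (f x ^+ 2)%:E))%E).
  apply: ge0_le_integral => //.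
  - by apply: measurableT_comp => //; exact/measurable_EFinP.
  - by apply: emeasurable_funD => //; exact: measurable_sq.
  - move=> x _ /=; rewrite -EFinD lee_fin -[X in _ <= 1 + X]real_normK ?num_real//.
    have : 0 <= (`|f x| - 1) ^+ 2 + `|f x| by rewrite addr_ge0 ?sqr_ge0.
    by set z := `|_|; lra.
rewrite ge0_integralD//; last 2 first.
- by move=> x _; rewrite lee_fin sqr_ge0.
- exact: measurable_sq.
by rewrite integral_cst//= probability_setT mule1 lte_add_pinfty// ltry.
Qed.

Lemma mean_cst c : mean (cst c) = c.
Proof. by rewrite /mean expectation_cst. Qed.

Lemma meanB f g : f \in Lfun P 1 -> g \in Lfun P 1 ->
  mean (fun x => f x - g x) = mean f - mean g.
Proof.
move=> lf lg; rewrite /mean (_ : (fun x => _) = (f \- g))//.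
by rewrite expectationB// fineB// expectation_fin_num.
Qed.

(** Integrate [`|f| <= del + del^-1 * f ^+ 2]. *)
Lemma mean_small f (del : R) : measurable_fun setT f -> 0 < del ->
  (sqn f <= (del ^+ 2)%:E)%E -> `|mean f| <= 2 * del.
Proof.
move=> mf del0 sf.
have lf : f \in Lfun P 1 by apply: sqn_Lfun1 => //; exact: le_lt_trans sf (ltry _).
have /integrableP[mfE fint] : P.-integrable setT (EFin \o f).
  exact/Lfun1_integrable.
have h : (\int[P]_x `|(f x)%:E| <= (2 * del)%:E)%E.
  apply: (@le_trans _ _ (\int[P]_x (del%:E + (del^-1)%:E * (f x ^+ 2)%:E))%E).
    apply: ge0_le_integral => //.
    - by apply: measurableT_comp => //; exact/measurable_EFinP.
    - apply: emeasurable_funD => //; apply: emeasurable_funM => //.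
      exact: measurable_sq.
    - move=> x _ /=; rewrite -EFinM -EFinD lee_fin.
      rewrite -[X in _ <= _ + _ * X]real_normK ?num_real//.
      have : 0 <= (`|f x| - del) ^+ 2 + `|f x| * del.
        by rewrite addr_ge0 ?sqr_ge0// mulr_ge0 ?normr_ge0// ltW.
      set z := `|_|.
      rewrite (_ : _ + _ = del * (del + del^-1 * z ^+ 2 - z)); last by field; rewrite gt_eqF.
      by rewrite pmulr_rge0// subr_ge0.
  rewrite ge0_integralD//; last 3 first.
  - by move=> x _; rewrite lee_fin ltW.
  - by move=> x _; rewrite -EFinM lee_fin mulr_ge0 ?sqr_ge0// invr_ge0 ltW.
  - by apply: emeasurable_funM => //; exact: measurable_sq.
  rewrite integral_cst//= probability_setT mule1 ge0_integralZl//; last 3 first.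
  - exact: measurable_sq.
  - by move=> x _; rewrite lee_fin sqr_ge0.
  - by rewrite lee_fin invr_ge0 ltW.
  apply: (@le_trans _ _ (del%:E + (del^-1)%:E * (del ^+ 2)%:E)%E).
    by apply: leeD => //; apply: lee_wpmul2l => //; rewrite lee_fin invr_ge0 ltW.
  rewrite -EFinM -EFinD lee_fin le_eqVlt; apply/orP; left; apply/eqP; field.
  by rewrite gt_eqF.
rewrite -lee_fin; apply: le_trans h.
have -> : (`|mean f|%:E = `|\int[P]_x (f x)%:E|)%E.
  have <- : ('E_P[f] = \int[P]_x (f x)%:E)%E by rewrite unlock.
  by rewrite -(fineK (expectation_fin_num lf)).
exact: le_abse_integral.
Qed.

Lemma sqn_cst c : sqn (cst c) = (c ^+ 2)%:E.
Proof.
transitivity (\int[P]_x (cst (c ^+ 2)%:E x))%E => //.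
by rewrite integral_cst//= probability_setT mule1.
Qed.

Lemma sqnD_lty f g : measurable_fun setT f -> measurable_fun setT g ->
  (sqn f < +oo)%E -> (sqn g < +oo)%E -> (sqn (fun x => f x + g x)%R < +oo)%E.
Proof.
move=> mf mg sf sg.
have ff : sqn f \is a fin_num by rewrite ge0_fin_numE// sqn_ge0.
have gf : sqn g \is a fin_num by rewrite ge0_fin_numE// sqn_ge0.
apply: (le_lt_trans (@sqnD2 _ _ _ P f g (fine (sqn f)) (fine (sqn g)) mf mg _ _)).
- by rewrite fineK.
- by rewrite fineK.
- by rewrite ltry.
Qed.

Section cvg.
Variables (f : nat -> T -> R) (g : T -> R).
Hypotheses (mf : forall n, measurable_fun setT (f n)) (mg : measurable_fun setT g).
Hypothesis fg : sqn_cvg P f g.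

Lemma sqn_cvg_lty : (forall n, sqn (f n) < +oo)%E -> (sqn g < +oo)%E.
Proof.
move=> sf; have [N /(_ N (leqnn _)) h] := fg ltr01.
have -> : g = (fun x => f N x + (g x - f N x)) by apply/funext => x; rewrite addrC subrK.
apply: sqnD_lty => //; first exact: measurable_funB.
by rewrite sqnC; exact: le_lt_trans h (ltry _).
Qed.

Hypothesis sf : (forall n, sqn (f n) < +oo)%E.

Lemma sqn_cvg_mean : forall e : R, 0 < e ->
  exists N, forall n, (N <= n)%N -> `|mean (f n) - mean g| <= e.
Proof.
move=> e e0; have e20 : 0 < (e / 2) ^+ 2 by rewrite exprn_gt0// divr_gt0.
have [N hN] := fg e20; exists N => n Nn.
rewrite -meanB; last 2 first.
- exact: sqn_Lfun1.
- by apply: sqn_Lfun1 => //; exact: sqn_cvg_lty.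
rewrite (_ : e = 2 * (e / 2)); last by field.
by apply: mean_small; [exact: measurable_funB|exact: divr_gt0|exact: hN].
Qed.

Lemma sqn_cvg_centred :
  sqn_cvg P (fun n x => f n x - mean (f n)) (fun x => g x - mean g).
Proof.
move=> e e0; have e40 : 0 < e / 4 by rewrite divr_gt0.
pose r := Num.min 1 (e / 4); have r0 : 0 < r by rewrite lt_min ltr01.
have [N1 hN1] := fg e40; have [N2 hN2] := sqn_cvg_mean r0.
exists (maxn N1 N2) => n; rewrite geq_max => /andP[n1 n2].
rewrite (_ : (fun x => _) =
  (fun x => (f n x - g x) + cst (mean g - mean (f n)) x)); last first.
  by apply/funext => x /=; lra.
rewrite (_ : e = 2 * (e / 4 + e / 4)); last by field.
apply: sqnD2.
- exact: measurable_funB.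
- exact: measurable_cst.
- exact: hN1.
- rewrite sqn_cst lee_fin -real_normK ?num_real// distrC.
  have := hN2 n n2; set z := `|_| => zr.
  have [z1 ze] : z <= 1 /\ z <= e / 4 by move: zr; rewrite le_min => /andP[].
  apply: le_trans ze; rewrite expr2 -[leRHS]mul1r ler_wpM2r//.
  by rewrite /z.
Qed.

(** For every [t > 0],
    [(a + b) ^+ 2 <= (1 + t) * a ^+ 2 + (1 + t^-1) * b ^+ 2]; with [t] small
    this plays the role of the triangle inequality for the L2 norm. *)
Lemma sqn_cvg_sqn : sqn (f n) @[n --> \oo] --> sqn g.
Proof.
have sg := sqn_cvg_lty sf.
have gE : (fine (sqn g))%:E = sqn g by rewrite fineK// ge0_fin_numE// sqn_ge0.
have fE n : (fine (sqn (f n)))%:E = sqn (f n).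
  by rewrite fineK// ge0_fin_numE// sqn_ge0.
pose A := fine (sqn g).
have A0 : 0 <= A by apply: fine_ge0; exact: sqn_ge0.
rewrite -gE; apply: cvg_EFin; first by apply: nearW => n; rewrite -fE.
apply/cvgrPdist_le => e e0.
have bound (u v : T -> R) (t c U : R) : 0 < t -> measurable_fun setT u ->
    measurable_fun setT v -> (sqn u <= U%:E)%E -> (sqn (fun x => v x - u x)%R <= c%:E)%E ->
    (sqn v <= ((1 + t) * U + (1 + t^-1) * c)%:E)%E.
  move=> t0 mu mv hu hv.
  apply: (@le_trans _ _ (\int[P]_x ((1 + t)%:E * (u x ^+ 2)%:E +
      (1 + t^-1)%:E * ((v x - u x) ^+ 2)%:E))%E).
    apply: ge0_le_integral => //.
    - by move=> x _; rewrite lee_fin sqr_ge0.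
    - exact: measurable_sq.
    - apply: emeasurable_funD; apply: emeasurable_funM => //.
        exact: measurable_sq.
      by apply: measurable_sq; exact: measurable_funB.
    - move=> x _; rewrite -!EFinM -EFinD lee_fin -subr_ge0.
      rewrite (_ : _ - _ = (t * u x - (v x - u x)) ^+ 2 / t); last first.
        by field; rewrite gt_eqF.
      by rewrite divr_ge0 ?sqr_ge0// ltW.
  have t1 : 0 <= 1 + t by rewrite addr_ge0// ltW.
  have t2 : 0 <= 1 + t^-1 by rewrite addr_ge0// invr_ge0 ltW.
  have msu := measurable_sq mu.
  have msv := measurable_sq (measurable_funB mv mu).
  rewrite ge0_integralD//; last 4 first.
  - by move=> x _; rewrite -EFinM lee_fin mulr_ge0 ?sqr_ge0.
  - exact: emeasurable_funM.
  - by move=> x _; rewrite -EFinM lee_fin mulr_ge0 ?sqr_ge0.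
  - exact: emeasurable_funM.
  rewrite !ge0_integralZl//; last 2 first.
  - by move=> x _; rewrite lee_fin sqr_ge0.
  - by move=> x _; rewrite lee_fin sqr_ge0.
  rewrite [leRHS]EFinD [X in (_ <= X + _)%E]EFinM [X in (_ <= _ + X)%E]EFinM; apply: leeD; apply: lee_wpmul2l; rewrite ?lee_fin//.
(* [t] is such that [t * A] and [t * sqn (f n)] are both at most [e / 2] *)
pose t := Num.min 1 (e / (2 * (A + e + 1))).
have Ae : 0 < A + e + 1 by lra.
have t0 : 0 < t by rewrite lt_min ltr01 divr_gt0// mulr_gt0.
have tA : t * (A + e + 1) <= e / 2.
  rewrite -ler_pdivlMr//; apply: (@le_trans _ _ (e / (2 * (A + e + 1)))).
    by rewrite /t ge_min lexx orbT.
  by rewrite le_eqVlt; apply/orP; left; apply/eqP; field; rewrite gt_eqF.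
have t20 : 0 < 1 + t^-1 by rewrite addr_gt0// invr_gt0.
pose c := e / 2 / (1 + t^-1); have c0 : 0 < c by rewrite !divr_gt0.
have cE : (1 + t^-1) * c = e / 2 by rewrite /c mulrC divfK// gt_eqF.
have [N hN] := fg c0; exists N => // n /= Nn.
have h1 : (sqn (f n) <= ((1 + t) * A + e / 2)%:E)%E.
  by rewrite -cE; apply: (bound g) => //; [rewrite /A gE|exact: hN].
have {}h1 : fine (sqn (f n)) <= (1 + t) * A + e / 2 by rewrite -lee_fin fE.
have h2 : (sqn g <= ((1 + t) * fine (sqn (f n)) + e / 2)%:E)%E.
  by rewrite -cE; apply: (bound (f n)) => //; [rewrite fE|rewrite sqnC; exact: hN].
have {}h2 : A <= (1 + t) * fine (sqn (f n)) + e / 2 by rewrite -lee_fin gE.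
set F := fine (sqn (f n)) in h1 h2 *; rewrite -/A.
have FA : F <= A + e by have : t * A <= t * (A + e + 1); [rewrite ler_wpM2l ?ltW//; lra|lra].
have tF : t * F <= t * (A + e + 1) by rewrite ler_wpM2l ?ltW//; lra.
have tA' : t * A <= t * (A + e + 1) by rewrite ler_wpM2l ?ltW//; lra.
by rewrite ler_norml; apply/andP; split; lra.
Qed.

End cvg.

End L2_limits.

Section cdf_limit.
Context d (T : measurableType d) (R : realType) (P : probability T R).

Lemma measurable_le_set (f : T -> R) (x : R) : measurable_fun setT f ->
  measurable [set t | f t <= x].
Proof.
move=> mf; rewrite -[X in measurable X]setTI.
by apply: (measurable_fun_ler mf _ measurableT (Y := [set true])) => //.
Qed.

Lemma measurable_gt_set (f : T -> R) (x : R) : measurable_fun setT f ->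
  measurable [set t | x < f t].
Proof.
move=> mf; rewrite -[X in measurable X]setTI.
by apply: (measurable_fun_ltr _ mf measurableT (Y := [set true])) => //.
Qed.

Lemma measurable_abs_ge_set (f : T -> R) (x : R) : measurable_fun setT f ->
  measurable [set t | x <= `|f t|].
Proof.
move=> mf; rewrite -[X in measurable X]setTI.
by apply: (measurable_fun_ler _ _ measurableT (Y := [set true])) => //;
  exact: measurableT_comp.
Qed.

(** By Chebyshev's inequality, [f] and [g] are at distance at least [del] with
    probability at most [c]. *)
Lemma prob_le_perturb (f g : T -> R) (x del c : R) : measurable_fun setT f ->
  measurable_fun setT g -> 0 < del ->
  (sqn P (fun t => f t - g t)%R <= (c * del ^+ 2)%:E)%E ->
  (P [set t | (f t <= x)%R] <= P [set t | (g t <= x + del)%R] + c%:E)%E.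
Proof.
move=> mf mg del0 hc.
have mfg : measurable_fun setT (fun t => f t - g t) by exact: measurable_funB.
have mA := measurable_le_set (x + del) mg.
have mB := measurable_abs_ge_set del mfg.
apply: (@le_trans _ _ (P [set t | (g t <= x + del)%R] +
    P [set t | (del <= `|f t - g t|)%R])%E).
  apply: le_trans (measureU2 P mA mB); apply: le_measure; rewrite ?inE.
  - exact: measurable_le_set.
  - exact: measurableU.
  - move=> t /= ft; have [h|h] := leP del `|f t - g t|; first by right.
    left; rewrite /=; have := ler_norm (g t - f t); rewrite distrC; lra.
apply: leeD => //; apply: le_trans (sqn_markov P mfg del0) _.
rewrite -[leRHS](_ : ((del ^- 2)%:E * (c * del ^+ 2)%:E)%E = _).
  by apply: lee_wpmul2l => //; rewrite lee_fin invr_ge0 exprn_ge0// ltW.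
by rewrite -EFinM mulrC mulfK// gt_eqF// exprn_gt0.
Qed.

Lemma sqn_cvg_cdf (f : nat -> T -> R) (g : T -> R) (x : R) :
  (forall n, measurable_fun setT (f n)) -> measurable_fun setT g ->
  sqn_cvg P f g ->
  {for x, continuous (fun y => P [set t | g t <= y])} ->
  P [set t | f n t <= x] @[n --> \oo] --> P [set t | g t <= x].
Proof.
move=> mf mg fg cg.
pose F y := fine (P [set t | g t <= y]).
have FE y : P [set t | g t <= y] = (F y)%:E by rewrite fineK// fin_num_measure//; exact: measurable_le_set.
pose H n := fine (P [set t | f n t <= x]).
have HE n : P [set t | f n t <= x] = (H n)%:E by rewrite fineK// fin_num_measure//; exact: measurable_le_set.
have cF : F y @[y --> x] --> F x.
  by apply: fine_cvg; rewrite -FE; exact: cg.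
rewrite FE; apply: cvg_EFin; first by apply: nearW => n; rewrite HE.
apply/cvgrPdist_le => e e0.
have e20 : 0 < e / 2 by rewrite divr_gt0.
move/cvgrPdist_le : cF => /(_ _ e20) [del /= del0 hdel].
have d20 : 0 < del / 2 by rewrite divr_gt0.
have c0 : 0 < e / 2 * (del / 2) ^+ 2 by rewrite mulr_gt0// exprn_gt0.
have [N hN] := fg _ c0; exists N => // n /= Nn; rewrite -/(H n).
have h1 : H n <= F (x + del / 2) + e / 2.
  rewrite -lee_fin EFinD -HE -FE; apply: prob_le_perturb => //; exact: hN.
have h2 : F (x - del / 2) <= H n + e / 2.
  rewrite -lee_fin EFinD -HE -FE -[x in X in (_ <= X + _)%E](subrK (del / 2)).
  by apply: prob_le_perturb => //; rewrite sqnC; exact: hN.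
have h3 : `|F x - F (x + del / 2)| <= e / 2.
  apply: hdel; rewrite /ball/= opprD addNKr normrN gtr0_norm//; lra.
have h4 : `|F x - F (x - del / 2)| <= e / 2.
  apply: hdel; rewrite /ball/= opprB addrC subrK gtr0_norm//; lra.
move: h3 h4; rewrite !ler_norml => /andP[a1 a2] /andP[b1 b2].
by apply/andP; split; lra.
Qed.

(** Lowering the level by 1 absorbs the distance between [f n] and [g], which
    exceeds 1 with vanishing probability. *)
Lemma sqn_cvg_gt (f : nat -> T -> R) (g : T -> R) (x c : R) :
  (forall n, measurable_fun setT (f n)) -> measurable_fun setT g ->
  sqn_cvg P f g -> (forall n, (c%:E <= P [set t | (x < f n t)%R])%E) ->
  (c%:E <= P [set t | (x - 1 < g t)%R])%E.
Proof.
move=> mf mg fg hc; apply/lee_addgt0Pr => e e0.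
have [N /(_ N (leqnn _)) h] := fg e e0.
have sC (u : T -> R) (y : R) : measurable_fun setT u ->
    (P [set t | (y < u t)%R] = 1 - P [set t | (u t <= y)%R])%E.
  move=> mu; rewrite -probability_setC; last exact: measurable_le_set.
  by congr (P _); apply/seteqP; split => t /=; rewrite ltNge => /negP.
have := hc N; rewrite !sC//; move=> hN.
have := @prob_le_perturb g (f N) (x - 1) 1 e mg (mf N) ltr01.
rewrite sqnC expr1n mulr1 subrK => /(_ h).
move: hN.
have pf : P [set t | f N t <= x] \is a fin_num.
  by apply: fin_num_measure; exact: measurable_le_set.
have qf : P [set t | g t <= x - 1] \is a fin_num.
  by apply: fin_num_measure; exact: measurable_le_set.
rewrite -(fineK pf) -(fineK qf) -!EFinB -!EFinD !lee_fin.
set a := fine _; set b := fine _; lra.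
Qed.

End cdf_limit.

(** * Linear forms in exponential variables *)

Section moments.
Context (R : realType) (mu : probability R R).
Hypothesis emu : expo_law mu.
Local Open Scope ereal_scope.

(** The mean is the integral of the tail, and the tail of this law is its own
    density. *)
Lemma expo_abs : \int[mu]_x (`|x|%R)%:E = 1.
Proof.
pose X : {mfun R >-> R} := HB.pack (fun x : R => `|x|%R)
  (isMeasurableFun.Build _ _ _ _ _ (@normr_measurable R setT)).
have := @ge0_expectation_ccdf _ _ R mu X (fun x => normr_ge0 x).
rewrite unlock /= => ->.
transitivity (\int[@lebesgue_measure R]_(r in `[0%R, +oo[)
    (exponential_pdf 1%R r)%:E).
  apply: eq_integral => r; rewrite inE/= in_itv/= andbT => r0.
  rewrite exponential_pdfE// mul1r mulN1r -(emu r0).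
  rewrite /ccdf /distribution /= /pushforward/=.
  have mA : measurable (X @^-1` `]r, +oo[%classic) by exact: measurable_funPTI.
  rewrite (expo_setI_pos emu mA); congr (mu _).
  apply/seteqP; split => x /=; rewrite !in_itv/= !andbT.
    by move=> [h x0]; move: h; rewrite gtr0_norm.
  by move=> rx; have x0 := le_lt_trans r0 rx; rewrite gtr0_norm.
rewrite -(@integral_exponential_pdf R 1%R ltr01) integral_mkcond.
apply: eq_integral => x _; rewrite patchE; case: ifPn => //.
rewrite notin_setE/= in_itv/= andbT => /negP; rewrite -ltNge => x0.
by rewrite lt0_exponential_pdf.
Qed.

(** The integrand [expR (x / 2) * expR (- x)] is twice the density of the
    exponential law of rate 1/2. *)
Lemma expo_exp : \int[mu]_x (expR (`|x| / 2))%:E = 2%:E.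
Proof.
have mE : measurable_fun setT (fun x : R => (expR (`|x| / 2))%:E).
  apply/measurable_EFinP; apply: measurableT_comp => //.
  by apply: measurable_funM => //; exact: normr_measurable.
have h0 : (0 < (2^-1 : R))%R by rewrite invr_gt0.
rewrite (expo_integral emu)//.
transitivity (\int[@lebesgue_measure R]_x (2%:E * (exponential_pdf (2^-1)%R x)%:E)).
  apply: eq_integral => x _; rewrite -!EFinM; congr EFin.
  have [x0|x0] := leP 0%R x; last by rewrite !lt0_exponential_pdf ?mulr0.
  rewrite !exponential_pdfE// ger0_norm// mul1r mulN1r -expRD mulrA mulfV//.
  by rewrite mul1r; congr expR; field.
rewrite ge0_integralZl//; last 2 first.
- by apply/measurable_EFinP; exact: measurable_exponential_pdf.
- by move=> x _; rewrite lee_fin exponential_pdf_ge0// ltW.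
by rewrite integral_exponential_pdf ?mule1.
Qed.

Lemma expo_sqr : \int[mu]_x (x ^+ 2)%:E < +oo.
Proof.
apply: (@le_lt_trans _ _ (\int[mu]_x (16%:E * (expR (`|x| / 2))%:E))).
  apply: ge0_le_integral => //.
  - by move=> x _; rewrite lee_fin sqr_ge0.
  - by apply/measurable_EFinP; exact: measurable_funX.
  - apply: emeasurable_funM => //.
    apply/measurable_EFinP; apply: measurableT_comp => //.
    by apply: measurable_funM => //; exact: normr_measurable.
  - move=> x _; rewrite -EFinM lee_fin.
    rewrite -real_normK ?num_real//; set z := `|x|%R.
    have z0 : (0 <= z)%R by rewrite /z.
    have := expR_ge1Dx (z / 4)%R; set w := expR _ => wz.
    rewrite (_ : (z / 2 = z / 4 + z / 4)%R); last by field.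
    rewrite expRD -/w.
    have zw : (z / 4 <= w)%R by lra.
    have : (z / 4 * (z / 4) <= w * w)%R by apply: ler_pM => //; lra.
    lra.
rewrite ge0_integralZl//.
- by rewrite expo_exp -EFinM ltry.
- apply/measurable_EFinP; apply: measurableT_comp => //.
  by apply: measurable_funM => //; exact: normr_measurable.
Qed.

End moments.

Section linear_forms.
Context (R : realType) (mu : probability R R)
  (L : probability (prodspace nat R) R).
Hypotheses (emu : expo_law mu) (iL : iid_law mu L).
Notation S := (prodspace nat R).

(** The absolute values make these forms nonnegative everywhere; almost surely
    they change nothing, the coordinates being positive. *)
Definition lin (c : nat -> R) (n : nat) (x : nat -> R) : R :=
  \sum_(j < n) c j * `|x j|.

Lemma measurable_lin c n : measurable_fun setT (fun x : S => lin c n x).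
Proof.
rewrite /lin; apply: measurable_sum => j; apply: measurable_funM => //.
apply: measurableT_comp => //; exact: (@measurable_coord nat _ R j).
Qed.

Lemma lin_upd c n x i t : (n <= i)%N -> lin c n (upd x i t) = lin c n x.
Proof.
move=> ni; apply: eq_bigr => j _; rewrite /upd ltn_eqF//.
by rewrite (leq_trans (ltn_ord j)).
Qed.

Lemma linS c n x : lin c n.+1 x = lin c n x + c n * `|x n|.
Proof. by rewrite /lin big_ord_recr. Qed.

Lemma linS_upd c n x t : lin c n.+1 (upd x n t) = lin c n x + c n * `|t|.
Proof. by rewrite linS lin_upd// /upd eqxx. Qed.

Section nonneg_coefficients.
Variable c : nat -> R.
Hypothesis c0 : forall j, 0 <= c j.

Lemma lin_ge0 n x : 0 <= lin c n x.
Proof. by apply: sumr_ge0 => j _; rewrite mulr_ge0. Qed.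

Lemma lin_mean n : (\int[L]_x (lin c n x)%:E = (\sum_(j < n) c j)%:E)%E.
Proof.
elim: n => [|n IH].
  rewrite big_ord0; apply: integral0_eq => x _; by rewrite /lin big_ord0.
rewrite (iid_fubini n iL); last 2 first.
- by apply/measurable_EFinP; exact: measurable_lin.
- by move=> x; rewrite lee_fin lin_ge0.
rewrite (eq_integral (fun t : R => (\sum_(j < n) c j)%:E + (c n)%:E * (`|t|)%:E)%E).
  rewrite ge0_integralD//; last 3 first.
  - by move=> x _; rewrite lee_fin sumr_ge0.
  - by move=> x _; rewrite -EFinM lee_fin mulr_ge0.
  - apply: emeasurable_funM => //; apply/measurable_EFinP; exact: normr_measurable.
  rewrite integral_cst//= probability_setT mule1 ge0_integralZl//; last 2 first.
  - by apply/measurable_EFinP; exact: normr_measurable.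
  - by rewrite lee_fin.
  by rewrite expo_abs// mule1 -EFinD big_ord_recr.
move=> t _; under eq_integral do rewrite linS_upd EFinD.
rewrite ge0_integralD//; last 3 first.
- by move=> x _; rewrite lee_fin lin_ge0.
- by apply/measurable_EFinP; exact: measurable_lin.
- by move=> x _; rewrite lee_fin mulr_ge0.
by rewrite IH integral_cst//= probability_setT mule1 EFinM.
Qed.

(** The variance of [mu], whose mean is 1. *)
Definition expo_var : R := fine (\int[mu]_x (x ^+ 2)%:E)%E - 1.

Lemma lin_sqr_mean n : (\int[L]_x ((lin c n x) ^+ 2)%:E =
  ((\sum_(j < n) c j) ^+ 2 + expo_var * \sum_(j < n) c j ^+ 2)%:E)%E.
Proof.
elim: n => [|n IH].
  rewrite !big_ord0 expr0n/= mulr0 addr0; apply: integral0_eq => x _.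
  by rewrite /lin big_ord0 expr0n.
have ml k : measurable_fun setT (fun x : S => lin c k x) by exact: measurable_lin.
rewrite (iid_fubini n iL); last 2 first.
- exact: measurable_sq.
- by move=> x; rewrite lee_fin sqr_ge0.
set A := (_ ^+ 2 + _) in IH; set B := \sum_(j < n) c j.
have B0 : 0 <= B by apply: sumr_ge0.
have A0 : 0 <= A.
  by rewrite -lee_fin -IH; apply: integral_ge0 => x _; rewrite lee_fin sqr_ge0.
have mabs : measurable_fun setT (fun t : R => (`|t|)%:E).
  by apply/measurable_EFinP; exact: normr_measurable.
have mt2 : measurable_fun setT (fun t : R => (t ^+ 2)%:E) by exact: measurable_sq.
have M2 : (\int[mu]_x (x ^+ 2)%:E = (expo_var + 1)%:E)%E.
  rewrite /expo_var subrK fineK// ge0_fin_numE ?expo_sqr//.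
  by apply: integral_ge0 => x _; rewrite lee_fin sqr_ge0.
rewrite (eq_integral (fun t : R => (A%:E + (2 * c n * B)%:E * (`|t|)%:E) +
    ((c n) ^+ 2)%:E * (t ^+ 2)%:E)%E).
  have cB0 : 0 <= 2 * c n * B by rewrite !mulr_ge0.
  rewrite ge0_integralD//; last 4 first.
  - by move=> x _; rewrite -EFinM -EFinD lee_fin addr_ge0// mulr_ge0.
  - by apply: emeasurable_funD => //; exact: emeasurable_funM.
  - by move=> x _; rewrite -EFinM lee_fin mulr_ge0// sqr_ge0.
  - exact: emeasurable_funM.
  rewrite ge0_integralD//; last 2 first.
  - by move=> x _; rewrite -EFinM lee_fin mulr_ge0.
  - exact: emeasurable_funM.
  rewrite integral_cst//= probability_setT mule1 !ge0_integralZl//; last 2 first.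
  - by move=> x _; rewrite lee_fin sqr_ge0.
  - by rewrite lee_fin sqr_ge0.
  rewrite expo_abs// mule1 M2 -EFinM -!EFinD !big_ord_recr/=; congr EFin.
  by rewrite /A -/B; ring.
move=> t _; rewrite (eq_integral (fun x : S => ((lin c n x) ^+ 2)%:E +
   ((2 * c n * `|t|)%:E * (lin c n x)%:E + ((c n) ^+ 2 * t ^+ 2)%:E))%E); last first.
  move=> x _; rewrite linS_upd -EFinM -!EFinD; congr EFin.
  by rewrite -[in RHS](real_normK (num_real t)); ring.
have ct0 : 0 <= 2 * c n * `|t| by rewrite !mulr_ge0.
have c2t : 0 <= c n ^+ 2 * t ^+ 2 by rewrite mulr_ge0 ?sqr_ge0.
have mlE : measurable_fun setT (fun x : S => (lin c n x)%:E).
  exact/measurable_EFinP.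
rewrite ge0_integralD//; last 4 first.
- by move=> x _; rewrite lee_fin sqr_ge0.
- exact: measurable_sq.
- by move=> x _; rewrite -EFinM -EFinD lee_fin addr_ge0// mulr_ge0// lin_ge0.
- by apply: emeasurable_funD => //; exact: emeasurable_funM.
rewrite ge0_integralD//; last 2 first.
- by move=> x _; rewrite -EFinM lee_fin mulr_ge0// lin_ge0.
- exact: emeasurable_funM.
rewrite IH ge0_integralZl//; last first.
  by move=> x _; rewrite lee_fin lin_ge0.
rewrite integral_cst//= probability_setT mule1 lin_mean -/B -!EFinM -!EFinD.
by congr EFin; ring.
Qed.

Lemma lin_sqn n :
  sqn L (fun x : S => lin c n x - \sum_(j < n) c j) =
  (expo_var * \sum_(j < n) c j ^+ 2)%:E.
Proof.
set B := \sum_(j < n) c j; have B0 : 0 <= B by apply: sumr_ge0.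
have ml : measurable_fun setT (fun x : S => lin c n x) by exact: measurable_lin.
have mlE : measurable_fun setT (fun x : S => (lin c n x)%:E).
  exact/measurable_EFinP.
have mlB : measurable_fun setT (fun x : S => ((lin c n x - B) ^+ 2)%:E).
  by apply: measurable_sq; exact: measurable_funB.
have : (sqn L (fun x : S => (lin c n x - B)%R) + (2 * B * B)%:E =
    (B ^+ 2 + expo_var * \sum_(j < n) c j ^+ 2)%:E + (B ^+ 2)%:E)%E.
  rewrite -lin_sqr_mean.
  transitivity (\int[L]_x (((lin c n x - B) ^+ 2)%:E + (2 * B)%:E * (lin c n x)%:E))%E.
    rewrite ge0_integralD//; last 3 first.
    - by move=> x _; rewrite lee_fin sqr_ge0.
    - by move=> x _; rewrite -EFinM lee_fin !mulr_ge0// lin_ge0.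
    - exact: emeasurable_funM.
    rewrite ge0_integralZl//; last 2 first.
    - by move=> x _; rewrite lee_fin lin_ge0.
    - by rewrite lee_fin mulr_ge0.
    by rewrite lin_mean -/B -EFinM.
  transitivity (\int[L]_x ((lin c n x ^+ 2)%:E + (B ^+ 2)%:E))%E.
    by apply: eq_integral => x _; rewrite -EFinM -!EFinD; congr EFin; ring.
  rewrite ge0_integralD//; last 3 first.
  - by move=> x _; rewrite lee_fin sqr_ge0.
  - exact: measurable_sq.
  - by move=> x _; rewrite lee_fin sqr_ge0.
  by rewrite integral_cst//= probability_setT mule1.
set s := sqn _ _; have s0 : (0 <= s)%E by exact: sqn_ge0.
case: s s0 => [s s0 | // | //]; rewrite -!EFinD => -[h].
by congr EFin; move: h; rewrite expr2; lra.
Qed.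

Lemma expo_var_ge0 : 0 <= expo_var.
Proof.
rewrite -lee_fin.
have M2 : (\int[mu]_x (x ^+ 2)%:E = (expo_var + 1)%:E)%E.
  rewrite /expo_var subrK fineK// ge0_fin_numE ?expo_sqr//.
  by apply: integral_ge0 => x _; rewrite lee_fin sqr_ge0.
have h : (\int[mu]_x ((2 * `|x|)%:E) <= \int[mu]_x ((x ^+ 2)%:E + 1%:E))%E.
  apply: ge0_le_integral => //.
  - apply/measurable_EFinP; apply: measurable_funM => //; exact: normr_measurable.
  - by apply: emeasurable_funD => //; exact: measurable_sq.
  - move=> x _; rewrite -EFinD lee_fin -real_normK ?num_real//.
    by have := sqr_ge0 (`|x| - 1); set z := `|x|; lra.
move: h; rewrite ge0_integralD//; last 2 first.
- by move=> x _; rewrite lee_fin sqr_ge0.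
- exact: measurable_sq.
rewrite M2 integral_cst//= probability_setT mule1.
under eq_integral do rewrite EFinM.
rewrite ge0_integralZl//; last first.
  by apply/measurable_EFinP; exact: normr_measurable.
by rewrite expo_abs// mule1 -EFinD !lee_fin; lra.
Qed.

End nonneg_coefficients.

End linear_forms.

(** * Inequalities for powers *)

Section power_inequalities.
Context (R : realType).
Implicit Types (p s m : R).

Lemma powRD_gt0 (x r t : R) : 0 < x -> x `^ (r + t) = x `^ r * x `^ t.
Proof. by move=> x0; rewrite powRD// (gt_eqF x0) implybT. Qed.

(** Concavity: the graph lies below its tangent at [m]. After rescaling to
    [m = 1] it follows from [ln y <= y - 1]. *)
Lemma powR_tangent p s m : 0 < p < 1 -> 0 <= s -> 0 < m ->
  s `^ p <= m `^ p + p * m `^ (p - 1) * (s - m).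
Proof.
move=> /andP[p0 p1] s0 m0.
have key (r : R) : 0 <= r -> r `^ p <= 1 + p * (r - 1).
  rewrite le_eqVlt => /predU1P[<-|r0].
    by rewrite powR0 ?gt_eqF//; lra.
  set A := 1 + p * (r - 1); have A0 : 0 < A.
    have : 0 < p * r by rewrite mulr_gt0.
    rewrite /A; lra.
  have lnle (y : R) : 0 < y -> ln y <= y - 1.
    by move=> y0; have := expR_ge1Dx (ln y); rewrite lnK//; lra.
  rewrite /powR gt_eqF// -[leRHS](lnK A0) ler_expR.
  have h1 := lnle (r / A) (divr_gt0 r0 A0).
  have h2 := lnle A^-1; rewrite invr_gt0 in h2; have {}h2 := h2 A0.
  rewrite ln_div// in h1; rewrite lnV// in h2.
  have e1 : p * (ln r - ln A) <= p * (r / A - 1) by rewrite ler_wpM2l// ltW.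
  have e2 : (1 - p) * (- ln A) <= (1 - p) * (A^-1 - 1).
    by rewrite ler_wpM2l//; lra.
  have e3 : p * (r / A - 1) + (1 - p) * (A^-1 - 1) = 0.
    rewrite (_ : _ + _ = (1 + p * (r - 1)) / A - 1); last by ring.
    by rewrite -/A divff ?gt_eqF// subrr.
  lra.
have r0 : 0 <= s / m by rewrite divr_ge0// ltW.
have mp : 0 < m `^ p by rewrite powR_gt0.
have := key _ r0; rewrite -(ler_pM2l mp) -powRM//; last exact: ltW.
rewrite mulrC divfK ?gt_eqF// => /le_trans; apply.
rewrite powRB ?(gt_eqF m0) ?implybT// powRr1 ?(ltW m0)//.
by rewrite le_eqVlt; apply/orP; left; apply/eqP; field; rewrite gt_eqF.
Qed.

(** For [m <= s] this is the tangent bound. For [s <= m] it holds because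
    [s `^ p >= m `^ (p - 1) * s], the exponent [p - 1] being negative. *)
Lemma powR_diff_sqr p s m : 0 < p < 1 -> 0 <= s -> 0 < m ->
  (s `^ p - m `^ p) ^+ 2 <= (m `^ (p - 1) * (s - m)) ^+ 2.
Proof.
move=> p01; have /andP[p0 p1] := p01; move=> s0 m0.
set M := m `^ (p - 1); have M0 : 0 < M by rewrite powR_gt0.
have [ms|sm] := leP m s.
  have h1 : m `^ p <= s `^ p by apply: ge0_ler_powR => //; rewrite ?nnegrE ltW.
  have h2 := powR_tangent p01 s0 m0; rewrite -/M in h2.
  have h3 : p * M * (s - m) <= M * (s - m).
    by rewrite ler_wpM2r ?subr_ge0// ger_pMl// ltW.
  rewrite lerXn2r// ?nnegrE; first by rewrite subr_ge0.
    by rewrite mulr_ge0 ?subr_ge0// ltW.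
  lra.
rewrite -sqrrN -[leRHS]sqrrN !opprB.
have h1 : s `^ p <= m `^ p by apply: ge0_ler_powR => //; rewrite ?nnegrE// ltW.
have h2 : M * s <= s `^ p.
  move: s0; rewrite le_eqVlt => /predU1P[<-|s0]; first by rewrite mulr0 powR_ge0.
  rewrite -(mulr_powRB1 (ltW s0) p0) mulrC ler_pM2l//.
  have -> : p - 1 = - (1 - p) by ring.
  rewrite /M (_ : p - 1 = - (1 - p)); last by ring.
  rewrite !powRN lef_pV2 ?posrE ?powR_gt0//.
  by apply: ge0_ler_powR; rewrite ?nnegrE ?subr_ge0 ?(ltW p1) ?(ltW sm) ?ltW.
have mM : m `^ p = M * m by rewrite mulrC /M mulr_powRB1// ltW.
have -> : - (M * (s - m)) = M * (m - s) by ring.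
rewrite lerXn2r// ?nnegrE; first by rewrite subr_ge0.
  by rewrite mulr_ge0 ?subr_ge0// ltW.
by rewrite mM; lra.
Qed.

(** Write [(s + m) `^ p] as [(s + m) * (s + m) `^ (p - 1)]; the factor
    [(s + m) `^ (p - 1)] is at most [s `^ (p - 1)] and at most [m `^ (p - 1)]. *)
Lemma powR_subadd p s m : 0 < p < 1 -> 0 <= s -> 0 <= m ->
  (s + m) `^ p <= s `^ p + m `^ p.
Proof.
move=> /andP[p0 p1] s0 m0.
have [->|s1] := eqVneq s 0; first by rewrite add0r lerDr powR_ge0.
have [->|m1] := eqVneq m 0; first by rewrite addr0 lerDl powR_ge0.
have sp : 0 < s by rewrite lt0r s1.
have mp : 0 < m by rewrite lt0r m1.
have smp : 0 < s + m by rewrite addr_gt0.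
have aux (u : R) : 0 < u -> u <= s + m -> u * (s + m) `^ (p - 1) <= u `^ p.
  move=> u0 us; rewrite -[leRHS](mulr_powRB1 (ltW u0) p0) ler_pM2l//.
  rewrite (_ : p - 1 = - (1 - p)); last by ring.
  rewrite !powRN lef_pV2 ?posrE ?powR_gt0//.
  by apply: ge0_ler_powR => //; rewrite ?nnegrE; lra.
rewrite -[leLHS](mulr_powRB1 (ltW smp) p0) mulrDl.
by apply: lerD; apply: aux => //; lra.
Qed.

Lemma powR_sqr_le p s : 2^-1 <= p -> p < 1 -> 0 <= s -> (s `^ p) ^+ 2 <= s + s ^+ 2.
Proof.
move=> p2 p1 s0; have p0 : 0 < p by lra.
rewrite -powR_mulrn ?powR_ge0// -powRrM.
have [s1|s1] := leP s 1.
  apply: (@le_trans _ _ s); last by rewrite lerDl sqr_ge0.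
  move: s0; rewrite le_eqVlt => /predU1P[<-|s0].
    by rewrite powR0// gt_eqF//; lra.
  by apply: ge1r_powR; rewrite ?s0 ?s1//; lra.
apply: (@le_trans _ _ (s ^+ 2)); last by rewrite lerDr.
rewrite -[leRHS]powR_mulrn//; apply: ler_powR; first exact: ltW.
by rewrite ler_piMl// ltW.
Qed.

Definition rpow (s : R) (k : nat) : R := k.+1%:R `^ (- s).

Lemma rpow_gt0 s k : 0 < rpow s k.
Proof. by rewrite powR_gt0. Qed.

(** Comparison with a telescoping sum, the discrete form of the integral of
    [x `^ (- s)]. *)
Lemma rpow_sum_bound s n : 1 < s -> \sum_(k < n) rpow s k <= 1 + (s - 1)^-1.
Proof.
move=> s1; have s10 : 0 < s - 1 by lra.
pose t := s - 1.
have t0 : 0 < t by [].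
suff h k : \sum_(i < k.+1) rpow s i <= 1 + t^-1 * (1 - rpow t k).
  case: n => [|n].
    by rewrite big_ord0 addr_ge0// invr_ge0 ltW.
  apply: le_trans (h n) _; rewrite lerD2l ger_pMr ?invr_gt0//.
  by have := rpow_gt0 t n; lra.
elim: k => [|k IH].
  by rewrite big_ord1 /rpow powR1 subrr mulr0 addr0.
rewrite big_ord_recr/=; apply: le_trans (lerD IH (lexx _)) _.
suff : rpow s k.+1 <= t^-1 * (rpow t k - rpow t k.+1) by lra.
set x : R := k.+2%:R; have x0 : 0 < x by rewrite ltr0n.
have y0 : 0 < (k.+1%:R : R) by rewrite ltr0n.
have yx : k.+1%:R = x - 1 :> R by rewrite /x -[in RHS]natr1 addrK.
rewrite ler_pdivlMl// mulrC.
have -> : rpow s k.+1 = rpow t k.+1 / x.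
  rewrite /rpow -/x (_ : - s = - t - 1); last by rewrite /t; ring.
  by rewrite powRB ?(gt_eqF x0) ?implybT// powRr1// ltW.
have -> : rpow t k = rpow t k.+1 * (k.+1%:R / x) `^ (- t).
  rewrite /rpow -/x -powRM ?divr_ge0 ?(ltW x0) ?(ltW y0)//.
  by rewrite mulrC divfK// gt_eqF.
set z := rpow t k.+1; have z0 : 0 < z by exact: rpow_gt0.
rewrite (_ : z * _ - z = z * ((k.+1%:R / x) `^ (- t) - 1)); last by ring.
rewrite mulrAC -mulrA ler_pM2l//.
set r := _ / x; have r0 : 0 < r by rewrite divr_gt0.
have lnle (y : R) : 0 < y -> ln y <= y - 1.
  by move=> y00; have := expR_ge1Dx (ln y); rewrite lnK//; lra.
rewrite /powR gt_eqF//.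
have := expR_ge1Dx (- t * ln r).
have h1 : t * ln r <= t * (r - 1) by rewrite ler_wpM2l ?lnle// ltW.
have h2 : r - 1 = - x^-1 by rewrite /r yx mulrBl divff ?gt_eqF//; ring.
rewrite h2 mulrN in h1; rewrite mulNr; set E := expR _; move: h1; set w := t / x; lra.
Qed.

Lemma rpow_tail s e : 1 < s -> 0 < e ->
  exists K, forall n, \sum_(K <= k < n) rpow s k <= e.
Proof.
move=> s1 e0.
have cv : cvgn (series (rpow s)).
  apply: nondecreasing_is_cvgn.
    by apply: nondecreasing_series => k _ _; exact: ltW (rpow_gt0 _ _).
  exists (1 + (s - 1)^-1) => _ [n _ <-].
  by rewrite /series/= big_mkord rpow_sum_bound.
have /cauchy_cvgP/cauchy_seriesP/(_ e e0) [[A B] /= [[N1 _ h1] [N2 _ h2]] h] := cv.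
exists (maxn N1 N2) => n.
have [nN|Nn] := leqP n (maxn N1 N2); first by rewrite big_geq// ltW.
have := h (maxn N1 N2, n) _; rewrite /= => hh.
apply: le_trans (ler_norm _) _; apply: ltW; apply: hh; split.
  by apply: h1; rewrite /= leq_maxl.
by apply: h2 => /=; rewrite (leq_trans (leq_maxr N1 N2))// ltnW.
Qed.

End power_inequalities.

(** * Mean-square convergence of the deviations *)

Section coefficients.
Context (R : realType).

Definition inv_sq (j : nat) : R := (j.+1 ^ 2)%:R^-1.

(** The coefficients of [tau k n] as a linear form. They vanish below [k], so
    that sums over [j < n] serve for every [k]. *)
Definition coef (k j : nat) : R := if (k <= j)%N then inv_sq j else 0.

(** The mean of [tau k n] for i.i.d. exponential variables of mean 1. *)
Definition mean_tau (k n : nat) : R := \sum_(j < n) coef k j.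

Lemma inv_sq_gt0 j : 0 < inv_sq j.
Proof. by rewrite invr_gt0 ltr0n expn_gt0. Qed.

Lemma coef_ge0 k j : 0 <= coef k j.
Proof. by rewrite /coef; case: ifP => // _; exact: ltW (inv_sq_gt0 j). Qed.

Lemma mean_tau_ge0 k n : 0 <= mean_tau k n.
Proof. by apply: sumr_ge0 => j _; exact: coef_ge0. Qed.

Lemma mean_tauS k n : mean_tau k n.+1 = mean_tau k n + coef k n.
Proof. by rewrite /mean_tau big_ord_recr. Qed.

Lemma mean_tau0 k n : (n <= k)%N -> mean_tau k n = 0.
Proof.
move=> nk; apply: big1 => j _; rewrite /coef leqNgt.
by rewrite (leq_trans (ltn_ord j) nk).
Qed.

Lemma mean_tau_gt0 k n : (k < n)%N -> 0 < mean_tau k n.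
Proof.
elim: n => // n IH; rewrite ltnS leq_eqVlt mean_tauS => /predU1P[->|/IH h].
  by rewrite ltr_wpDl ?mean_tau_ge0// /coef leqnn inv_sq_gt0.
by rewrite ltr_pwDl ?coef_ge0.
Qed.

Lemma inv_sq_diff j : inv_sq j.+1 <= j.+1%:R^-1 - j.+2%:R^-1.
Proof.
rewrite /inv_sq natrX -[j.+2%:R]natr1; set x : R := j.+1%:R.
have x0 : 0 < x by rewrite ltr0n.
rewrite -subr_ge0 (_ : _ - _ = (x * (x + 1) ^+ 2)^-1); last first.
  by field; rewrite ?gt_eqF// addr_gt0.
by rewrite invr_ge0 mulr_ge0 ?exprn_ge0 ?addr_ge0// ltW.
Qed.

Lemma inv_sq_diff_ge j : j.+1%:R^-1 - j.+2%:R^-1 <= inv_sq j.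
Proof.
rewrite /inv_sq natrX -[j.+2%:R]natr1; set x : R := j.+1%:R.
have x0 : 0 < x by rewrite ltr0n.
rewrite -subr_ge0 (_ : _ - _ = (x ^+ 2 * (x + 1))^-1); last first.
  by field; rewrite ?gt_eqF// addr_gt0.
by rewrite invr_ge0 mulr_ge0 ?exprn_ge0 ?addr_ge0// ltW.
Qed.

Lemma mean_tau_le k n : mean_tau k n <= 2 / k.+1%:R.
Proof.
have k0 : 0 < (k.+1%:R : R) by rewrite ltr0n.
have [nk|kn] := leqP n k; first by rewrite mean_tau0// divr_ge0.
suff : mean_tau k n <= 2 / k.+1%:R - n%:R^-1.
  by move=> /le_trans; apply; rewrite gerBl invr_ge0.
elim: n kn => // n IH; rewrite ltnS leq_eqVlt mean_tauS => /predU1P[<-|kn].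
  rewrite mean_tau0// add0r /coef leqnn /inv_sq natrX (_ : _ - _ = k.+1%:R^-1); last by ring.
  rewrite lef_pV2 ?posrE ?exprn_gt0// ler_eXnr//.
  by rewrite ler1n.
case: n kn IH => // n kn IH; apply: le_trans (lerD (IH kn) (lexx _)) _.
rewrite /coef ltnW//; have := inv_sq_diff n; set a := inv_sq _; set b := _^-1; set c := _^-1; set d := 2 / _. lra.
Qed.

Lemma mean_tau_ge k n : (k <= n)%N -> k.+1%:R^-1 - n.+1%:R^-1 <= mean_tau k n.
Proof.
elim: n => [|n IH]; first by rewrite leqn0 => /eqP ->; rewrite subrr mean_tau_ge0.
rewrite leq_eqVlt => /predU1P[->|]; first by rewrite subrr mean_tau_ge0.
rewrite ltnS => kn; rewrite mean_tauS /coef kn.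
by have := inv_sq_diff_ge n; have := IH kn; set a := mean_tau _ _; set b := inv_sq _;
  set x := _^-1; set y := _^-1; set z := _^-1; lra.
Qed.

Lemma inv_sq_le k j : (k <= j)%N -> inv_sq j <= inv_sq k.
Proof.
move=> kj; rewrite /inv_sq lef_pV2 ?posrE ?ltr0n ?expn_gt0//.
by rewrite ler_nat leq_exp2r// ltnS.
Qed.

Lemma coef_sqr_sum k n : \sum_(j < n) coef k j ^+ 2 <= inv_sq k * mean_tau k n.
Proof.
rewrite /mean_tau mulr_sumr; apply: ler_sum => j _; rewrite /coef; case: ifPn => kj.
  by rewrite expr2 ler_wpM2r ?inv_sq_le// ltW// inv_sq_gt0.
by rewrite expr0n/= mulr0.
Qed.

Lemma lin_coef0 k n x : (n <= k)%N -> lin (coef k) n x = 0.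
Proof.
move=> nk; apply: big1 => j _; rewrite /coef leqNgt.
by rewrite (leq_trans (ltn_ord j) nk) mul0r.
Qed.

Lemma lin_coef_split k n n' x : (k <= n)%N -> (n <= n')%N ->
  lin (coef k) n' x = lin (coef k) n x + lin (coef n) n' x.
Proof.
move=> kn; elim: n' => [|n' IH].
  by rewrite leqn0 => /eqP ->; rewrite (lin_coef0 x (leqnn 0)) addr0.
rewrite leq_eqVlt => /predU1P[<-|]; first by rewrite (lin_coef0 x (leqnn n)) addr0.
rewrite ltnS => nn'; rewrite !linS IH// addrA /coef nn'.
by rewrite (leq_trans kn nn').
Qed.

Lemma mean_tau_split k n n' : (k <= n)%N -> (n <= n')%N ->
  mean_tau k n' = mean_tau k n + mean_tau n n'.
Proof.
have e a b : mean_tau a b = lin (coef a) b (fun=> 1).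
  by apply: eq_bigr => j _; rewrite normr1 mulr1.
by move=> kn nn'; rewrite !e; exact: lin_coef_split.
Qed.

End coefficients.

Section deviations.
Context (R : realType) (mu : probability R R)
  (L : probability (prodspace nat R) R).
Hypotheses (emu : expo_law mu) (iL : iid_law mu L).
Variable p : R.
Hypotheses (p2 : 2^-1 < p) (p1 : p < 1).
Notation S := (prodspace nat R).

Let p0 : 0 < p. Proof. by apply: lt_trans p2; rewrite invr_gt0. Qed.
Let p01 : 0 < p < 1. Proof. by rewrite p0 p1. Qed.

Definition dev (k n : nat) (x : nat -> R) : R :=
  lin (coef R k) n x `^ p - mean_tau R k n `^ p.

(** The number [K] of terms and the length [n] of the sequence vary
    independently: [K = n] is the total cost, while [n = 2 * K] keeps the
    means [mean_tau k n], for [k < K], of order [k.+1%:R^-1], which the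
    exponential moment requires. *)
Definition sum_dev (K n : nat) (x : nat -> R) : R := \sum_(k < K) dev k n x.

Lemma measurable_dev k n : measurable_fun setT (fun x : S => dev k n x).
Proof.
apply: measurable_funB; last exact: measurable_cst.
apply: (measurableT_comp (measurable_powR p)); exact: measurable_lin.
Qed.

Lemma measurable_sum_dev K n : measurable_fun setT (fun x : S => sum_dev K n x).
Proof. by apply: measurable_sum => k; exact: measurable_dev. Qed.

Lemma dev0 k n x : (n <= k)%N -> dev k n x = 0.
Proof. by move=> nk; rewrite /dev lin_coef0// mean_tau0// subrr. Qed.

Notation kappa := (expo_var mu).
Let kappa0 : 0 <= kappa := expo_var_ge0 emu.
Notation sg := (p + 2^-1).

(** Linearise at the mean [m], at most [2 / (k + 1)]: the variance of
    [tau k n] is at most [kappa * m / (k + 1) ^ 2] and the squared slope is at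
    most [m `^ (2 * p - 2)]. *)
Lemma sqn_dev k n :
  (sqn L (fun x : S => dev k n x) <= (2 * kappa * rpow sg k ^+ 2)%:E)%E.
Proof.
have r0 := rpow_gt0 sg k.
have [nk|kn] := leqP n k.
  rewrite (_ : (fun x : S => dev k n x) = cst 0); last first.
    by apply/funext => x; rewrite dev0.
  rewrite sqn_cst expr0n lee_fin; apply: mulr_ge0; last exact: sqr_ge0.
  exact: mulr_ge0.
have m0 := mean_tau_gt0 R kn; set m := mean_tau R k n in m0 *.
have ml : measurable_fun setT (fun x : S => lin (coef R k) n x - m).
  by apply: measurable_funB => //; exact: measurable_lin.
apply: (@le_trans _ _ (sqn L (fun x : S => m `^ (p - 1) * (lin (coef R k) n x - m))%R)).
  apply: sqn_le.
  - exact: measurable_dev.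
  - exact: measurable_funM.
  - move=> x; apply: powR_diff_sqr => //.
    by apply: lin_ge0 => j; exact: coef_ge0.
rewrite sqnZ// (lin_sqn emu iL (coef_ge0 R k)) -EFinM lee_fin.
have k0 : 0 < (k.+1%:R : R) by rewrite ltr0n.
apply: (@le_trans _ _ ((m `^ (p - 1)) ^+ 2 * (kappa * (inv_sq R k * m)))).
  by rewrite ler_wpM2l ?sqr_ge0// ler_wpM2l// coef_sqr_sum.
rewrite (_ : _ * _ = kappa * ((m `^ (p - 1)) ^+ 2 * m * inv_sq R k)); last by ring.
rewrite (_ : 2 * _ * _ = kappa * (2 * rpow sg k ^+ 2)); last by ring.
apply: (ler_wpM2l kappa0).
have e1 : (m `^ (p - 1)) ^+ 2 * m = m `^ (2 * p - 1).
  rewrite -powR_mulrn ?powR_ge0// -powRrM -[X in _ * X = _](powRr1 (ltW m0)).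
  by rewrite -(powRD_gt0 _ _ m0); congr powR; ring.
have e2 : rpow sg k ^+ 2 = (k.+1%:R^-1) `^ (2 * p - 1) * inv_sq R k.
  rewrite -powR_mulrn ?powR_ge0// /rpow -powRrM /inv_sq natrX.
  rewrite -[k.+1%:R^-1]powR_inv1 ?(ltW k0)// -powRrM -[_ ^- 2]powR_invn ?(ltW k0)//.
  by rewrite -(powRD_gt0 _ _ k0); congr powR; field.
rewrite e1 e2 mulrA ler_wpM2r ?(ltW (inv_sq_gt0 _ _))//.
have -> : 2 * k.+1%:R^-1 `^ (2 * p - 1) = 2 `^ 1 * k.+1%:R^-1 `^ (2 * p - 1) :> R.
  by rewrite powRr1.
apply: (@le_trans _ _ ((2 / k.+1%:R) `^ (2 * p - 1))).
  apply: ge0_ler_powR; rewrite ?nnegrE; [have := p2; lra|exact: ltW| |exact: mean_tau_le].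
  by rewrite divr_ge0.
rewrite powRM ?invr_ge0// ler_wpM2r ?powR_ge0//.
by apply: ler_powR; [rewrite ler1n|have := p1; lra].
Qed.

(** By subadditivity of the power, lengthening the sequence from [n] to [n']
    changes both powers by at most the [p]-th power of a remainder of mean at
    most [2 / (n + 1)]. *)
Lemma sqn_dev_diff k n n' : (k <= n)%N -> (n <= n')%N ->
  (sqn L (fun x : S => dev k n' x - dev k n x)%R <=
   (4 * (6 + kappa) / n.+1%:R)%:E)%E.
Proof.
move=> kn nn'.
pose D (x : nat -> R) := lin (coef R n) n' x; set del := mean_tau R n n'.
have D0 x : 0 <= D x by apply: lin_ge0 => j; exact: coef_ge0.
have del0 : 0 <= del by exact: mean_tau_ge0.
have mD : measurable_fun setT (fun x : S => D x) by exact: measurable_lin.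
have bnd x : (dev k n' x - dev k n x) ^+ 2 <=
    2 * (D x + D x ^+ 2) + 2 * (del + del ^+ 2).
  rewrite /dev (lin_coef_split x kn nn') (mean_tau_split R kn nn') -/(D x) -/del.
  set s := lin _ n x; set m := mean_tau R k n.
  have s0 : 0 <= s by apply: lin_ge0 => j; exact: coef_ge0.
  have m0 : 0 <= m by exact: mean_tau_ge0.
  have h1 : 0 <= (s + D x) `^ p - s `^ p <= D x `^ p.
    have := powR_subadd p01 s0 (D0 x).
    have : s `^ p <= (s + D x) `^ p.
      by apply: ge0_ler_powR; rewrite ?nnegrE ?addr_ge0 ?lerDl// ltW.
    by move=> *; apply/andP; split; lra.
  have h2 : 0 <= (m + del) `^ p - m `^ p <= del `^ p.
    have := powR_subadd p01 m0 del0.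
    have : m `^ p <= (m + del) `^ p.
      by apply: ge0_ler_powR; rewrite ?nnegrE ?addr_ge0 ?lerDl// ltW.
    by move=> *; apply/andP; split; lra.
  have h3 := powR_sqr_le (ltW p2) p1 (D0 x).
  have h4 := powR_sqr_le (ltW p2) p1 del0.
  move: h1 h2 h3 h4; set u := (s + D x) `^ p - s `^ p.
  set v := (m + del) `^ p - m `^ p; set U := D x `^ p; set V := del `^ p.
  move=> /andP[u0 uU] /andP[v0 vV] h3 h4.
  rewrite (_ : _ - _ - _ = u - v); last by rewrite /u /v; ring.
  have hu : u ^+ 2 <= U ^+ 2 by rewrite lerXn2r// nnegrE// (le_trans u0).
  have hv : v ^+ 2 <= V ^+ 2 by rewrite lerXn2r// nnegrE// (le_trans v0).
  have uv := sqr_ge0 (u + v).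
  have -> : (u - v) ^+ 2 = 2 * (u ^+ 2 + v ^+ 2) - (u + v) ^+ 2 by ring.
  move: uv hu hv h3 h4; set a := (u + v) ^+ 2; set b := u ^+ 2.
  set c := v ^+ 2; set U2 := U ^+ 2; set V2 := V ^+ 2.
  set D2 := D x ^+ 2; set d2 := del ^+ 2; set D1 := D x; lra.
apply: (@le_trans _ _ (\int[L]_x ((2 * (D x + D x ^+ 2))%:E +
    (2 * (del + del ^+ 2))%:E))%E).
  apply: ge0_le_integral => //.
  - by move=> x _; rewrite lee_fin sqr_ge0.
  - by apply: measurable_sq; apply: measurable_funB; exact: measurable_dev.
  - apply: emeasurable_funD => //; apply/measurable_EFinP.
    apply: measurable_funM => //; apply: measurable_funD => //.
    exact: measurable_funX.
  - by move=> x _; rewrite -EFinD lee_fin.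
have mDE : measurable_fun setT (fun x : S => (D x)%:E) by exact/measurable_EFinP.
have mD2 : measurable_fun setT (fun x : S => (D x ^+ 2)%:E) by exact: measurable_sq.
have DE : (\int[L]_x (D x)%:E = del%:E)%E by exact: (lin_mean emu iL (coef_ge0 R n)).
have D2E : (\int[L]_x (D x ^+ 2)%:E =
    (del ^+ 2 + kappa * \sum_(j < n') coef R n j ^+ 2)%:E)%E.
  exact: (lin_sqr_mean emu iL (coef_ge0 R n)).
have mDD : measurable_fun setT (fun x : S => (D x + D x ^+ 2)%:E).
  apply/measurable_EFinP; apply: measurable_funD => //.
  exact: measurable_funX.
have DD0 x : (0 <= (D x + D x ^+ 2)%:E)%E by rewrite lee_fin addr_ge0// sqr_ge0.
have I1 : (\int[L]_x (2 * (D x + D x ^+ 2))%:E =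
    (2 * (del + (del ^+ 2 + kappa * \sum_(j < n') coef R n j ^+ 2)))%:E)%E.
  transitivity (\int[L]_x (2%:E * (D x + D x ^+ 2)%:E))%E.
    by apply: eq_integral => x _; rewrite EFinM.
  rewrite ge0_integralZl// EFinM; congr (_ * _)%E; rewrite EFinD -DE -D2E.
  rewrite -ge0_integralD//; last 2 first.
  - by move=> x _; rewrite lee_fin.
  - by move=> x _; rewrite lee_fin sqr_ge0.
rewrite ge0_integralD//; last 3 first.
- by move=> x _; rewrite EFinM mule_ge0.
- by apply/measurable_EFinP; apply: measurable_funM => //; exact/measurable_EFinP.
- by move=> x _; rewrite lee_fin mulr_ge0// addr_ge0// sqr_ge0.
rewrite I1 integral_cst//= probability_setT mule1 -EFinD lee_fin.
have hs := coef_sqr_sum R n n'; rewrite -/del in hs.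
have q1 : inv_sq R n <= 1.
  by rewrite /inv_sq invf_le1 ?ltr0n ?expn_gt0// ler1n expn_gt0.
have hs' : \sum_(j < n') coef R n j ^+ 2 <= del.
  by apply: le_trans hs _; rewrite ler_piMl.
have hk : kappa * \sum_(j < n') coef R n j ^+ 2 <= kappa * del by rewrite ler_wpM2l.
have dn := mean_tau_le R n n'; rewrite -/del in dn.
have nn0 : 0 < (n.+1%:R : R) by rewrite ltr0n.
have n1 : 2 / n.+1%:R <= 2 :> R.
  by rewrite ler_pdivrMr// ler_peMr// ler1n.
have d2 : del ^+ 2 <= 2 * del by rewrite expr2 ler_wpM2r// (le_trans dn).
apply: (@le_trans _ _ (2 * (6 + kappa) * del)).
  have k0 : 0 <= kappa * del by rewrite mulr_ge0.
  rewrite (_ : 2 * (6 + kappa) * del = 12 * del + 2 * (kappa * del)); last by ring.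
  lra.
have -> : 4 * (6 + kappa) / n.+1%:R = 2 * (6 + kappa) * (2 / n.+1%:R) by ring.
by rewrite ler_wpM2l// mulr_ge0// addr_ge0.
Qed.

(** Finitely many initial terms converge by [sqn_dev_diff]; the others are
    uniformly small by [sqn_dev]. The weights [rpow sg] are summable since
    [1 < sg], and combine both in the weighted Cauchy-Schwarz inequality. *)
Lemma sum_dev_cauchy e : 0 < e -> exists N, forall K n K' n',
  (N <= K)%N -> (K <= n)%N -> (N <= K')%N -> (K' <= n')%N ->
  (sqn L (fun x : S => sum_dev K n x - sum_dev K' n' x)%R <= e%:E)%E.
Proof.
move=> e0; have sg1 : 1 < sg by have := p2; lra.
pose z := rpow sg; have z0 k : 0 < z k := rpow_gt0 sg k.
pose W := 1 + (sg - 1)^-1.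
have W0 : 0 < W by rewrite addr_gt0// invr_gt0; lra.
(* the terms beyond [M] contribute at most [8 * (kappa + 1) * W * e1 = e / 2] *)
pose e1 := e / 2 / W / (8 * (kappa + 1)).
have e10 : 0 < e1 by rewrite !divr_gt0// mulr_gt0// ltr_wpDl.
have [M hM] := rpow_tail sg1 e10.
pose Q := \sum_(0 <= k < M) (z k)^-1.
have Q0 : 0 <= Q by apply: sumr_ge0 => k _; rewrite invr_ge0 ltW.
pose C := 8 * (6 + kappa).
have C0 : 0 < C by rewrite mulr_gt0// ltr_pwDl.
(* for [n >= N0] the first [M] terms contribute at most
   [W * C * Q / N0 <= e / 2] *)
have [N0 hN0] : exists N0 : nat, 2 * W * C * Q / e <= N0%:R.
  exists (Num.bound (2 * W * C * Q / e)); apply: ltW; apply: archi_boundP.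
  by rewrite divr_ge0 ?(ltW e0)// !mulr_ge0 ?(ltW W0)// addr_ge0.
exists (maxn M N0) => K n K' n' NK Kn NK' Kn'.
pose b k (x : nat -> R) := (if (k < K)%N then dev k n x else 0) -
  (if (k < K')%N then dev k n' x else 0).
have mif k j (B : bool) :
    measurable_fun setT (fun x : S => if B then dev k j x else 0).
  by case: B; [exact: measurable_dev|exact: measurable_cst].
have mb k : measurable_fun setT (fun x : S => b k x).
  exact: measurable_funB.
pose Km := maxn K K'.
have DE x : sum_dev K n x - sum_dev K' n' x = \sum_(k <- index_iota 0 Km) b k x.
  have aux (H : nat) (g : nat -> R) : (H <= Km)%N ->
      \sum_(k < H) g k = \sum_(0 <= k < Km) (if (k < H)%N then g k else 0).
    move=> HK; rewrite (@big_cat_nat _ _ _ H)//= [X in _ = _ + X]big_nat_cond.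
    rewrite [X in _ = _ + X]big1 ?addr0; last first.
      by move=> k /andP[/andP[Hk _] _]; rewrite ltnNge Hk.
    by rewrite big_mkord; apply: eq_bigr => k _; rewrite ltn_ord.
  rewrite sumrB /sum_dev (aux K (fun k => dev k n x)) ?leq_maxl//.
  by rewrite (aux K' (fun k => dev k n' x)) ?leq_maxr.
pose beta k := if (k < M)%N then C / N0.+1%:R else 8 * (kappa + 1) * z k ^+ 2.
have hb k : k \in index_iota 0 Km -> (sqn L (fun x : S => b k x) <= (beta k)%:E)%E.
  move=> _; rewrite /beta; case: ifPn => kM.
    have kK : (k < K)%N.
      by apply: leq_trans kM _; apply: leq_trans NK; rewrite leq_maxl.
    have kK' : (k < K')%N.
      by apply: leq_trans kM _; apply: leq_trans NK'; rewrite leq_maxl.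
    have kn := ltnW (leq_trans kK Kn); have kn' := ltnW (leq_trans kK' Kn').
    have Nn : (N0 <= n)%N by rewrite (leq_trans _ Kn)// (leq_trans _ NK)// leq_maxr.
    have Nn' : (N0 <= n')%N.
      by rewrite (leq_trans _ Kn')// (leq_trans _ NK')// leq_maxr.
    have fin (j : nat) : (N0 <= j)%N ->
        ((4 * (6 + kappa) / j.+1%:R)%:E <= (C / N0.+1%:R)%:E)%E.
      move=> Nj; rewrite lee_fin ler_pM//.
      - by rewrite mulr_ge0// addr_ge0.
      - have := kappa0; rewrite /C; lra.
      - by rewrite lef_pV2 ?posrE// ler_nat.
    rewrite (_ : (fun x : S => b k x) = (fun x : S => dev k n x - dev k n' x)); last first.
      by apply/funext => x; rewrite /b kK kK'.
    have [nn'|nn'] := leqP n n'.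
      by rewrite sqnC; apply: le_trans (sqn_dev_diff kn nn') _; exact: fin.
    by apply: le_trans (sqn_dev_diff kn' (ltnW nn')) _; exact: fin.
  have hd j (B : bool) :
      (sqn L (fun x : S => if B then dev k j x else 0)%R <= (2 * kappa * z k ^+ 2)%:E)%E.
    case: B; first exact: sqn_dev.
    rewrite (sqn_cst L 0) expr0n lee_fin; apply: mulr_ge0; last exact: sqr_ge0.
    exact: mulr_ge0.
  apply: (@le_trans _ _ (2 * (2 * kappa * z k ^+ 2 + 2 * kappa * z k ^+ 2))%:E).
    apply: sqnD2 => //.
    - exact: measurable_funN.
    - rewrite (_ : sqn L _ = sqn L (fun x : S => if (k < K')%N then dev k n' x else 0)%R)//.
      by apply: eq_integral => x _; rewrite sqrrN.
  rewrite lee_fin (_ : 2 * _ = 8 * kappa * z k ^+ 2); last by ring.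
  by rewrite ler_wpM2r ?sqr_ge0// ler_wpM2l// lerDl.
rewrite (_ : (fun x => _) = fun x : S => \sum_(k <- index_iota 0 Km) b k x); last first.
  by apply/funext => x; rewrite DE.
apply: le_trans (sqn_sum mb z0 hb) _; rewrite lee_fin.
have zsum : \sum_(0 <= k < Km) z k <= W by rewrite big_mkord; exact: rpow_sum_bound.
have bsum0 : 0 <= \sum_(0 <= k < Km) beta k / z k.
  apply: sumr_ge0 => k _; rewrite divr_ge0 ?(ltW (z0 k))// /beta; case: ifP => _.
    by rewrite divr_ge0// ltW.
  by rewrite mulr_ge0 ?sqr_ge0// mulr_ge0// addr_ge0.
have MK : (M <= Km)%N.
  by rewrite (leq_trans _ (leq_maxl _ _))// (leq_trans _ NK)// leq_maxl.
have s1 : \sum_(0 <= k < M) beta k / z k = C / N0.+1%:R * Q.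
  rewrite mulr_sumr big_nat [RHS]big_nat; apply: eq_bigr => k /andP[_ kM].
  by rewrite /beta kM.
have s2 : \sum_(M <= k < Km) beta k / z k <= 8 * (kappa + 1) * e1.
  rewrite (_ : \sum_(M <= k < Km) beta k / z k =
      8 * (kappa + 1) * \sum_(M <= k < Km) z k); last first.
    rewrite mulr_sumr big_nat [RHS]big_nat; apply: eq_bigr => k /andP[Mk _].
    by rewrite /beta ltnNge Mk/= expr2 !mulrA mulfK// gt_eqF.
  by rewrite ler_wpM2l// mulr_ge0// addr_ge0.
apply: (@le_trans _ _ (W * \sum_(0 <= k < Km) beta k / z k)).
  by rewrite ler_wpM2r.
rewrite (@big_cat_nat _ _ _ M)//= s1 mulrDr.
have t1 : W * (C / N0.+1%:R * Q) <= e / 2.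
  have N00 : 0 < (N0.+1%:R : R) by rewrite ltr0n.
  have hN1 : 2 * W * C * Q / e <= N0.+1%:R.
    by apply: le_trans hN0 _; rewrite ler_nat.
  rewrite ler_pdivrMr// in hN1.
  rewrite (_ : W * _ = W * C * Q / N0.+1%:R); last by ring.
  rewrite ler_pdivrMr//; set N1 : R := N0.+1%:R in hN1 *.
  move: hN1; set X := W * C * Q.
  rewrite (_ : 2 * W * C * Q = 2 * X); last by rewrite /X; ring.
  rewrite (_ : e / 2 * N1 = N1 * e / 2); last by ring.
  lra.
have t2 : W * \sum_(M <= k < Km) beta k / z k <= e / 2.
  apply: (@le_trans _ _ (W * (8 * (kappa + 1) * e1))); first by rewrite ler_wpM2l// ltW.
  rewrite le_eqVlt; apply/orP; left; apply/eqP; rewrite /e1; field.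
  by rewrite !gt_eqF// ltr_wpDl.
by rewrite [leRHS](splitr e) lerD.
Qed.

End deviations.

(** * Moment generating functions near the origin *)

Section subgaussian.
Context d (T : measurableType d) (R : realType) (P : probability T R).

Lemma expR_le_quad (y : R) : expR y <= 1 + y + y ^+ 2 * (if 0 <= y then expR y else 1).
Proof.
case: ifPn => [y0|]; last first.
  rewrite -ltNge => y0; have h := expR_ge1Dx (- y).
  have e0 := expR_gt0 y; rewrite mulr1.
  have : expR y * (1 - y) <= 1.
    apply: (@le_trans _ _ (expR y * expR (- y))); first by rewrite ler_wpM2l// ltW.
    by rewrite -expRD subrr expR0.
  have y1 : 0 < 1 - y by lra.
  rewrite -ler_pdivlMr// => /le_trans; apply.
  rewrite ler_pdivrMr// (_ : (1 + y + y ^+ 2) * (1 - y) = 1 - y ^+ 3); last by ring.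
  by rewrite lerBrDl gerDr exprS nmulr_rle0// sqr_ge0.
have h := expR_ge1Dx (- y).
have e0 := expR_gt0 y.
have h1 : expR y <= 1 + y * expR y.
  have : expR y * (1 - y) <= 1.
    apply: (@le_trans _ _ (expR y * expR (- y))); first by rewrite ler_wpM2l// ltW.
    by rewrite -expRD subrr expR0.
  lra.
have h2 : y * expR y <= y * (1 + y * expR y) by exact: ler_wpM2l.
rewrite (_ : y * (1 + y * expR y) = y + y ^+ 2 * expR y) in h2; last by ring.
by apply: le_trans h1 _; rewrite -addrA lerD2l.
Qed.

Lemma sqr_le_expR (z : R) : 0 <= z -> z ^+ 2 <= 4 * expR z.
Proof.
move=> z0; have := expR_ge1Dx (z / 2); set w := expR _ => wz.
have -> : expR z = w * w by rewrite -expRD -splitr.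
have -> : z ^+ 2 = 4 * (z / 2 * (z / 2)) by field.
by rewrite ler_wpM2l//; apply: ler_pM; lra.
Qed.

(** Expand the exponential to second order: the linear term integrates to 0,
    and for [t <= t0 / 2] the quadratic remainder is [t ^+ 2] times a function
    dominated by a fixed integrable one. *)
Lemma mgf_subgaussian (X : T -> R) (t0 : R) : measurable_fun setT X -> 0 < t0 ->
  (\int[P]_x (expR (t0 * X x))%:E < +oo)%E -> (sqn P X < +oo)%E -> mean P X = 0 ->
  exists2 C, 0 <= C & forall t, 0 <= t -> t <= t0 / 2 ->
    (\int[P]_x (expR (t * X x))%:E <= (expR (C * t ^+ 2))%:E)%E.
Proof.
move=> mX t00 eX sX EX.
have mexpR s : measurable_fun setT (fun x => expR (s * X x)).
  by apply: measurableT_comp => //; exact: measurable_funM.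
have mexp s : measurable_fun setT (fun x => (expR (s * X x))%:E).
  exact/measurable_EFinP.
have lX : X \in Lfun P 1 by exact: sqn_Lfun1.
have EXE : (\int[P]_x (X x)%:E = 0)%E.
  have : ('E_P[X] = 0)%E.
    by rewrite -(fineK (expectation_fin_num lX)); congr EFin.
  by rewrite unlock.
have iX : P.-integrable setT (EFin \o X) by exact/Lfun1_integrable.
(* [W] dominates the remainder: for [0 <= X x] the factor
   [X x ^+ 2 * expR (t * X x)] is at most [c * expR (t0 * X x)], as
   [z ^+ 2 <= 4 * expR z] for [z = t0 * X x / 2] *)
pose c : R := 16 / t0 ^+ 2.
have c0 : 0 <= c by rewrite divr_ge0// exprn_ge0// ltW.
pose W x := X x ^+ 2 + c * expR (t0 * X x).
have W0 x : 0 <= W x by rewrite addr_ge0 ?sqr_ge0// mulr_ge0// expR_ge0.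
have mW : measurable_fun setT W.
  apply: measurable_funD; first exact: measurable_funX.
  exact: measurable_funM.
have Wint : (\int[P]_x (W x)%:E < +oo)%E.
  rewrite (eq_integral (fun x => (X x ^+ 2)%:E + (c * expR (t0 * X x))%:E)%E); last first.
    by move=> x _; rewrite /W EFinD.
  rewrite ge0_integralD//; last 4 first.
  - by move=> x _; rewrite lee_fin sqr_ge0.
  - exact: measurable_sq.
  - by move=> x _; rewrite lee_fin mulr_ge0// expR_ge0.
  - apply/measurable_EFinP; exact: measurable_funM.
  apply: lte_add_pinfty => //.
  under eq_integral do rewrite EFinM.
  by rewrite ge0_integralZl//; apply: lte_mul_pinfty.
have iW : P.-integrable setT (EFin \o W).
  apply/integrableP; split; first exact/measurable_EFinP.
  by under eq_integral do rewrite /= ger0_norm//.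
pose C := fine (\int[P]_x (W x)%:E)%E.
have CE : (\int[P]_x (W x)%:E = C%:E)%E.
  by rewrite fineK// ge0_fin_numE//; apply: integral_ge0 => x _; rewrite lee_fin.
have C0 : 0 <= C by apply: fine_ge0; apply: integral_ge0 => x _; rewrite lee_fin.
exists C => // t tge0 tt0.
have bnd x : expR (t * X x) <= 1 + t * X x + t ^+ 2 * W x.
  apply: le_trans (expR_le_quad _) _; rewrite lerD2l exprMn -mulrA.
  rewrite ler_wpM2l ?sqr_ge0// /W.
  have [X0|X0] := leP 0 (X x); last first.
    apply: (@le_trans _ _ (X x ^+ 2)); last by rewrite lerDl mulr_ge0// expR_ge0.
    rewrite ler_piMr ?sqr_ge0//; case: ifP => // _.
    by rewrite -expR0 ler_expR mulr_ge0_le0// ltW.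
  apply: (@le_trans _ _ (c * expR (t0 * X x))); last by rewrite lerDr sqr_ge0.
  rewrite mulr_ge0//.
  pose z := t0 * X x / 2.
  have z0 : 0 <= z by rewrite divr_ge0// mulr_ge0// ltW.
  have h1 := sqr_le_expR z0.
  have h2 : expR (t * X x) <= expR z.
    by rewrite ler_expR /z mulrAC ler_wpM2r.
  have XE : X x ^+ 2 = 4 / t0 ^+ 2 * z ^+ 2 by rewrite /z; field; rewrite gt_eqF.
  have EE : expR (t0 * X x) = expR z * expR z.
    by rewrite -expRD; congr expR; rewrite /z; field.
  rewrite XE EE mulrA; apply: ler_pM => //.
  - by rewrite mulr_ge0 ?sqr_ge0// divr_ge0// sqr_ge0.
  rewrite (_ : c * expR z = 4 / t0 ^+ 2 * (4 * expR z)); last by rewrite /c; ring.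
  by rewrite ler_wpM2l// divr_ge0// sqr_ge0.
apply: (@le_trans _ _ (\int[P]_x (1 + t * X x + t ^+ 2 * W x)%:E)%E).
  apply: ge0_le_integral => //.
  - apply/measurable_EFinP; apply: measurable_funD; last exact: measurable_funM.
    by apply: measurable_funD => //; exact: measurable_funM.
  - by move=> x _; rewrite lee_fin bnd.
have itX : P.-integrable setT (fun x => (t * X x)%:E).
  under eq_fun do rewrite EFinM.
  exact: integrableZl.
have itW : P.-integrable setT (fun x => (t ^+ 2 * W x)%:E).
  under eq_fun do rewrite EFinM.
  exact: integrableZl.
have i1 : P.-integrable setT (fun x => (1 + t * X x)%:E).
  under eq_fun do rewrite EFinD.
  apply: integrableD => //; exact: finite_measure_integrable_cst.
rewrite (eq_integral (fun x => (1 + t * X x)%:E + (t ^+ 2 * W x)%:E)%E); last first.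
  by move=> x _; rewrite EFinD.
rewrite integralD//.
rewrite [X in (X + _)%E](_ : _ = 1%E); last first.
  rewrite (eq_integral (fun x => 1%:E + (t * X x)%:E)%E); last first.
    by move=> x _; rewrite EFinD.
  rewrite integralD//; last exact: finite_measure_integrable_cst.
  rewrite integral_cst//= probability_setT mule1.
  under eq_integral do rewrite EFinM.
  by rewrite integralZl// EXE mule0 adde0.
under eq_integral do rewrite EFinM.
rewrite integralZl// CE -EFinM -EFinD lee_fin mulrC.
exact: expR_ge1Dx.
Qed.

End subgaussian.

(** * The limit and its upper tail from below *)

Section limit.
Context (R : realType) (mu : probability R R)
  (L : probability (prodspace nat R) R).
Hypotheses (emu : expo_law mu) (iL : iid_law mu L).
Variable p : R.
Hypotheses (p2 : 2^-1 < p) (p1 : p < 1).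
Notation S := (prodspace nat R).
Notation kappa := (expo_var mu).
Notation sg := (p + 2^-1).

Let p0 : 0 < p. Proof. by apply: lt_trans p2; rewrite invr_gt0. Qed.
Let p01 : 0 < p < 1. Proof. by rewrite p0 p1. Qed.
Let sg1 : 1 < sg. Proof. by have := p2; lra. Qed.
Let kappa0 : 0 <= kappa := expo_var_ge0 emu.

Definition dev_bound : R := 2 * kappa * (1 + (sg - 1)^-1) ^+ 2.

Lemma sqn_dev_sum (a b n : nat) :
  (sqn L (fun x : S => \sum_(a <= k < b) dev p k n x)%R <= dev_bound%:E)%E.
Proof.
have z0 := rpow_gt0 sg.
have hb k : k \in index_iota a b ->
  (sqn L (fun x : S => dev p k n x) <= (2 * kappa * rpow sg k ^+ 2)%:E)%E.
  by move=> _; exact: sqn_dev.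
apply: le_trans (sqn_sum (fun k => measurable_dev p k n) z0 hb) _.
rewrite lee_fin.
have W0 : \sum_(a <= k < b) rpow sg k <= 1 + (sg - 1)^-1.
  apply: le_trans (rpow_sum_bound b sg1).
  have [ab|ba] := leqP a b; last first.
    by rewrite big_geq 1?ltnW// sumr_ge0// => k _; exact: ltW.
  rewrite -(big_mkord xpredT (rpow sg)) (@big_cat_nat _ _ _ a 0 b)//= lerDr.
  by apply: sumr_ge0 => k _; exact: ltW.
have -> : \sum_(a <= k < b) (2 * kappa * rpow sg k ^+ 2 / rpow sg k) =
   2 * kappa * \sum_(a <= k < b) rpow sg k.
  rewrite mulr_sumr; apply: eq_bigr => k _.
  by rewrite expr2 !mulrA mulfK// gt_eqF.
rewrite mulrCA /dev_bound expr2.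
have s0 : 0 <= \sum_(a <= k < b) rpow sg k by apply: sumr_ge0 => k _; exact: ltW.
by rewrite ler_wpM2l ?mulr_ge0// ler_pM.
Qed.

Lemma sqn_sum_dev_lty K n : (sqn L (fun x : S => sum_dev p K n x) < +oo)%E.
Proof.
apply: (@le_lt_trans _ _ dev_bound%:E); last exact: ltry.
apply: le_trans (sqn_dev_sum 0 K n); rewrite le_eqVlt; apply/orP; left; apply/eqP.
by apply: eq_integral => x _; rewrite /sum_dev big_mkord.
Qed.

Lemma exists_limit : exists g : S -> R, [/\ measurable_fun setT g,
  sqn_cvg L (fun n => sum_dev p n n) g & sqn_cvg L (fun n => sum_dev p n (2 * n)) g].
Proof.
have mD K n : measurable_fun setT (fun x : S => sum_dev p K n x) by exact: measurable_sum_dev.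
have [|g [mg Dg]] := @sqn_complete _ _ _ L (fun n (x : S) => sum_dev p n n x) (fun n => mD n n).
  move=> e e0; have [N hN] := sum_dev_cauchy emu iL p2 p1 e0.
  by exists N => n m Nn Nm; apply: hN.
exists g; split => // e e0.
have e40 : 0 < e / 4 by rewrite divr_gt0.
have [N1 hN1] := Dg _ e40; have [N2 hN2] := sum_dev_cauchy emu iL p2 p1 e40.
exists (maxn N1 N2) => n; rewrite geq_max => /andP[n1 n2].
rewrite (_ : (fun x : S => _) = fun x : S =>
  (sum_dev p n (2 * n) x - sum_dev p n n x) + (sum_dev p n n x - g x)); last first.
  by apply/funext => x; rewrite addrA subrK.
rewrite (_ : e = 2 * (e / 4 + e / 4)); last by field.
apply: sqnD2.
- exact: measurable_funB.
- exact: measurable_funB.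
- by apply: hN2 => //; rewrite leq_pmull.
- exact: hN1.
Qed.

(** Resampling coordinate [i] leaves [B] unchanged and makes [x i] independent
    of it. *)
Lemma indep_coord (A : set R) (B : set S) i : measurable A -> measurable B ->
  (forall x t, B (upd x i t) <-> B x) ->
  L [set x : S | A (x i) /\ B x] = (mu A * L B)%E.
Proof.
move=> mA mB hB.
have mAi : measurable [set x : S | A (x i)].
  by rewrite -[X in measurable X]setTI; exact: (@measurable_coord nat _ R i measurableT A).
have mE : measurable [set x : S | A (x i) /\ B x] by exact: measurableI.
transitivity (\int[L]_x (\1_[set x : S | A (x i) /\ B x] x)%:E)%E.
  by rewrite integral_indic// setIT.
rewrite (iid_fubini i iL)//; last first.
  by apply/measurable_EFinP; exact: measurable_indic.
transitivity (\int[mu]_t ((\1_A t)%:E * L B))%E.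
  apply: eq_integral => t _.
  transitivity ((\1_A t)%:E * \int[L]_x (\1_B x)%:E)%E; last first.
    by rewrite integral_indic// setIT.
  rewrite -ge0_integralZl//; last first.
    by apply/measurable_EFinP; exact: measurable_indic.
  apply: eq_integral => x _; rewrite -EFinM !indicE -natrM mulnb; congr (_%:R%:E).
  congr nat_of_bool; apply/idP/idP => [|/andP[]].
    rewrite inE /= {1}/upd eqxx => -[At /hB Bx].
    by apply/andP; split; exact/mem_set.
  rewrite !inE /= => At Bx.
  by split; [rewrite /upd eqxx|exact/hB].
rewrite ge0_integralZr//; last first.
  by apply/measurable_EFinP; exact: measurable_indic.
by rewrite integral_indic// setIT.
Qed.

(** With probability [expR (- ((y + b) `^ p^-1))] the coordinate [x 0] alone
    makes the first of the powers exceed [y + b]; the other terms do not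
    involve [x 0], and by Chebyshev's inequality they are bounded with
    probability at least 1/2. *)
Lemma sum_dev_lower_tail : exists2 b : R, 0 <= b & forall (n : nat) (y : R), 0 <= y ->
  ((2^-1 * expR (- ((y + b) `^ p^-1)))%:E <=
   L [set x : S | (y < sum_dev p n.+1 n.+1 x)%R])%E.
Proof.
(* Chebyshev's inequality at level [r] leaves probability at most
   [dev_bound / r ^+ 2 <= 1/2]; in the final bound, [2 + r], the 2 accounts
   for the term [mean_tau 0 N `^ p] *)
pose r : R := 1 + 2 * dev_bound.
have B0 : 0 <= dev_bound by rewrite mulr_ge0 ?sqr_ge0// mulr_ge0.
have r0 : 0 < r by rewrite ltr_pwDl// mulr_ge0.
exists (2 + r) => [|n y y0]; first by rewrite addr_ge0// ltW.
pose N := n.+1.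
pose Q (x : nat -> R) := \sum_(1 <= k < N) dev p k N x.
have mQ : measurable_fun setT (fun x : S => Q x).
  by rewrite /Q; apply: measurable_sum => k; exact: measurable_dev.
have Qupd x t : Q (upd x 0 t) = Q x.
  rewrite /Q big_nat [RHS]big_nat; apply: eq_bigr => k /andP[k1 _].
  rewrite /dev; congr (_ `^ p - _); apply: eq_bigr => j _; rewrite /coef.
  case: ifPn => kj; last by rewrite !mul0r.
  by rewrite /upd gtn_eqF// (leq_trans k1).
pose w := y + (2 + r).
have w0 : 0 <= w by rewrite addr_ge0// addr_ge0// ltW.
pose A : set R := `]w `^ p^-1, +oo[%classic.
pose B : set S := [set x | `|Q x| < r].
have mB : measurable B.
  rewrite -[X in measurable X]setTI.
  by apply: (measurable_fun_ltr _ _ measurableT (Y := [set true])) => //;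
    exact: measurableT_comp.
have LB : ((2^-1)%:E <= L B)%E.
  have -> : B = ~` [set x : S | r <= `|Q x|].
    apply/seteqP; split => x /=; first by move=> h; apply/negP; rewrite -ltNge.
    by move/negP; rewrite -ltNge.
  rewrite probability_setC; last exact: measurable_abs_ge_set.
  have h : (L [set x : S | (r <= `|Q x|)%R] <= (2^-1)%:E)%E.
    apply: le_trans (sqn_markov L mQ r0) _.
    apply: (@le_trans _ _ ((r ^- 2)%:E * dev_bound%:E)%E).
      apply: lee_wpmul2l; first by rewrite lee_fin invr_ge0 exprn_ge0// ltW.
      exact: sqn_dev_sum.
    rewrite -EFinM lee_fin mulrC ler_pdivrMr ?exprn_gt0//.
    rewrite /r; set D := dev_bound in B0 *.
    have := sqr_ge0 D.
    rewrite (_ : 2^-1 * (1 + 2 * D) ^+ 2 = 2^-1 + 2 * D + 2 * D ^+ 2); last by field.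
    lra.
  rewrite -[X in (1 - X)%E]fineK; last by apply: fin_num_measure; exact: measurable_abs_ge_set.
  move: h; rewrite -[X in (X <= _)%E -> _]fineK; last by apply: fin_num_measure; exact: measurable_abs_ge_set.
  by rewrite -EFinB !lee_fin; lra.
apply: (@le_trans _ _ (L [set x : S | A (x 0%N) /\ B x])).
  rewrite indep_coord//; last 2 first.
  - exact: measurable_itv.
  - by move=> x t; rewrite /B/= Qupd.
  rewrite /A emu ?powR_ge0// mulrC EFinM.
  by apply: lee_wpmul2l; rewrite ?lee_fin ?expR_ge0.
have mU : measurable [set x : S | A (x 0%N) /\ B x].
  apply: measurableI => //.
  rewrite -[X in measurable X]setTI.
  by apply: (@measurable_coord nat _ R 0%N measurableT A); rewrite /A.
have mV : measurable [set x : S | y < sum_dev p n.+1 n.+1 x].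
  by apply: measurable_gt_set; exact: measurable_sum_dev.
apply: (le_measure L (mem_set mU) (mem_set mV)) => x /= [Ax Bx].
have -> : sum_dev p N N x = dev p 0 N x + Q x.
  by rewrite /sum_dev -(big_mkord xpredT (fun k => dev p k N x)) big_ltn.
have h1 : w < lin (coef R 0) N x `^ p.
  move: Ax; rewrite /A/= in_itv/= andbT => Ax.
  have x0 : w `^ p^-1 < `|x 0%N| by exact: lt_le_trans Ax (ler_norm _).
  have -> : w = (w `^ p^-1) `^ p by rewrite -powRrM mulVf ?gt_eqF// powRr1.
  apply: gt0_ltr_powR; rewrite ?nnegrE ?powR_ge0//.
    by apply: lin_ge0 => j; exact: coef_ge0.
  apply: lt_le_trans x0 _; rewrite /lin big_ord_recl/= /coef/= /inv_sq exp1n invr1 mul1r lerDl.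
  by apply: sumr_ge0 => j _; rewrite mulr_ge0// ltW// invr_gt0 ltr0n expn_gt0.
have h2 : mean_tau R 0 N `^ p <= 2.
  apply: (@le_trans _ _ (2 `^ p)).
    apply: ge0_ler_powR; rewrite ?nnegrE ?mean_tau_ge0//; first exact: ltW.
    by have := mean_tau_le R 0 N; rewrite divr1.
  by rewrite -[leRHS]powRr1//; apply: ler_powR; rewrite ?ler1n// ltW.
have h3 : `|Q x| < r := Bx; move: h3; rewrite ltr_norml /dev => /andP[h3 _].
move: h1 h2 h3; rewrite /w; set a := _ `^ p; set b := _ `^ p; set c := Q x; lra.
Qed.

End limit.

(** * An exponential moment of the limit *)

Section exponential_moment.
Context (R : realType) (mu : probability R R)
  (L : probability (prodspace nat R) R).
Hypotheses (emu : expo_law mu) (iL : iid_law mu L).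
Notation S := (prodspace nat R).

Lemma expo_mgf : exists2 C : R, 0 <= C & forall t : R, 0 <= t -> t <= 4^-1 ->
  (\int[mu]_x (expR (t * (`|x| - 1)))%:E <= (expR (C * t ^+ 2))%:E)%E.
Proof.
pose X (x : R) := `|x| - 1.
have mn : measurable_fun setT (fun x : R => `|x|) by exact: normr_measurable.
have mX : measurable_fun setT X by exact: measurable_funB.
have m2 : measurable_fun setT (fun x : R => `|x| / 2) by exact: measurable_funM.
have h0 : 0 < 2^-1 :> R by rewrite invr_gt0.
have eX : (\int[mu]_x (expR (2^-1 * X x))%:E < +oo)%E.
  apply: (@le_lt_trans _ _ (\int[mu]_x (expR (`|x| / 2))%:E)%E); last first.
    by rewrite expo_exp// ltry.
  apply: ge0_le_integral => //.
  - apply/measurable_EFinP; apply: measurableT_comp => //.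
    exact: measurable_funM.
  - by apply/measurable_EFinP; apply: measurableT_comp.
  - by move=> x _; rewrite lee_fin ler_expR /X; set z := `|x|; lra.
have sn : (sqn mu (fun x : R => `|x|)%R < +oo)%E.
  apply: le_lt_trans (expo_sqr emu); rewrite le_eqVlt; apply/orP; left; apply/eqP.
  by apply: eq_integral => x _; rewrite real_normK ?num_real.
have sX : (sqn mu X < +oo)%E.
  by apply: sqnD_lty => //; rewrite (sqn_cst mu (-1)) ltry.
have EX : mean mu X = 0.
  have -> : X = (fun x => `|x| - cst 1 x) by [].
  rewrite meanB; last 2 first.
  - exact: sqn_Lfun1.
  - by apply: sqn_Lfun1 => //; rewrite sqn_cst ltry.
  rewrite mean_cst /mean unlock.
  by rewrite (_ : (\int[mu]_x _)%E = 1%E) ?subrr//; exact: expo_abs.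
have [C C0 hC] := mgf_subgaussian mX h0 eX sX EX.
by exists C => // t t0 t4; apply: hC => //; lra.
Qed.

(** The exponential of a sum of independent variables: induction on [n],
    resampling coordinate [n]. *)
Lemma mgf_lin (C : R) : 0 <= C ->
  (forall t : R, 0 <= t -> t <= 4^-1 ->
    (\int[mu]_x (expR (t * (`|x| - 1)))%:E <= (expR (C * t ^+ 2))%:E)%E) ->
  forall (c : nat -> R) (t : R) n, 0 <= t -> (forall j, 0 <= c j) ->
   (forall j, (j < n)%N -> t * c j <= 4^-1) ->
  (\int[L]_x (expR (t * (lin c n x - \sum_(j < n) c j)))%:E <=
    (expR (C * t ^+ 2 * \sum_(j < n) c j ^+ 2))%:E)%E.
Proof.
move=> C0 hC c t n t0 c0; elim: n => [|n IH] hc.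
  rewrite !big_ord0 mulr0 expR0.
  rewrite (_ : (\int[L]_x _)%E = (\int[L]_x (cst 1%E x))%E); last first.
    by apply: eq_integral => x _; rewrite /lin big_ord0 subrr mulr0 expR0.
  by rewrite integral_cst//= probability_setT mule1.
have ml k : measurable_fun setT (fun x : S => (expR (t * (lin c k x - \sum_(j < k) c j)))%:E).
  apply/measurable_EFinP; apply: measurableT_comp => //.
  apply: measurable_funM => //; apply: measurable_funB => //; exact: measurable_lin.
rewrite (iid_fubini n iL)//.
have hn : 0 <= t * c n by rewrite mulr_ge0.
have IH' := IH (fun j jn => hc j (leq_trans jn (leqnSn n))).
set I := (\int[L]_x _)%E in IH'.
have I0 : (0 <= I)%E by apply: integral_ge0 => x _; rewrite lee_fin expR_ge0.
have mE : measurable_fun setT (fun s : R => (expR (t * c n * (`|s| - 1)))%:E).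
  apply/measurable_EFinP; apply: measurableT_comp => //.
  apply: measurable_funM => //; apply: measurable_funB => //; exact: normr_measurable.
rewrite (eq_integral (fun s : R => (expR (t * c n * (`|s| - 1)))%:E * I)%E).
  rewrite ge0_integralZr//.
  apply: (@le_trans _ _ ((expR (C * (t * c n) ^+ 2))%:E *
     (expR (C * t ^+ 2 * \sum_(j < n) c j ^+ 2))%:E)%E).
    apply: lee_pmul => //.
      by apply: integral_ge0 => s _; rewrite lee_fin expR_ge0.
    by apply: hC => //; exact: hc.
  rewrite -EFinM lee_fin -expRD ler_expR big_ord_recr/= exprMn.
  by set u := \sum_(i < n) _; rewrite le_eqVlt; apply/orP; left; apply/eqP; ring.
move=> s _; rewrite -ge0_integralZl//.
apply: eq_integral => x _; rewrite linS_upd -EFinM -expRD big_ord_recr/=.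
by congr (expR _)%:E; set u := \sum_(i < n) _; ring.
Qed.

Variable p : R.
Hypotheses (p2 : 2^-1 < p) (p1 : p < 1).
Let p0 : 0 < p. Proof. by apply: lt_trans p2; rewrite invr_gt0. Qed.
Let p01 : 0 < p < 1. Proof. by rewrite p0 p1. Qed.

(** The gradient, at the means, of the sum of [p]-th powers that
    [sum_dev K (2 * K)] compares with its value at the means. *)
Definition tcoef (K j : nat) : R :=
  \sum_(k < K) p * mean_tau R k (2 * K) `^ (p - 1) * coef R k j.

Lemma tcoef_ge0 K j : 0 <= tcoef K j.
Proof.
apply: sumr_ge0 => k _; rewrite mulr_ge0 ?coef_ge0// mulr_ge0 ?powR_ge0//.
exact: ltW.
Qed.

Lemma sum_dev_le_lin K x :
  sum_dev p K (2 * K) x <= lin (tcoef K) (2 * K) x - \sum_(j < 2 * K) tcoef K j.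
Proof.
have -> : lin (tcoef K) (2 * K) x =
    \sum_(k < K) p * mean_tau R k (2 * K) `^ (p - 1) * lin (coef R k) (2 * K) x.
  rewrite /lin; under eq_bigr do rewrite mulr_suml.
  rewrite exchange_big/=; apply: eq_bigr => k _.
  by rewrite mulr_sumr; apply: eq_bigr => j _; rewrite mulrA.
have -> : \sum_(j < 2 * K) tcoef K j =
    \sum_(k < K) p * mean_tau R k (2 * K) `^ (p - 1) * mean_tau R k (2 * K).
  by rewrite exchange_big/=; apply: eq_bigr => k _; rewrite mulr_sumr.
rewrite -sumrB; apply: ler_sum => k _.
rewrite /dev lerBlDl -mulrBr; apply: powR_tangent => //.
  by apply: lin_ge0 => j; exact: coef_ge0.
by apply: mean_tau_gt0; rewrite (leq_trans (ltn_ord k))// leq_pmull.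
Qed.

(** As [mean_tau k (2 * K) >= (2 * (k + 1))^-1], the slopes are at most
    [2 * (k + 1) `^ (1 - p)], and only the [j + 1] indices [k <= j]
    contribute. *)
Lemma tcoef_le K j : tcoef K j <= 2 * rpow p j.
Proof.
have j0 : 0 < (j.+1%:R : R) by rewrite ltr0n.
pose w : R := 2 * j.+1%:R `^ (1 - p).
have w0 : 0 <= w by rewrite mulr_ge0// powR_ge0.
apply: (@le_trans _ _ (\sum_(k < K) (if (k <= j)%N then w * inv_sq R j else 0))).
  apply: ler_sum => k _; rewrite /coef; case: ifPn => kj; last by rewrite mulr0.
  rewrite ler_wpM2r ?(ltW (inv_sq_gt0 _ _))//.
  have k0 : 0 < (k.+1%:R : R) by rewrite ltr0n.
  set m := mean_tau R k (2 * K).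
  have mlow : (2 * k.+1%:R)^-1 <= m.
    apply: le_trans (mean_tau_ge R _); last first.
      by rewrite (leq_trans (ltnW (ltn_ord k)))// leq_pmull.
    have -> : (2 * k.+1%:R)^-1 = k.+1%:R^-1 - (2 * k.+1%:R)^-1 :> R.
      by field; rewrite gt_eqF.
    rewrite lerD2l lerN2 -natrM lef_pV2 ?posrE ?ltr0n// ler_nat.
    by rewrite (leq_trans (_ : 2 * k.+1 <= 2 * K)%N)// leq_mul2l ltn_ord.
  have m0 : 0 < m by apply: lt_le_trans mlow; rewrite invr_gt0 mulr_gt0.
  have -> : m `^ (p - 1) = (m^-1) `^ (1 - p).
    by rewrite -[m^-1]powR_inv1 ?ltW// -powRrM mulN1r opprB.
  apply: (@le_trans _ _ ((m^-1) `^ (1 - p))).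
    by rewrite ler_piMl ?powR_ge0// ltW.
  apply: (@le_trans _ _ ((2 * j.+1%:R) `^ (1 - p))).
    apply: ge0_ler_powR; rewrite ?nnegrE ?invr_ge0 ?(ltW m0)//.
    - by have := p1; lra.
    - rewrite -[leRHS]invrK lef_pV2 ?posrE ?invr_gt0 ?mulr_gt0//.
      apply: le_trans mlow.
      by rewrite lef_pV2 ?posrE ?mulr_gt0// ler_pM2l// ler_nat ltnS.
  rewrite powRM ?(ltW j0)// /w ler_wpM2r ?powR_ge0//.
  rewrite -[leRHS]powRr1//; apply: ler_powR; first by rewrite ler1n.
  by have := p0; lra.
set v := w * inv_sq R j; have v0 : 0 <= v by rewrite mulr_ge0// ltW// inv_sq_gt0.
have card : \sum_(k < K) (if (k <= j)%N then v else 0) <= (minn K j.+1)%:R * v.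
  elim: K => [|K IH]; first by rewrite big_ord0 mulr_ge0.
  rewrite big_ord_recr/=; case: ifPn => Kj.
    rewrite (minn_idPl _) ?ltnS// -natr1 mulrDl mul1r lerD2r.
    by apply: le_trans IH _; rewrite ler_wpM2r// ler_nat geq_minl.
  rewrite addr0; apply: le_trans IH _; rewrite ler_wpM2r// ler_nat.
  by rewrite leq_min geq_minr (leq_trans (geq_minl _ _)).
apply: le_trans card _.
apply: (@le_trans _ _ (j.+1%:R * v)); first by rewrite ler_wpM2r// ler_nat geq_minr.
rewrite le_eqVlt; apply/orP; left; apply/eqP.
rewrite /v /w /inv_sq natrX /rpow [in RHS](_ : - p = (1 - p) - 1)//; last by ring.
rewrite (powRD_gt0 (1 - p) (-1) j0) powR_inv1 ?ltW//.
by move: j0; set a := _ `^ _; set J : R := j.+1%:R => j0; field; rewrite gt_eqF.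
Qed.

Lemma tcoef_sqr_sum K n :
  \sum_(j < n) tcoef K j ^+ 2 <= 4 * (1 + (2 * p - 1)^-1).
Proof.
apply: (@le_trans _ _ (\sum_(j < n) 4 * rpow (2 * p) j)).
  apply: ler_sum => j _.
  apply: (@le_trans _ _ ((2 * rpow p j) ^+ 2)).
    by rewrite lerXn2r ?nnegrE ?tcoef_ge0 ?tcoef_le// mulr_ge0// ltW// rpow_gt0.
  rewrite exprMn /rpow -[(_ `^ _) ^+ 2]powR_mulrn ?powR_ge0// -powRrM.
  by rewrite mulNr [p * _]mulrC -natrX.
rewrite -mulr_sumr ler_wpM2l// rpow_sum_bound//.
by have := p2; lra.
Qed.

(** The forms of [sum_dev_le_lin] have bounded sums of squared coefficients,
    so their exponential moments are bounded; Fatou's lemma passes to the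
    limit. *)
Lemma limit_mgf (g : S -> R) : measurable_fun setT g ->
  sqn_cvg L (fun n => sum_dev p n (2 * n)) g ->
  (\int[L]_x (expR (8^-1 * g x))%:E < +oo)%E.
Proof.
move=> mg Dg.
have mD n : measurable_fun setT (fun x : S => sum_dev p n (2 * n) x).
  exact: measurable_sum_dev.
have [phi [_ hphi]] := sqn_ae_subseq mD mg Dg.
have [C C0 hC] := expo_mgf.
have mexp (f : S -> R) : measurable_fun setT f ->
    measurable_fun setT (fun x => (expR (8^-1 * f x))%:E).
  move=> mf; apply/measurable_EFinP; apply: measurableT_comp => //.
  exact: measurable_funM.
apply: (@le_lt_trans _ _ (expR (C * 8^-1 ^+ 2 * (4 * (1 + (2 * p - 1)^-1))))%:E);
  last exact: ltry.
apply: (@fatou_le _ _ _ L (fun k x => (expR (8^-1 * sum_dev p (phi k) (2 * phi k) x))%:E)).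
- by move=> k; exact: mexp.
- exact: mexp.
- by move=> k x; rewrite lee_fin expR_ge0.
- by move=> x; rewrite lee_fin expR_ge0.
- apply: filterS hphi => x hx; apply: cvg_EFin; first exact: nearW.
  apply: (cvg_comp (fun k => 8^-1 * sum_dev p (phi k) (2 * phi k) x) (@expR R)).
    exact: cvgMr hx.
  exact: continuous_expR.
move=> k; set K := phi k.
have ml : measurable_fun setT (fun x : S =>
    lin (tcoef K) (2 * K) x - \sum_(j < 2 * K) tcoef K j).
  apply: measurable_funB => //; exact: measurable_lin.
apply: (@le_trans _ _ (\int[L]_x (expR (8^-1 *
    (lin (tcoef K) (2 * K) x - \sum_(j < 2 * K) tcoef K j)))%:E)%E).
  apply: ge0_le_integral => //.
  - exact: mexp.
  - exact: mexp.
  - move=> x _; rewrite lee_fin ler_expR ler_wpM2l//; exact: sum_dev_le_lin.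
apply: le_trans (mgf_lin C0 hC _ (tcoef_ge0 K) _) _ => //.
  (* [tcoef K j <= 2], so the exponent 1/8 stays in the range [t * c j <= 1/4]
     of [mgf_lin] *)
  move=> j _; apply: (@le_trans _ _ (8^-1 * 2)); last by lra.
  rewrite ler_wpM2l//; apply: le_trans (tcoef_le _ _) _.
  rewrite ler_piMr// /rpow powRN invf_le1 ?powR_gt0//.
  rewrite -[leLHS](powRr0 j.+1%:R); apply: ler_powR; rewrite ?ler1n//.
  exact: ltW.
rewrite lee_fin ler_expR ler_wpM2l ?mulr_ge0 ?sqr_ge0//; exact: tcoef_sqr_sum.
Qed.

End exponential_moment.

(** * Laws with a tail heavier than Gaussian *)

Section tails.
Context d0 (T : measurableType d0) (R : realType) (P : probability T R).
Variable d : R.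
Hypotheses (d1 : 1 < d) (d2 : d < 2).

(** A lower bound on the upper tail which, for [d < 2], no Gaussian law
    satisfies. *)
Definition heavy_tail (X : T -> R) : Prop := exists2 b : R, 0 <= b &
  forall y, 0 <= y ->
    ((2^-1 * expR (- ((y + b) `^ d)))%:E <= P [set t | (y < X t)%R])%E.

(** For large [y], [(y + b) `^ d <= 4 * y `^ d] is smaller than
    [a * y ^+ 2 = a * y `^ (2 - d) * y `^ d] by more than any given constant. *)
Lemma heavy_tail_exceeds_gaussian (X : T -> R) (a K y0 : R) : heavy_tail X -> 0 < a ->
  (forall y, y0 <= y -> (P [set t | (y < X t)%R] <= (K * expR (- (a * y ^+ 2)))%:E)%E) ->
  False.
Proof.
move=> [b b0 low] a0 up.
pose k := 2 * `|K|; have k0 : 0 <= k by rewrite mulr_ge0.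
(* [y] is chosen so that [a * y `^ (2 - d) >= 5 + k], with [2 * K < expR k] *)
pose Z := (5 + k) / a.
have Z0 : 0 <= Z by rewrite divr_ge0 ?addr_ge0// ltW.
have e0 : 0 < 2 - d by have := d2; lra.
pose y := Num.max (Num.max 1 b) (Num.max y0 (Z `^ (2 - d)^-1)).
have y1 : 1 <= y by rewrite !le_max lexx.
have yb : b <= y by rewrite !le_max lexx !orbT.
have yy0 : y0 <= y by rewrite !le_max lexx !orbT.
have yZ : Z `^ (2 - d)^-1 <= y by rewrite !le_max lexx !orbT.
have y00 : 0 < y by lra.
have h1 : Z <= y `^ (2 - d).
  have -> : Z = (Z `^ (2 - d)^-1) `^ (2 - d).
    by rewrite -powRrM mulVf ?gt_eqF// powRr1.
  by apply: ge0_ler_powR; rewrite ?nnegrE ?powR_ge0 ?(ltW e0) ?(ltW y00).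
set D := y `^ d.
have D1 : 1 <= D by rewrite /D -[leLHS](powRr0 y); apply: ler_powR => //; have := d1; lra.
have y2 : y ^+ 2 = y `^ (2 - d) * D.
  rewrite -powRD ?subrK; last by rewrite (gt_eqF y00) implybT.
  by rewrite powR_mulrn// ltW.
have h2 : (5 + k) * D <= a * y ^+ 2.
  rewrite y2 mulrA ler_wpM2r//; first by lra.
  by rewrite -ler_pdivrMl// mulrC.
have h3 : (y + b) `^ d <= 4 * D.
  apply: (@le_trans _ _ ((2 * y) `^ d)).
    by apply: ge0_ler_powR; rewrite ?nnegrE; have := d1; lra.
  rewrite powRM ?(ltW y00)// ler_wpM2r ?powR_ge0//.
  apply: (@le_trans _ _ (2 `^ 2)); first by apply: ler_powR; have := d2; lra.
  by rewrite (powR_mulrn 2%N)//; lra.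
have := le_trans (low y (ltW y00)) (up y yy0); rewrite lee_fin.
apply/negP; rewrite -ltNge.
have hK : K < 2^-1 * expR k.
  have := expR_ge1Dx k; have := ler_norm K; rewrite /k.
  set u := expR _; set v := `|K|; lra.
apply: (@lt_le_trans _ _ (2^-1 * expR k * expR (- (a * y ^+ 2)))).
  by rewrite ltr_pM2r// expR_gt0.
rewrite -mulrA ler_pM2l ?invr_gt0// -expRD ler_expR.
have : k <= k * D by rewrite ler_peMr.
rewrite mulrDl in h2; move: h2 h3; set u := k * D; set v := a * _; set w := _ `^ d; lra.
Qed.

(** Beyond a large [y], the normal density with deviation [s] is at most a
    Gaussian factor in [y] times the density with deviation [2 * s], whose
    integral is 1. *)
Lemma heavy_tail_not_gaussian (X : {RV P >-> R}) : heavy_tail X -> ~ gaussian X.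
Proof.
move=> hX [[m [s [s0 law]]]|[m law]].
  pose K := normal_peak s / normal_peak (2 * s).
  have s1 : s != 0 by rewrite gt_eqF.
  have s2 : 2 * s != 0 by rewrite mulf_neq0.
  have p1 := normal_peak_gt0 s1; have p2 := normal_peak_gt0 s2.
  have K0 : 0 < K by rewrite divr_gt0.
  pose a := 3 / (32 * s ^+ 2).
  have a0 : 0 < a by rewrite divr_gt0// mulr_gt0// exprn_gt0.
  apply: (@heavy_tail_exceeds_gaussian X a K (2 * `|m|) hX a0) => y ym.
  have nm := normr_ge0 m; have lm := ler_norm m.
  have lm' : - m <= `|m| by rewrite -normrN ler_norm.
  pose A : set R := `]y, +oo[%classic.
  have mA : measurable A by exact: measurable_itv.
  have -> : P [set t | (y < X t)%R] = normal_prob m s A.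
    rewrite -law// /distribution/= /pushforward; congr (P _).
    by apply/seteqP; split => t; rewrite /A/= in_itv/= andbT.
  have bnd x : A x -> normal_pdf m s x <= K * expR (- (a * y ^+ 2)) * normal_pdf m (2 * s) x.
    rewrite /A/= in_itv/= andbT => yx; rewrite !normal_pdfE// /K.
    rewrite (_ : _ * _ * _ = normal_peak s *
      (expR (- (a * y ^+ 2)) * normal_fun m (2 * s) x)); last first.
      by field; rewrite gt_eqF.
    rewrite ler_pM2l// /normal_fun -expRD ler_expR -!(mulr_natr (_ ^+ 2)).
    rewrite /a -subr_ge0.
    rewrite (_ : _ - _ = 3 / (32 * s ^+ 2) * ((2 * (x - m)) ^+ 2 - y ^+ 2)); last first.
      by field; rewrite s1.
    rewrite mulr_ge0 ?(ltW a0)// subr_ge0 lerXn2r// ?nnegrE; lra.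
  apply: (@le_trans _ _ (\int[lebesgue_measure]_(x in A)
      ((K * expR (- (a * y ^+ 2)))%:E * (normal_pdf m (2 * s) x)%:E))%E).
    apply: ge0_le_integral => //.
    - by move=> x _; rewrite lee_fin normal_pdf_ge0.
    - apply/measurable_EFinP; apply: measurable_funTS; exact: measurable_normal_pdf.
    - apply: emeasurable_funM => //.
      apply/measurable_EFinP; apply: measurable_funTS; exact: measurable_normal_pdf.
  have c0 : 0 <= K * expR (- (a * y ^+ 2)) by rewrite mulr_ge0 ?expR_ge0// ltW.
  rewrite ge0_integralZl//; last first.
  - by move=> x _; rewrite lee_fin normal_pdf_ge0.
  - apply/measurable_EFinP; apply: measurable_funTS; exact: measurable_normal_pdf.
  rewrite -[leRHS]mule1; apply: lee_wpmul2l; first by rewrite lee_fin.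
  rewrite -(@integral_normal_pdf R m (2 * s)); apply: ge0_subset_integral => //.
  - by apply/measurable_EFinP; exact: measurable_normal_pdf.
  - by move=> x _; rewrite lee_fin normal_pdf_ge0.
apply: (@heavy_tail_exceeds_gaussian X 1 1 m hX ltr01) => y my.
pose A : set R := `]y, +oo[%classic.
have mA : measurable A by exact: measurable_itv.
have -> : P [set t | (y < X t)%R] = \d_m A.
  rewrite -law// /distribution/= /pushforward; congr (P _).
  by apply/seteqP; split => t; rewrite /A/= in_itv/= andbT.
rewrite diracE memNset ?lee_fin ?mul1r ?expR_ge0//.
by rewrite /A/= in_itv/= andbT; apply/negP; rewrite -leNgt.
Qed.

End tails.

Section stable.
Context d0 (T : measurableType d0) (R : realType) (P : probability T R).

Lemma same_law_integral d1 (T1 : measurableType d1) (P1 : probability T1 R)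
    (X : {RV P >-> R}) (Y : {RV P1 >-> R}) (f : R -> \bar R) :
  has_law Y (distribution P X) -> measurable_fun setT f -> (forall x, 0 <= f x)%E ->
  (\int[P1]_t f (Y t) = \int[P]_t f (X t))%E.
Proof.
move=> law mf f0.
have hY := ge0_integral_distribution Y mf f0.
have hX := ge0_integral_distribution X mf f0.
apply: (eq_trans (esym hY)); apply: (eq_trans _ hX).
by apply: eq_measure_integral => A mA _; exact: law.
Qed.

Lemma independent_copies (X : {RV P >-> R}) :
  exists Y : 'I_2 -> {RV ((P \x P)%E : probability _ R) >-> R},
    iid_with_law Y (distribution P X) /\
    forall z, (\sum_(i < 2) Y i : {RV ((P \x P)%E : probability _ R) >-> R}) z = X z.1 + X z.2.
Proof.
pose PP : probability (T * T)%type R := (P \x P)%E.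
have m1 : measurable_fun setT (fun z : T * T => X z.1).
  exact: measurableT_comp.
have m2 : measurable_fun setT (fun z : T * T => X z.2).
  exact: measurableT_comp.
pose Y1 : {RV PP >-> R} := HB.pack (fun z : T * T => X z.1)
  (isMeasurableFun.Build _ _ _ _ _ m1).
pose Y2 : {RV PP >-> R} := HB.pack (fun z : T * T => X z.2)
  (isMeasurableFun.Build _ _ _ _ _ m2).
pose Y (i : 'I_2) : {RV PP >-> R} := if i == ord0 then Y1 else Y2.
have mXA (A : set R) : measurable A -> measurable (X @^-1` A).
  by move=> mA; exact: measurable_funPTI.
have prodE (A B : set R) : measurable A -> measurable B ->
    PP [set z : T * T | A (X z.1) /\ B (X z.2)] = (P (X @^-1` A) * P (X @^-1` B))%E.
  move=> mA mB; rewrite -(product_measure1E _ _ (mXA _ mA) (mXA _ mB)); congr (PP _).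
have Y1E (A : set R) : measurable A -> PP (Y1 @^-1` A) = P (X @^-1` A).
  move=> mA; rewrite -[RHS]mule1 -[X in (_ * X)%E](probability_setT P).
  rewrite -[in RHS](preimage_setT X) -prodE//; congr (PP _).
  by apply/seteqP; split => z //= [].
have Y2E (A : set R) : measurable A -> PP (Y2 @^-1` A) = P (X @^-1` A).
  move=> mA; rewrite -[RHS]mul1e -[X in (X * _)%E](probability_setT P).
  rewrite -[in RHS](preimage_setT X) -prodE//; congr (PP _).
  by apply/seteqP; split => z //= [].
exists Y; split; last first.
  by move=> z; rewrite !big_ord_recl big_ord0 /= addr0.
split; last first.
  by move=> i A mA; rewrite /Y; case: (i == ord0); [exact: Y1E|exact: Y2E].
move=> J A mA.
pose A' i := if i \in J then A i else setT.
have mA' i : measurable (A' i) by rewrite /A'; case: (i \in J).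
transitivity (PP [set z : T * T | A' ord0 (X z.1) /\ A' ord_max (X z.2)]).
  congr (PP _); apply/seteqP; split => z /=.
    move=> h; split; rewrite /A'; case: ifPn => // iJ.
      exact: (h ord0 iJ).
    exact: (h ord_max iJ).
  move=> [h1 h2] i /= iJ; rewrite /Y.
  case: (eqVneq i ord0) => [i0|i0].
    by move: h1; rewrite /A' -i0 iJ.
  have i1 : i = ord_max by apply/val_inj; case: i i0 {iJ} => -[|[|]].
  by move: h2; rewrite /A' -i1 iJ.
rewrite prodE// big_mkcond/= !big_ord_recl big_ord0 mule1.
congr (_ * _)%E.
  rewrite /A'; case: ifPn => _; first by rewrite -Y1E.
  by rewrite preimage_setT probability_setT.
rewrite (_ : lift ord0 ord0 = ord_max); last exact/val_inj.
rewrite /A'; case: ifPn => _; first by rewrite -Y2E.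
by rewrite preimage_setT probability_setT.
Qed.

(** The case of two summands, realised by the coordinates of the product
    space. *)
Lemma stable_law2 (X : {RV P >-> R}) : stable_law X ->
  exists a b : R, 0 < a /\ forall f : R -> \bar R,
    measurable_fun setT f -> (forall x, 0 <= f x)%E ->
    (\int[P]_x \int[P]_y f (X x + X y)%R = \int[P]_x f (a * X x + b)%R)%E.
Proof.
move=> /(_ 2%N isT)[a [b [a0 h]]]; exists a, b; split => // f mf f0.
have [Y [iidY YE]] := independent_copies X.
have law := h _ _ _ Y iidY.
transitivity (\int[(P \x P)%E]_z f (X z.1 + X z.2)%R)%E.
  rewrite fubini_tonelli1//.
  apply: measurableT_comp => //; apply: measurable_funD; exact: measurableT_comp.
have := same_law_integral law mf f0.
rewrite (eq_integral (fun z => f (X z.1 + X z.2)%R))//.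
by move=> z _; rewrite YE.
Qed.

Lemma sqn_shift (X : T -> R) (c : R) : measurable_fun setT X ->
  (sqn P X < +oo)%E -> mean P X = 0 ->
  sqn P (fun x => X x + c) = (sqn P X + (c ^+ 2)%:E)%E.
Proof.
move=> mX sX EX.
have lX := sqn_Lfun1 mX sX.
have iX : P.-integrable setT (EFin \o X) by exact/Lfun1_integrable.
have iX2 : P.-integrable setT (fun x => (X x ^+ 2)%:E).
  apply/integrableP; split; first exact: measurable_sq.
  by under eq_integral do rewrite gee0_abs ?lee_fin ?sqr_ge0//.
have ic : P.-integrable setT (cst (c ^+ 2)%:E).
  by apply: finite_measure_integrable_cst.
have icX : P.-integrable setT (fun x => (2 * c)%:E * (EFin \o X) x)%E.
  exact: integrableZl.
transitivity (\int[P]_x ((X x ^+ 2)%:E + ((2 * c)%:E * (EFin \o X) x + cst (c ^+ 2)%:E x)))%E.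
  by apply: eq_integral => x _ /=; rewrite -EFinM -!EFinD; congr EFin; ring.
rewrite integralD//; last exact: integrableD.
rewrite integralD// integralZl// integral_cst//= probability_setT mule1.
congr (_ + _)%E; rewrite (_ : (\int[P]_x _)%E = 0%E) ?mule0 ?add0e//.
have <- : ('E_P[X] = \int[P]_x (X x)%:E)%E by rewrite unlock.
rewrite -(fineK (expectation_fin_num lX)); congr EFin; exact: EX.
Qed.

Lemma chernoff (X : T -> R) (t y M : R) : measurable_fun setT X -> 0 <= t ->
  (\int[P]_x (expR (t * X x))%:E <= (expR M)%:E)%E ->
  (P [set x | (y < X x)%R] <= (expR (M - t * y))%:E)%E.
Proof.
move=> mX t0 hM.
have mE : measurable [set x | y < X x] by exact: measurable_gt_set.
have me : measurable_fun setT (fun x => (expR (t * X x))%:E).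
  by apply/measurable_EFinP; apply: measurableT_comp => //; exact: measurable_funM.
rewrite -[P _]mul1e -integral_cst//.
apply: (@le_trans _ _ (\int[P]_(x in [set x | (y < X x)%R])
   ((expR (- (t * y)))%:E * (expR (t * X x))%:E))%E).
  apply: ge0_le_integral => //.
  - by apply: emeasurable_funM => //; exact: measurable_funTS.
  - move=> x /= yX; rewrite -EFinM lee_fin -expRD -[leLHS]expR0 ler_expR.
    by rewrite addrC subr_ge0 ler_wpM2l// ltW.
apply: (@le_trans _ _ (\int[P]_x ((expR (- (t * y)))%:E * (expR (t * X x))%:E))%E).
  apply: ge0_subset_integral => //.
  exact: emeasurable_funM.
rewrite ge0_integralZl//.
by rewrite addrC expRD EFinM; apply: lee_wpmul2l; rewrite ?lee_fin ?expR_ge0.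
Qed.

(** Second moments force [a ^+ 2 = 2] and [b = 0] in [stable_law2], so the
    moment generating function [M] satisfies [M (a * t) = M t * M t]. The
    bound [M t <= expR (C * t ^+ 2)] near 0 then propagates to all [t >= 0],
    and Chernoff's bound gives a Gaussian tail. *)
Lemma heavy_tail_not_stable (d : R) (X : {RV P >-> R}) (t0 : R) : 1 < d -> d < 2 ->
  0 < t0 -> (\int[P]_x (expR (t0 * X x))%:E < +oo)%E -> (sqn P X < +oo)%E ->
  mean P X = 0 -> heavy_tail P d X -> ~ stable_law X.
Proof.
move=> d1 d2 t00 eX sX EX hX /stable_law2[a [b [a0 h]]].
have mX : measurable_fun setT X by [].
have [C C0 hC] := mgf_subgaussian mX t00 eX sX EX.
pose V := fine (sqn P X).
have VE : sqn P X = V%:E by rewrite fineK// ge0_fin_numE// sqn_ge0.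
have V0 : 0 < V.
  rewrite lt0r; apply/andP; split; last by apply: fine_ge0; exact: sqn_ge0.
  apply/negP => /eqP V0.
  have [c c0 low] := hX; have := low 1 ler01.
  apply/negP; rewrite -ltNge.
  apply: (@le_lt_trans _ _ (P [set x | (1 <= `|X x|)%R])).
    apply: le_measure; rewrite ?inE.
    - exact: measurable_gt_set.
    - exact: measurable_abs_ge_set.
    - by move=> x /= x1; apply: le_trans (ltW x1) (ler_norm _).
  apply: (le_lt_trans (sqn_markov P mX ltr01)).
  by rewrite VE V0 mule0 lte_fin mulr_gt0 ?expR_gt0.
(* second moments of both laws translated by [c]; [c = 0] and [c = 1]
   determine [b] and [a ^+ 2] *)
have key (c : R) : V + (V + c ^+ 2) = a ^+ 2 * V + (b + c) ^+ 2.
  apply: EFin_inj.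
  have mf : measurable_fun setT (fun u : R => ((u + c) ^+ 2)%:E).
    apply/measurable_EFinP; apply: measurable_funX; exact: measurable_funD.
  have := h (fun u : R => ((u + c) ^+ 2)%:E) mf (fun u => ltac:(by rewrite lee_fin sqr_ge0)).
  rewrite (eq_integral (fun x => (V%:E + ((X x + c) ^+ 2)%:E)%E)); last first.
    move=> x _; rewrite -VE -(sqn_shift _ mX sX EX).
    by apply: eq_integral => y _; congr EFin; ring.
  rewrite ge0_integralD//; last 3 first.
  - by move=> x _; rewrite lee_fin ltW.
  - by move=> x _; rewrite lee_fin sqr_ge0.
  - by apply: measurable_sq; exact: measurable_funD.
  rewrite integral_cst//= probability_setT mule1.
  rewrite -/(sqn P (fun x => X x + c)%R) (sqn_shift _ mX sX EX) VE -!EFinD => ->.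
  have a1 : a != 0 by rewrite gt_eqF.
  transitivity (sqn P (fun x => a * (X x + (b + c) / a)))%R.
    by apply: eq_integral => x _; congr EFin; field.
  rewrite sqnZ; last exact: measurable_funD.
  rewrite (sqn_shift _ mX sX EX) VE -EFinD -EFinM; congr EFin; field; exact: a1.
have k0 := key 0; have k1 := key 1.
have b0 : b = 0 by move: k0 k1; rewrite !addr0 expr0n expr1n/= sqrrD; lra.
have a2 : a ^+ 2 = 2.
  move: k0; rewrite b0 !addr0 expr0n/= !addr0 => k0.
  have Vn : V != 0 by rewrite gt_eqF.
  by apply: (mulIf Vn); rewrite -k0; ring.
pose M t := (\int[P]_x (expR (t * X x))%:E)%E.
have M0 (t : R) : (0 <= M t)%E by apply: integral_ge0 => x _; rewrite lee_fin expR_ge0.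
have me t : measurable_fun setT (fun x => (expR (t * X x))%:E).
  by apply/measurable_EFinP; apply: measurableT_comp => //; exact: measurable_funM.
have double (t : R) : M (a * t) = (M t * M t)%E.
  have mf : measurable_fun setT (fun u : R => (expR (t * u))%:E).
    by apply/measurable_EFinP; apply: measurableT_comp => //; exact: measurable_funM.
  have := h _ mf (fun u => ltac:(by rewrite lee_fin expR_ge0)).
  rewrite (eq_integral (fun x => ((expR (t * X x))%:E * M t)%E)); last first.
    move=> x _; rewrite -ge0_integralZl//.
    by apply: eq_integral => y _; rewrite -EFinM -expRD mulrDr.
  rewrite ge0_integralZr// => ->.
  by apply: eq_integral => x _; rewrite b0 addr0 mulrCA mulrA.
pose t1 := t0 / 2; have t10 : 0 < t1 by rewrite divr_gt0.
have grow n (t : R) : 0 <= t -> t ^+ 2 <= 2 ^+ n * t1 ^+ 2 ->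
    (M t <= (expR (C * t ^+ 2))%:E)%E.
  elim: n t => [|n IH] t tge.
    rewrite expr0 mul1r ler_sqr ?nnegrE ?(ltW t10)// => tt1; exact: hC.
  move=> ht; have -> : M t = M (a * (t / a)) by congr M; field; rewrite gt_eqF.
  have ta : (t / a) ^+ 2 = t ^+ 2 / 2 by rewrite expr_div_n a2.
  have IH' : (M (t / a)%R <= (expR (C * (t / a) ^+ 2))%:E)%E.
    apply: IH; first by rewrite divr_ge0// ltW.
    by rewrite ta ler_pdivrMr// -mulrA [t1 ^+ 2 * _]mulrC mulrA -exprSr.
  rewrite double; apply: le_trans (lee_pmul (M0 _) (M0 _) IH' IH') _.
  rewrite -EFinM lee_fin -expRD ler_expR ta.
  by rewrite le_eqVlt; apply/orP; left; apply/eqP; field.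
have Mle (t : R) : 0 <= t -> (M t <= (expR (C * t ^+ 2))%:E)%E.
  move=> tge; pose N := Num.bound (t ^+ 2 / t1 ^+ 2).
  apply: (grow N) => //.
  rewrite -ler_pdivrMr ?exprn_gt0//.
  apply: (@le_trans _ _ N%:R).
    by apply: ltW; apply: archi_boundP; rewrite divr_ge0 ?sqr_ge0.
  by rewrite -natrX ler_nat ltnW// ltn_expl.
pose D := C + 1; have D0 : 0 < D by rewrite ltr_wpDl.
apply: (@heavy_tail_exceeds_gaussian _ _ _ P d d1 d2 X (4 * D)^-1 1 0 hX).
  by rewrite invr_gt0 mulr_gt0.
move=> y y0.
(* [t = y / (2 * D)] minimises [D * t ^+ 2 - t * y] *)
have t0' : 0 <= y / (2 * D) by rewrite divr_ge0// mulr_ge0// ltW.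
have ch := @chernoff X _ y _ mX t0' (Mle _ t0').
apply: (le_trans ch).
rewrite mul1r lee_fin ler_expR.
apply: (@le_trans _ _ (D * (y / (2 * D)) ^+ 2 - y / (2 * D) * y)).
  by rewrite lerD2r ler_wpM2r ?sqr_ge0// lerDl.
by rewrite le_eqVlt; apply/orP; left; apply/eqP; field; rewrite gt_eqF.
Qed.

End stable.

(** * The law of the total cost and its limit *)

Section variance.
Context d0 (T : measurableType d0) (R : realType) (P : probability T R).

Lemma variance_sqn (X : T -> R) : ('V_P[X] = sqn P (fun x => X x - mean P X)%R)%E.
Proof.
rewrite /variance covariance.unlock /mean expectation.unlock.
by apply: eq_integral => x _; rewrite expr2.
Qed.

End variance.

Section transfer.
Context d0 (T : measurableType d0) (R : realType) (P : probability T R).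
Context d1 (T1 : measurableType d1) (P1 : probability T1 R).
Variables (X : {RV P >-> R}) (Y : {RV P1 >-> R}).
Hypothesis law : has_law Y (distribution P X).

Lemma same_law_mean : mean P1 Y = mean P X.
Proof.
rewrite /mean expectation.unlock; congr fine.
have mE : measurable_fun setT (@EFin R) by apply/measurable_EFinP; exact: measurable_id.
rewrite [LHS]integralE [RHS]integralE; congr (_ - _)%E.
  have h := same_law_integral law (measurable_funepos mE) (funepos_ge0 _).
  by move: h; rewrite funepos.unlock.
have h := same_law_integral law (measurable_funeneg mE) (funeneg_ge0 _).
by move: h; rewrite funeneg.unlock.
Qed.

Lemma same_law_variance : ('V_P1[Y] = 'V_P[X])%E.
Proof.
rewrite !variance_sqn same_law_mean.
apply: (same_law_integral law (f := fun u => ((u - mean P X) ^+ 2)%:E)).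
  by apply/measurable_EFinP; apply: measurable_funX; exact: measurable_funB.
by move=> x; rewrite lee_fin sqr_ge0.
Qed.

Lemma same_law_cdf_centred (x : R) :
  cdf (centred Y) x = P [set t | X t - mean P X <= x].
Proof.
have mA : measurable `]-oo, x + mean P X]%classic by exact: measurable_itv.
transitivity (distribution P1 Y `]-oo, x + mean P X]%classic).
  rewrite /cdf /distribution/= /pushforward; congr (P1 _).
  apply/seteqP; split => t; rewrite /centred/= !in_itv/= -/(mean P1 Y) same_law_mean.
    by rewrite lerBlDr.
  by rewrite lerBlDr.
rewrite law// /distribution/= /pushforward; congr (P _).
by apply/seteqP; split => t /=; rewrite in_itv/= lerBlDr.
Qed.

End transfer.

Section total_cost_limit.
Context (R : realType) (d : R).
Context (mu : probability R R) (L : probability (prodspace nat R) R).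
Hypotheses (emu : expo_law mu) (iL : iid_law mu L).
Notation S := (prodspace nat R).

Lemma iid_expo_gt0 n : L (box (iota 0 n) (fun=> `]0, +oo[%classic : set R)) = 1%E.
Proof.
rewrite iL ?iota_uniq// big1// => i _.
by rewrite emu// oppr0 expR0.
Qed.

Lemma seq_cost_sum_dev n (x : nat -> R) : box (iota 0 n) (fun=> `]0, +oo[%classic : set R) x ->
  seq_cost (spow d^-1) n 0 x =
  sum_dev d^-1 n n x + \sum_(k < n) mean_tau R k n `^ d^-1.
Proof.
move=> xpos; rewrite /seq_cost /sum_dev -big_split/=; apply: eq_bigr => i _.
rewrite add0r /dev subrK.
suff -> : tau i n x = lin (coef R i) n x.
  by rewrite spow_ge0//; apply: lin_ge0 => j; exact: coef_ge0.
rewrite /lin -(big_mkord xpredT (fun j => coef R i j * `|x j|)) /tau.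
rewrite [RHS](@big_cat_nat _ _ _ i)//=; last exact: ltnW.
rewrite [X in _ = X + _]big_nat [X in _ = X + _]big1 ?add0r; last first.
  by move=> j /andP[_ ji]; rewrite /coef leqNgt ji mul0r.
rewrite big_nat [RHS]big_nat; apply: eq_bigr => j /andP[ij jn].
rewrite /coef ij /inv_sq mulrC; congr (_ * _).
have := xpos j; rewrite mem_iota add0n jn => /(_ isT).
by rewrite /= in_itv/= andbT => /gtr0_norm ->.
Qed.

(** The two functions agree when the first [n] coordinates are positive, which
    has probability 1. *)
Lemma seq_cost_law n (B : set R) : measurable B ->
  L ((fun x : S => seq_cost (spow d^-1) n 0 x) @^-1` B) =
  L ((fun x : S => sum_dev d^-1 n n x + \sum_(k < n) mean_tau R k n `^ d^-1) @^-1` B).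
Proof.
move=> mB.
pose A : set S := box (iota 0 n) (fun=> `]0, +oo[%classic : set R).
have mA : measurable A by apply: measurable_box => i; exact: measurable_itv.
have LA E : measurable E -> L E = L (E `&` A).
  move=> mE; apply/eqP; rewrite eq_le; apply/andP; split; last first.
    apply: (le_measure L); rewrite ?inE//; exact: measurableI.
  have mEA : measurable (E `&` A) by exact: measurableI.
  have mAc : measurable (~` A) by exact: measurableC.
  apply: (@le_trans _ _ (L (E `&` A) + L (~` A))%E).
    apply: le_trans (measureU2 L mEA mAc); apply: (le_measure L); rewrite ?inE//.
      exact: measurableU.
    by move=> x Ex; have [Ax|Ax] := pselect (A x); [left|right].
  by rewrite probability_setC// iid_expo_gt0 subee// adde0.
have m1 : measurable_fun setT (fun x : S => seq_cost (spow d^-1) n 0 x).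
  by apply: measurable_seq_cost; exact: measurable_spow.
have m2 : measurable_fun setT
    (fun x : S => sum_dev d^-1 n n x + \sum_(k < n) mean_tau R k n `^ d^-1).
  by apply: measurable_funD => //; exact: measurable_sum_dev.
have mp (f : S -> R) : measurable_fun setT f -> measurable (f @^-1` B).
  by move=> mf; rewrite -[X in measurable X]setTI; exact: mf.
rewrite LA; last exact: mp.
rewrite [RHS]LA; last exact: mp.
congr (L _); apply/seteqP; split => x /= [Bx Ax]; split => //; move: Bx.
  by rewrite seq_cost_sum_dev.
by rewrite seq_cost_sum_dev.
Qed.

End total_cost_limit.

Section limit_law.
Context (R : realType) (d : R).
Hypotheses (d1 : 1 < d) (d2 : d < 2).
Context (mu : probability R R) (L : probability (prodspace nat R) R).
Hypotheses (emu : expo_law mu) (iL : iid_law mu L).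
Notation S := (prodspace nat R).
Notation p := (d^-1).

Let d0 : 0 < d. Proof. by apply: lt_trans d1. Qed.
Let p2 : 2^-1 < p. Proof. by rewrite ltf_pV2 ?posrE. Qed.
Let p1 : p < 1. Proof. by rewrite invf_lt1. Qed.

Lemma limit_heavy_tail (g : S -> R) (m : R) : measurable_fun setT g ->
  sqn_cvg L (fun n => sum_dev p n n) g -> heavy_tail L d (fun x => g x - m).
Proof.
move=> mg Dg; have [b b0 low] := sum_dev_lower_tail emu iL p2 p1.
exists (b + 1 + `|m|) => [|y y0]; first by rewrite !addr_ge0.
pose z := y + 1 + `|m|; have z0 : 0 <= z by rewrite !addr_ge0.
have mD n : measurable_fun setT (fun x : S => sum_dev p n.+1 n.+1 x).
  exact: measurable_sum_dev.
have Dg1 : sqn_cvg L (fun n => sum_dev p n.+1 n.+1) g.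
  move=> e e0; have [N hN] := Dg e e0; exists N => n Nn; apply: hN.
  exact: leqW.
have := sqn_cvg_gt mD mg Dg1 (fun n => low n z z0).
rewrite invrK (_ : z + b = y + (b + 1 + `|m|)); last by rewrite /z; ring.
move=> h; apply: (le_trans h).
have mA : measurable [set x : S | z - 1 < g x] by exact: measurable_gt_set.
have mB : measurable [set x : S | y < g x - m].
  by apply: measurable_gt_set; exact: measurable_funB.
apply: (le_measure L (mem_set mA) (mem_set mB)) => x /=.
have := ler_norm m; rewrite /z; set a := `|m|; set u := g x; lra.
Qed.

End limit_law.

Theorem theorem1p4 (R : realType) (d : R) (hd : 1 < d < 2) :
  exists (dS : measure_display) (S : measurableType dS) (Q : probability S R)
    (xi : {RV Q >-> R}),
    [/\ ~ gaussian xi, ~ stable_law xi, ('V_Q[xi] < +oo)%E &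
      forall (dT : nat -> measure_display) (T : forall n, measurableType (dT n))
        (P : forall n, probability (T n) R)
        (omega : forall n, edge n -> {RV (P n) >-> R}),
        (forall n, iid_with_law (omega n) (weibull_prob d)) ->
        cvg_in_law P (fun n => centred (stable_cost (omega n))) Q xi /\
        'V_(P n)[stable_cost (omega n)] @[n --> \oo] --> 'V_Q[xi]].
Proof.
have /andP[d1 d2] := hd; have d0 : 0 < d by exact: lt_trans d1.
have p2 : 2^-1 < d^-1 by rewrite ltf_pV2 ?posrE.
have p1 : d^-1 < 1 by rewrite invf_lt1.
have emu := @expo_prob1_law R.
have [L iL] := exists_iid_sequence emu.
have [g [mg Dg D2g]] := exists_limit emu iL p2 p1.
pose S := prodspace nat R.
pose D n (x : S) := sum_dev d^-1 n n x.
have mD n : measurable_fun setT (D n) by exact: measurable_sum_dev.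
have sD n : (sqn L (D n) < +oo)%E by apply: (sqn_sum_dev_lty (p := d^-1) emu iL).
have sg : (sqn L g < +oo)%E by exact: sqn_cvg_lty mD mg Dg sD.
pose m := mean L g.
have mX : measurable_fun setT (fun x : S => g x - m) by exact: measurable_funB.
pose xi : {RV L >-> R} := HB.pack (fun x : S => g x - m)
  (isMeasurableFun.Build _ _ _ _ _ mX).
have mxi : measurable_fun setT xi by [].
have sxi : (sqn L xi < +oo)%E.
  by apply: (@sqnD_lty _ _ _ L g (cst (- m))) => //; rewrite sqn_cst ltry.
have Exi : mean L xi = 0.
  rewrite (@meanB _ _ _ L g (cst m)); last 2 first.
  - exact: sqn_Lfun1.
  - by apply: sqn_Lfun1 => //; rewrite sqn_cst ltry.
  by rewrite mean_cst subrr.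
have heavy : heavy_tail L d xi by exact: (limit_heavy_tail d1 d2 emu iL m mg Dg).
have Vxi : 'V_L[xi] = sqn L xi.
  by rewrite variance_sqn Exi; apply: eq_integral => x _; rewrite subr0.
have exi : (\int[L]_x (expR (8^-1 * xi x))%:E < +oo)%E.
  have eg := limit_mgf emu iL p2 p1 mg D2g.
  rewrite (eq_integral (fun x : S => (expR (- (8^-1 * m)))%:E * (expR (8^-1 * g x))%:E)%E).
    rewrite ge0_integralZl//; first by apply: lte_mul_pinfty; rewrite ?lee_fin ?expR_ge0.
    apply/measurable_EFinP; apply: measurableT_comp => //.
    exact: measurable_funM.
  by move=> x _; rewrite -EFinM -expRD /xi/=; congr (expR _)%:E; ring.
exists _, S, L, xi; split.
- exact: heavy_tail_not_gaussian d1 d2 _ heavy.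
- exact: heavy_tail_not_stable d1 d2 _ exi sxi Exi heavy.
- by rewrite Vxi.
move=> dT T P omega iid.
(* [D n + c n] has the law of the total cost, and the constant [c n]
   disappears on centring *)
pose c n : R := \sum_(k < n) mean_tau R k n `^ d^-1.
have mU n : measurable_fun setT (fun x : S => D n x + c n) by exact: measurable_funD.
pose U n : {RV L >-> R} := HB.pack (fun x : S => D n x + c n)
  (isMeasurableFun.Build _ _ _ _ _ (mU n)).
have EU n : mean L (U n) = mean L (D n) + c n.
  rewrite -[c n]opprK -[X in _ = _ - X](mean_cst L) -meanB; last 2 first.
  - exact: sqn_Lfun1.
  - by apply: sqn_Lfun1 => //; rewrite sqn_cst ltry.
  by congr mean; apply/funext => x /=; rewrite opprK.
have law n : has_law (P := P n) (stable_cost (omega n)) (distribution L (U n)).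
  move=> A mA; rewrite (stable_cost_law d1 (iid n) emu iL mA).
  exact: (seq_cost_law d emu iL n mA).
have UD n x : U n x - mean L (U n) = D n x - mean L (D n).
  by rewrite EU /U/=; ring.
have Dxi : sqn_cvg L (fun n x => D n x - mean L (D n)) xi.
  exact: sqn_cvg_centred.
have mDc n : measurable_fun setT (fun x : S => D n x - mean L (D n)).
  exact: measurable_funB.
split.
  move=> x cx.
  have cdfE y : cdf xi y = L [set t | xi t <= y].
    rewrite /cdf /distribution/= /pushforward; congr (L _).
  rewrite cdfE.
  rewrite (_ : (fun n => cdf _ x) =
    fun n => L [set t | D n t - mean L (D n) <= x]); last first.
    apply/funext => n; rewrite (same_law_cdf_centred (law n)); congr (L _).
    by apply/seteqP; split => t /=; rewrite UD.
  apply: (sqn_cvg_cdf mDc mxi Dxi).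
  by move: cx; rewrite (_ : cdf xi = fun y => L [set t | xi t <= y])//; exact/funext.
rewrite Vxi (_ : (fun n => _) = fun n => sqn L (fun x : S => D n x - mean L (D n)));
  last first.
  apply/funext => n; rewrite (same_law_variance (law n)) variance_sqn.
  by apply: eq_integral => x _; rewrite UD.
apply: (sqn_cvg_sqn mDc mxi Dxi) => n.
by apply: (@sqnD_lty _ _ _ L (D n) (cst (- mean L (D n)))) => //; rewrite sqn_cst ltry.
Qed.
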